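(* Let $\tau_\pm:\mathcal{V}'^{\pm}_{3\text{-}dim}\times\mathring{\mathcal{W}}'_{1/2}\times\mathcal{V}^{\pm}_{3\text{-}dim}\to\mathbb{C}$ be the $\mathfrak{sp}(4,\mathbb{C})$-invariant trilinear forms $$\tau_\pm(g,F,f)=\frac{i}{8\pi^2}\int_{\widetilde\Gamma}g(Z)\cdot F(Z)\cdot f(Z)\,dZ^3,$$ and let $$E_+=\mathbb{C}\text{-span}\{N(Z)^{k+\frac12}\mathbf{T}^m_l,\ N(Z)^{k+\frac12}\mathbf{M}^m_l,\ \mathbf{C}^m_{k+\frac12,l}:\ k\ge-(l+1)\},$$ $$E_-=\mathbb{C}\text{-span}\{N(Z)^{k+\frac12}\mathbf{T}^m_l,\ N(Z)^{k+\frac12}\mathbf{M}^m_l,\ \mathbf{C}^m_{k+\frac32,l}:\ k\le-1\}$$ ($k\in\mathbb{Z}$, $l\ge0$, all admissible $m$), which are $\mathfrak{sp}(4,\mathbb{C})$-invariant subspaces of $(\rho'_2,\mathring{\mathcal{W}}'_{1/2})$ such that $\tau_+$ vanishes on $\mathcal{V}'^+_{3\text{-}dim}\times E_+\times\mathcal{V}^+_{3\text{-}dim}$ and $\tau_-$ vanishes on $\mathcal{V}'^-_{3\text{-}dim}\times E_-\times\mathcal{V}^-_{3\text{-}dim}$. Then the two induced invariant trilinear forms $$\mathcal{V}'^+_{3\text{-}dim}\times\bigl(\mathring{\mathcal{W}}'_{1/2}/E_+\bigr)\times\mathcal{V}^+_{3\text{-}dim}\to\mathbb{C},\qquad\mathcal{V}'^-_{3\text{-}dim}\times\bigl(\mathring{\mathcal{W}}'_{1/2}/E_-\bigr)\times\mathcal{V}^-_{3\text{-}dim}\to\mathbb{C}$$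 are non-trivial (not identically zero).
   Context: Let $Z=\begin{pmatrix} z_{11} & z_{12} \\ z_{12} & z_{22} \end{pmatrix}$ denote a complex symmetric $2\times2$ matrix, $z_{12}=it$; use coordinates $z_{11},z_{22},t$; $N(Z)=\det Z=z_{11}z_{22}+t^2$. $P=\mathbb{C}[z_{11},z_{12},z_{22},N(Z)^{-1}]$ and $N(Z)^{1/2}P$ is the corresponding space with half-integer powers of $N(Z)$. $\mathrm{Sym}$: complex symmetric $2\times2$ matrices; $\mathbb{S}=\mathbb{C}^2$ (columns), $\mathbb{S}'=\mathbb{C}^2$ (rows). $\partial=\begin{pmatrix} \partial_{z_{11}} & -\frac i2\partial_t \\ -\frac i2\partial_t & \partial_{z_{22}} \end{pmatrix}$, $\partial^+=\begin{pmatrix} \partial_{z_{22}} & \frac i2\partial_t \\ \frac i2\partial_t & \partial_{z_{11}} \end{pmatrix}$. $\mathcal{V}^+_{3\text{-}dim}=\{f\in\mathbb{S}\otimes P:\partial^+f=0\}$, $\mathcal{V}^-_{3\text{-}dim}=\{f\in\mathbb{S}\otimes N(Z)^{1/2}P:\partial^+f=0\}$, $\mathcal{V}'^+_{3\text{-}dim}=\{g\in\mathbb{S}'\otimes P:g\overleftarrow{\partial^+}=0\}$, $\mathcal{V}'^-_{3\text{-}dim}=\{g\in\mathbb{S}'\otimes N(Z)^{1/2}P:g\overleftarrow{\partial^+}=0\}$ (operator acting by right matrix multiplication). $\mathring{\mathcal{W}}'_{1/2}=\mathrm{Sym}\otimes N(Z)^{1/2}P$. $\mathfrak{sp}(4,\mathbb{C})=\{\begin{pmatrix}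 A & B \\ C & -A^T \end{pmatrix}:B^T=B,C^T=C\}$; $A,B,C$ stand for $\begin{pmatrix} A & 0 \\ 0 & -A^T \end{pmatrix}$, $\begin{pmatrix} 0 & B \\ 0 & 0 \end{pmatrix}$, $\begin{pmatrix} 0 & 0 \\ C & 0 \end{pmatrix}$. In every module $B$ acts by $-\mathrm{Tr}(B\partial)$. On $\mathring{\mathcal{W}}'_{1/2}$: $\rho'_2(A)F=-\mathrm{Tr}(AZ\partial+ZA^T\partial+2A)F+AF+FA^T$, $\rho'_2(C)F=\mathrm{Tr}(ZCZ\partial+2ZC)F-ZCF-FCZ$. On $\mathcal{V}^\pm_{3\text{-}dim}$: $A$ acts by $f\mapsto-\mathrm{Tr}(AZ\partial+ZA^T\partial+\frac12A)f-A^Tf$, $C$ by $f\mapsto\mathrm{Tr}(ZCZ\partial+\frac12CZ)f+CZf$. On $\mathcal{V}'^\pm_{3\text{-}dim}$: $A$ acts by $g\mapsto-\mathrm{Tr}(AZ\partial+ZA^T\partial+\frac12A)g-gA$, $C$ by $g\mapsto\mathrm{Tr}(ZCZ\partial+\frac12ZC)g+gZC$. Solid harmonics: $P^m_l(x)=\frac{(-1)^m}{2^ll!}(1-x^2)^{m/2}\frac{d^{l+m}}{dx^{l+m}}(x^2-1)^l$; for $l\ge0$, $|m|\le l$, $R^m_l(Z)$ is the homogeneous polynomial of degree $l$ in $z_{11},z_{22},t$ that for $z_{11}=z$, $z_{22}=\bar z$, $t\in\mathbb{R}$, $r=\sqrt{|z|^2+t^2}$ equals $r^l(z/|z|)^mP^m_l(t/r)$;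 $R^m_l=0$ if $|m|>l$ or $l<0$. Put $\mathbf{T}^m_l=\begin{pmatrix} R^{m+1}_l & i(l+m+1)R^m_l \\ i(l+m+1)R^m_l & -(l+m)(l+m+1)R^{m-1}_l \end{pmatrix}$ ($-l-1\le m\le l+1$), $\mathbf{M}^m_l=\begin{pmatrix} R^{m+1}_l & i m R^m_l \\ i m R^m_l & (l+m)(l-m+1)R^{m-1}_l \end{pmatrix}$ ($-l\le m\le l$), $\mathbf{B}^m_l=\begin{pmatrix} R^{m+1}_l & -i(l-m)R^m_l \\ -i(l-m)R^m_l & -(l-m)(l-m+1)R^{m-1}_l \end{pmatrix}$ ($-l+1\le m\le l-1$), $\mathbf{C}^m_{k+\frac12,l}=(2k+1)N(Z)^{k-\frac12}\mathbf{B}^m_{l+1}-2(k+l+1)N(Z)^{k+\frac12}\mathbf{T}^m_{l-1}$ ($k\in\mathbb{Z}$, $l\ge0$, $-l\le m\le l$; $\mathbf{T}_{-1}=0$). $\widetilde\Gamma=S^2\times S^1$, where $S^2=\{X=\begin{pmatrix} z & it \\ it & \bar z \end{pmatrix}:z\in\mathbb{C},t\in\mathbb{R},\det X=1\}$ and $S^1=\{\zeta\in\mathbb{C}:|\zeta|=1\}$; functions are pulled back to $\widetilde\Gamma$ via $(X,\zeta)\mapsto Z=\zeta X$, with $N(Z)^{1/2}=\zeta$. $dZ^3=dz^0\wedge dz^1\wedge dz^3$, where $z_{11}=z^0-iz^3$, $z_{22}=z^0+iz^3$, $z_{12}=-iz^1$. $\widetilde\Gamma$ is oriented so that at $(1,1)$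 the tangent vectors $\frac{1}{i}\begin{pmatrix} 1 & 0 \\ 0 & 1 \end{pmatrix}$, $\begin{pmatrix} 0 & -i \\ -i & 0 \end{pmatrix}$, $\begin{pmatrix} -i & 0 \\ 0 & i \end{pmatrix}$ (in this order) form a positive basis. *)

(* Defs.v *)
(* The complex numbers are R[i] for R : realType. *)
From HB Require Import structures.
From mathcomp Require Import all_boot all_order all_algebra.
From mathcomp Require Import complex.
From mathcomp Require Import all_classical all_reals all_analysis.

Set Implicit Arguments.
Unset Strict Implicit.
Unset Printing Implicit Defensive.

Import Order.TTheory GRing.Theory Num.Theory.
Import numFieldNormedType.Exports.

Local Open Scope classical_set_scope.
Local Open Scope ring_scope.

Section LinearAlgebra.

Definition lspan (K : nzRingType) (V : lmodType K) (S : set V) : set V :=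
  [set v | exists (n : nat) (a : 'I_n -> K) (b : 'I_n -> V),
     (forall i, S (b i)) /\ v = \sum_(i < n) a i *: b i].

Definition lsubspace (K : nzRingType) (V : lmodType K) (W E : set V) : Prop :=
  [/\ E `<=` W, E 0 & forall a u v, E u -> E v -> E (a *: u + v)].

Definition coset_mod (V : zmodType) (E : set V) (v : V) : set V :=
  [set w | E (w - v)].

Definition quotient_space (V : zmodType) (W E : set V) : set (set V) :=
  coset_mod E @` W.

Definition trilinear_on (K : nzRingType) (U V W : lmodType K)
    (A : set U) (B : set V) (D : set W) (tau : U -> V -> W -> K) : Prop :=
  [/\ forall a g g' F f, A g -> A g' -> B F -> D f ->
        tau (a *: g + g') F f = a * tau g F f + tau g' F f,
      forall a g F F' f, A g -> B F -> B F' -> D f ->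
        tau g (a *: F + F') f = a * tau g F f + tau g F' f
    & forall a g F f f', A g -> B F -> D f -> D f' ->
        tau g F (a *: f + f') = a * tau g F f + tau g F f'].

End LinearAlgebra.

Section Functions.
Variable R : realType.
Local Notation C := R[i].
Local Notation i := ('i%C : C).

(* A point is the triple of coordinates (z11, z22, t). *)
Definition pt : Type := (C * C * C)%type.
Definition z11 (u : pt) : C := u.1.1.
Definition z22 (u : pt) : C := u.1.2.
Definition ct (u : pt) : C := u.2.
Definition z12 (u : pt) : C := i * ct u.

Definition symmx (a b d : C) : 'M[C]_2 :=
  \matrix_(p < 2, q < 2) nth 0 [:: a; b; d] (p + q)%N.

Definition Zmx (u : pt) : 'M[C]_2 := symmx (z11 u) (z12 u) (z22 u).
Definition NZ (u : pt) : C := \det (Zmx u).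

(* The domain N(Z) <> 0.  Elements of N(Z)^(1/2) P are not functions on it:
   throughout, at level e : nat, a function h on reg stands for the element
   N(Z)^(e/2) h.  Thus P is level 0, N(Z)^(1/2) P is level 1, and products add
   levels.  Differentiation depends on the level, see [pder]. *)
Definition reg : Type := {u : pt | NZ u != 0}.

Definition ext0 (h : reg -> C) (u : pt) : C := oapp h 0 (insub u).

Definition zcoord (j : 'I_3) (u : pt) : C := nth 0 [:: z11 u; z22 u; ct u] j.

Definition upd (j : 'I_3) (u : pt) (w : C) : pt :=
  nth u [:: (w, z22 u, ct u); (z11 u, w, ct u); (z11 u, z22 u, w)] j.

Definition partial (j : 'I_3) (h : pt -> C) (u : pt) : C :=
  derive1 (fun w : C^o => h (upd j u w) : C^o) (zcoord j u).

(* N^(-e/2) d_j (N^(e/2) h), where d_j is the derivative in the j-th of the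
   coordinates z11, z22, t; reg is open, so extending h by 0 is harmless. *)
Definition pder (e : nat) (j : 'I_3) (h : reg -> C) (u : reg) : C :=
  partial j (ext0 h) (val u)
  + e%:R / 2 * (partial j NZ (val u) / NZ (val u)) * h u.

Definition d_z11 e := pder e (inord 0).
Definition d_z22 e := pder e (inord 1).
Definition d_t e := pder e (inord 2).

Definition dZ (e : nat) (p q : 'I_2) (h : reg -> C) (u : reg) : C :=
  nth 0 [:: d_z11 e h u; - (i / 2) * d_t e h u; d_z22 e h u] (p + q)%N.

Definition dZplus (e : nat) (p q : 'I_2) (h : reg -> C) (u : reg) : C :=
  nth 0 [:: d_z22 e h u; i / 2 * d_t e h u; d_z11 e h u] (p + q)%N.

Section Matrices.
Variables m n : nat.

Definition entry (F : reg -> 'M[C]_(m, n)) p q : reg -> C^o := fun u => F u p q.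

(* Tr(M d) F *)
Definition tr_dZ (e : nat) (M : reg -> 'M[C]_2) (F : reg -> 'M[C]_(m, n)) :
    reg -> 'M[C]_(m, n) :=
  fun u => \matrix_(a, b)
    \sum_(p < 2) \sum_(q < 2) M u p q * dZ e q p (entry F a b) u.

End Matrices.

Definition laurent_monomial (a b c : nat) (k : int) : reg -> C^o :=
  fun u => z11 (val u) ^+ a * z22 (val u) ^+ b * z12 (val u) ^+ c
           * NZ (val u) ^ k.

Definition P : set (reg -> C^o) :=
  lspan [set h | exists a b c k, h = laurent_monomial a b c k].

Definition mxP (m n : nat) : set (reg -> 'M[C]_(m, n)) :=
  [set F | forall p q, P (entry F p q)].

(* Sym (x) N(Z)^(1/2) P, at level 1 *)
Definition W : set (reg -> 'M[C]_2) :=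
  [set F | mxP F /\ forall u, (F u)^T = F u].

(* e = 0 : V^+ and V'^+ ; e = 1 : V^- and V'^- *)
Definition Vcol (e : nat) : set (reg -> 'cV[C]_2) :=
  [set f | mxP f /\
     forall u p, \sum_(q < 2) dZplus e p q (entry f q 0) u = 0].

Definition Vrow (e : nat) : set (reg -> 'rV[C]_2) :=
  [set g | mxP g /\
     forall u q, \sum_(p < 2) dZplus e p q (entry g 0 p) u = 0].

End Functions.

Section Actions.
Variable R : realType.
Local Notation C := R[i].
Local Notation Z u := (Zmx (val u)).

Definition sp4 : set 'M[C]_(2 + 2) :=
  [set X | [/\ drsubmx X = - (ulsubmx X)^T,
               (ursubmx X)^T = ursubmx X & (dlsubmx X)^T = dlsubmx X]].

Definition actB m n (e : nat) (B : 'M[C]_2) (F : reg R -> 'M[C]_(m, n)) :=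
  - tr_dZ e (fun=> B) F.

Definition vecA (A : 'M[C]_2) (u : reg R) : 'M[C]_2 := A *m Z u + Z u *m A^T.
Definition vecC (K : 'M[C]_2) (u : reg R) : 'M[C]_2 := Z u *m K *m Z u.

Definition actW (X : 'M[C]_(2 + 2)) (F : reg R -> 'M[C]_2) : reg R -> 'M[C]_2 :=
  let A := ulsubmx X in let K := dlsubmx X in
  fun u =>
    (- (tr_dZ 1 (vecA A) F u + \tr (2 *: A) *: F u) + A *m F u + F u *m A^T)
    + actB 1 (ursubmx X) F u
    + (tr_dZ 1 (vecC K) F u + \tr (2 *: (Z u *m K)) *: F u
       - Z u *m K *m F u - F u *m K *m Z u).

Definition actV (e : nat) (X : 'M[C]_(2 + 2)) (f : reg R -> 'cV[C]_2) :
    reg R -> 'cV[C]_2 :=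
  let A := ulsubmx X in let K := dlsubmx X in
  fun u =>
    (- (tr_dZ e (vecA A) f u + \tr (2^-1 *: A) *: f u) - A^T *m f u)
    + actB e (ursubmx X) f u
    + (tr_dZ e (vecC K) f u + \tr (2^-1 *: (K *m Z u)) *: f u
       + K *m Z u *m f u).

Definition actV' (e : nat) (X : 'M[C]_(2 + 2)) (g : reg R -> 'rV[C]_2) :
    reg R -> 'rV[C]_2 :=
  let A := ulsubmx X in let K := dlsubmx X in
  fun u =>
    (- (tr_dZ e (vecA A) g u + \tr (2^-1 *: A) *: g u) - g u *m A)
    + actB e (ursubmx X) g u
    + (tr_dZ e (vecC K) g u + \tr (2^-1 *: (Z u *m K)) *: g u
       + g u *m Z u *m K).

End Actions.

Section Integration.
Variable R : realType.
Local Notation C := R[i].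
Local Notation i := ('i%C : C).

Definition cis (x : R) : C := (cos x +i* sin x)%C.

Definition S2pt (theta phi : R) : pt R :=
  ((sin theta)%:C%C * cis phi, (sin theta)%:C%C * cis (- phi),
   (cos theta)%:C%C).

Definition dilate (zeta : C) (u : pt R) : pt R :=
  (zeta * z11 u, zeta * z22 u, zeta * ct u).

(* (X, zeta) |-> zeta X composed with the parametrization of S^2 x S^1 by
   0 <= theta <= pi and 0 <= phi, alpha <= 2 pi, which is one-to-one off a null
   set. *)
Definition gam (theta phi alpha : R) : pt R :=
  dilate (cis alpha) (S2pt theta phi).

Definition cder (f : R -> C) (x : R) : C :=
  (derive1 (fun y => complex.Re (f y)) x +i*
   derive1 (fun y => complex.Im (f y)) x)%C.

(* z11 = z^0 - i z^3, z22 = z^0 + i z^3, z12 = - i z^1 *)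
Definition z013 (p : 'I_3) (u : pt R) : C :=
  nth 0 [:: (z11 u + z22 u) / 2; i * z12 u; i * (z11 u - z22 u) / 2] p.

(* dz^0 /\ dz^1 /\ dz^3 evaluated on (d_theta, d_phi, d_alpha), in this order.
   At X = 1, zeta = 1, that is theta = pi/2, phi = alpha = 0, the basis fixing
   the orientation is (- d_alpha, d_theta, - d_phi), an even rearrangement of
   (d_theta, d_phi, d_alpha), so that the parametrization is positive. *)
Definition dZ3 (theta phi alpha : R) : C :=
  \det (\matrix_(p < 3, q < 3)
    nth 0 [:: cder (fun x => z013 p (gam x phi alpha)) theta;
              cder (fun x => z013 p (gam theta x alpha)) phi;
              cder (fun x => z013 p (gam theta phi x)) alpha] q).

Definition cint (a b : R) (f : R -> C) : C :=
  ((\int[lebesgue_measure]_(x in `[a, b]) complex.Re (f x)) +i*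
   (\int[lebesgue_measure]_(x in `[a, b]) complex.Im (f x)))%C.

(* Integral of N(Z)^(e/2) h(Z) dZ^3; note that N(Z)^(1/2) is pulled back to
   zeta. *)
Definition int_Gamma (e : nat) (h : reg R -> C) : C :=
  cint 0 pi (fun theta => cint 0 (2 * pi) (fun phi =>
    cint 0 (2 * pi) (fun alpha =>
      cis alpha ^+ e * ext0 h (gam theta phi alpha) * dZ3 theta phi alpha))).

Definition tau (e : nat) (g : reg R -> 'rV[C]_2) (F : reg R -> 'M[C]_2)
    (f : reg R -> 'cV[C]_2) : C :=
  i / (8 * pi ^+ 2)%:C%C
  * int_Gamma (e + 1 + e)%N (fun u => (g u *m F u *m f u) 0 0).

End Integration.

Section Harmonics.
Variable R : realType.
Local Notation C := R[i].
Local Notation i := ('i%C : C).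

Definition homogeneous_poly (l : nat) : set (pt R -> C^o) :=
  lspan [set h | exists a b c, (a + b + c = l)%N /\
                   h = fun u => z11 u ^+ a * z22 u ^+ b * ct u ^+ c].

(* used for - l <= m only *)
Definition legendreP (l : nat) (m : int) (x : R) : R :=
  (-1) ^ m / (2 ^+ l * l`!%:R) * Num.sqrt (1 - x ^+ 2) ^ m
  * (derivn (absz (l%:Z + m)) (('X^2 - 1) ^+ l)).[x].

(* Requiring the formula for z != 0 already determines the polynomial h; at
   z = 0 the factor z / |z| is not defined. *)
Definition is_solid_harmonic (l : nat) (m : int) (h : pt R -> C^o) : Prop :=
  homogeneous_poly l h /\
  forall (z : C) (t : R), z != 0 ->
    let r := Num.sqrt (complex.Re (`|z| ^+ 2) + t ^+ 2) in
    h (z, (z^*)%C, t%:C%C)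
    = (r ^+ l)%:C%C * (z / `|z|) ^ m * (legendreP l m (t / r))%:C%C.

Definition solidR (l m : int) : pt R -> C^o :=
  if (0 <= l) && (`|m| <= l) then
    xget (fun=> 0) [set h | is_solid_harmonic (absz l) m h]
  else fun=> 0.

Definition matT (l m : int) (u : pt R) : 'M[C]_2 :=
  symmx (solidR l (m + 1) u)
        (i * (l + m + 1)%:~R * solidR l m u)
        (- ((l + m) * (l + m + 1))%:~R * solidR l (m - 1) u).

Definition matM (l m : int) (u : pt R) : 'M[C]_2 :=
  symmx (solidR l (m + 1) u)
        (i * m%:~R * solidR l m u)
        (((l + m) * (l - m + 1))%:~R * solidR l (m - 1) u).

Definition matB (l m : int) (u : pt R) : 'M[C]_2 :=
  symmx (solidR l (m + 1) u)
        (- (i * (l - m)%:~R) * solidR l m u)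
        (- ((l - m) * (l - m + 1))%:~R * solidR l (m - 1) u).

(* The level-1 representatives of N^(k+1/2) T, N^(k+1/2) M and C_(k+1/2,l). *)
Definition NT (k l m : int) : reg R -> 'M[C]_2 :=
  fun u => NZ (val u) ^ k *: matT l m (val u).
Definition NM (k l m : int) : reg R -> 'M[C]_2 :=
  fun u => NZ (val u) ^ k *: matM l m (val u).
Definition NC (k l m : int) : reg R -> 'M[C]_2 :=
  fun u => (2 * k + 1)%:~R * NZ (val u) ^ (k - 1) *: matB (l + 1) m (val u)
           - (2 * (k + l + 1))%:~R * NZ (val u) ^ k *: matT (l - 1) m (val u).

Definition Eplus : set (reg R -> 'M[C]_2) :=
  lspan [set F | exists k l m : int, [/\ 0 <= l, - (l + 1) <= k &
    [\/ - l - 1 <= m <= l + 1 /\ F = NT k l m,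
        - l <= m <= l /\ F = NM k l m
      | - l <= m <= l /\ F = NC k l m]]].

Definition Eminus : set (reg R -> 'M[C]_2) :=
  lspan [set F | exists k l m : int, [/\ 0 <= l, k <= -1 &
    [\/ - l - 1 <= m <= l + 1 /\ F = NT k l m,
        - l <= m <= l /\ F = NM k l m
      | - l <= m <= l /\ F = NC (k + 1) l m]]].

End Harmonics.

Section Forms.
Variable R : realType.
Local Notation C := R[i].

Definition tau_sp4_invariant (e : nat) : Prop :=
  forall X g F f, sp4 X -> Vrow e g -> W F -> Vcol e f ->
    tau e (actV' e X g) F f + tau e g (actW X F) f + tau e g F (actV e X f)
    = 0 :> C.

Definition sp4_stable (E : set (reg R -> 'M[C]_2)) : Prop :=
  forall X F, sp4 X -> E F -> E (actW X F).

Definition tau_vanishes (e : nat) (E : set (reg R -> 'M[C]_2)) : Prop :=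
  forall g F f, Vrow e g -> E F -> Vcol e f -> tau e g F f = 0 :> C.

Definition induced_form (e : nat) (E : set (reg R -> 'M[C]_2))
    (beta : (reg R -> 'rV[C]_2) -> set (reg R -> 'M[C]_2) ->
            (reg R -> 'cV[C]_2) -> C) : Prop :=
  forall g F f, Vrow e g -> W F -> Vcol e f ->
    beta g (coset_mod E F) f = tau e g F f.

Definition nontrivial_form (e : nat) (E : set (reg R -> 'M[C]_2))
    (beta : (reg R -> 'rV[C]_2) -> set (reg R -> 'M[C]_2) ->
            (reg R -> 'cV[C]_2) -> C) : Prop :=
  exists g Q f, [/\ Vrow e g, quotient_space (@W R) E Q, Vcol e f &
    beta g Q f != 0].

End Forms.

(* Main.v *)
(* Put Q = - z22 + 2 t X + z11 X^2.  Up to nonzero factors the coefficients of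
   Q^l are the solid harmonics R_l^m, and the coefficients of all N^k Q^l span P.
   The Laplacian d_z11 d_z22 + d_t^2 / 4 maps N^s Q^l to
   s (s + l + 1/2) N^(s-1) Q^l.  Components of elements of V'^+ and V^+ are
   harmonic, hence combinations of coefficients of Q^l; components of elements of
   V'^- and V^-, and also of g Z and Z f for such g and f, are combinations of
   coefficients of N^(-l-1/2) Q^l.

   E_+ consists of the symmetric matrices with entries in the span of the
   N^(k+1/2) Q^l with k >= - l - 1, and E_- of the Z H Z with H symmetric with
   entries in the span of the N^(k+1/2) Q^l with k <= - 2; invariance is easy to
   see on these descriptions.  The integral of a derivative over the cycle is 0.
   This gives the invariance of tau, and, through the Euler field and the
   self-adjointness of the Laplacian, the vanishing of the integral of
   N^s Q^L * Q^l unless L = l and 2 s + 2 l = - 3.  The exponents occurring in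
   g F f = (g Z) H (Z f) never satisfy these equalities.

   Non-triviality: for tau_+ take g = e1^T, F = N^(-3/2) E11, f = e1; for tau_- take f = N^(-3/2) Z^+ e1, g = f^T, F = N^(-1/2) Z E11 Z, where
   Z^+ is the adjugate of Z. *)
Require Import Defs.
From HB Require Import structures.
From mathcomp Require Import all_boot all_order all_algebra.
From mathcomp Require Import complex ring lra zify.
From mathcomp Require Import all_classical all_reals all_analysis.
Set Implicit Arguments.
Unset Strict Implicit.
Unset Printing Implicit Defensive.
Import Order.TTheory GRing.Theory Num.Theory.
Import numFieldNormedType.Exports.
Local Open Scope classical_set_scope.
Local Open Scope ring_scope.

(** Working with Q^l instead of the individual R_l^m replaces identities between Legendre functions
    by polynomial identities in X, one for all m. Multiplication by a coordinate sends the bidegree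
    (k, l) of N^k Q^l to (k, l + 1) and (k + 1, l - 1), a derivative sends it to (k - 1, l + 1) and
    (k, l - 1); closure of a span thus becomes arithmetic on pairs of integers. Its coefficient
    vanishes there, and the thresholds in E_+ and E_- are exactly those at which this happens.

    Multiplication by a coordinate raises the exponent of N, which the bound k <= - 2 does not
    tolerate, while multiplication by an entry of Z^(-1) does not raise it; hence E_- is studied
    through H = Z^(-1) F Z^(-1).

    Linear independence of the coefficients of the N^k Q^l is never established: the kernel of the
    Laplacian is found by an eigenvalue argument that does without it. Half-integer powers enter
    only through the level e, which turns the exponent k into k + e/2 in derivatives. *)

Local Notation NV u := (NZ (val u)).
Local Notation j0 := (inord 0 : 'I_3).
Local Notation j1 := (inord 1 : 'I_3).
Local Notation j2 := (inord 2 : 'I_3).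

(** * Subspaces *)

Section Spans.
Variables (K : nzRingType) (V : lmodType K).
Implicit Types S T : set V.

Definition subsp S : Prop := S 0 /\ forall a u v, S u -> S v -> S (a *: u + v).

Lemma subspD S u v : subsp S -> S u -> S v -> S (u + v).
Proof. by move=> [_ h] hu hv; rewrite -[u]scale1r; apply: h. Qed.

Lemma subspZ S a u : subsp S -> S u -> S (a *: u).
Proof. by move=> [h0 h] hu; rewrite -[_ *: _]addr0; apply: h. Qed.

Lemma subspB S u v : subsp S -> S u -> S v -> S (u - v).
Proof. by move=> hS hu hv; rewrite addrC -scaleN1r; apply: hS.2. Qed.

Lemma subsp_sum S (I : Type) (r : seq I) (Q : pred I) (F : I -> V) :
  subsp S -> (forall i, Q i -> S (F i)) -> S (\sum_(i <- r | Q i) F i).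
Proof.
move=> hS hF; apply: (big_ind S) => //; first exact: hS.1.
by move=> u v; apply: subspD.
Qed.

Lemma lspan_subsp S : subsp (lspan S).
Proof.
split; first by exists 0%N, (fun=> 0), (fun=> 0); split=> [[]|] //; rewrite big_ord0.
move=> c u v [n [a [b [hb ->]]]] [n' [a' [b' [hb' ->]]]].
exists (n + n')%N,
  (fun i => match fintype.split i with inl j => c * a j | inr j => a' j end),
  (fun i => match fintype.split i with inl j => b j | inr j => b' j end); split.
  by move=> i; case: (fintype.split i).
rewrite big_split_ord /= scaler_sumr; congr (_ + _); apply: eq_bigr => i _.
  by rewrite (unsplitK (inl i : 'I_n + 'I_n')) scalerA.
by rewrite (unsplitK (inr i : 'I_n + 'I_n')).
Qed.

Lemma lspan_gen S u : S u -> lspan S u.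
Proof.
move=> hu; exists 1%N, (fun=> 1), (fun=> u); split=> //.
by rewrite big_ord1 scale1r.
Qed.

Lemma lspan_min S T : subsp T -> S `<=` T -> lspan S `<=` T.
Proof.
move=> hT hS u [n [a [b [hb ->]]]]; apply: subsp_sum => // i _.
by apply: subspZ => //; apply: hS.
Qed.

End Spans.

(** * Derivatives *)

Section Derivatives.
Variable R : realType.
Local Notation C := R[i].
Local Notation reg := (reg R).
Local Notation Fn := (reg -> C^o).

(** The gradient of N. Up to order and a factor 2 its components are again the coordinates, so
    closure under multiplication by all [nN j] is closure under multiplication by the
    coordinates. *)
Definition nN (j : 'I_3) (u : pt R) : C := nth 0 [:: z22 u; z11 u; 2 * ct u] j.

Lemma NZE (u : pt R) : NZ u = z11 u * z22 u + ct u ^+ 2.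
Proof.
rewrite /NZ (expand_det_row _ 0) !big_ord_recl big_ord0 /= addr0 /cofactor.
rewrite !det_mx11 !mxE /= /z12.
have h : ('i%C : C) * 'i%C = -1 by rewrite -expr2 sqr_i.
rewrite /bump /= !(addn0,add0n,addn1) expr0 expr1 mul1r.
by ring: h.
Qed.

Lemma Nneq0 (u : reg) : NV u != 0. Proof. exact: (valP u). Qed.

Section Univariate.
Implicit Types (f g : C -> C) (x a b : C).

Definition isd f x a : Prop :=
  is_derive (x : C^o) (1 : C^o) (f : C^o -> C^o) (a : C^o).

Lemma isd_cst c x : isd (fun=> c) x 0.
Proof. exact: is_derive_cst. Qed.

Lemma isd_id x : isd id x 1.
Proof. exact: is_derive_id. Qed.

Lemma isdD f g x a b : isd f x a -> isd g x b -> isd (fun y => f y + g y) x (a + b).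
Proof. by move=> hf hg; apply: is_deriveD. Qed.

Lemma isdM f g x a b : isd f x a -> isd g x b ->
  isd (fun y => f y * g y) x (a * g x + f x * b).
Proof.
move=> hf hg; have h := is_deriveM hf hg.
by apply: (is_derive_eq h); rewrite /GRing.scale /= addrC (mulrC (g x)).
Qed.

Lemma isd_eq f x a b : isd f x a -> a = b -> isd f x b.
Proof. by move=> h <-. Qed.

Lemma isd_val f x a : isd f x a -> derive1 (f : C^o -> C^o) x = a.
Proof. by move=> h; rewrite derive1E (@derive_val _ _ _ _ _ _ _ h). Qed.

Lemma isd_near f g x a : (\forall y \near (x : C^o), f y = g y) -> isd f x a -> isd g x a.
Proof. by move=> h; apply: near_eq_is_derive. Qed.

End Univariate.
Lemma upd_zcoord j (u : pt R) : upd j u (zcoord j u) = u.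
Proof. by case: j => [] [|[|[|]]] //; case: u => [] []. Qed.

(** A relation rather than an operation: it carries differentiability at every regular point
    together with the value, at level 0. *)
Definition pd0 j (h d : Fn) : Prop := forall u : reg,
  isd (fun w => ext0 h (upd j (val u) w)) (zcoord j (val u)) (d u).

Lemma isd_NZ j (u : pt R) : isd (fun w => NZ (upd j u w)) (zcoord j u) (nN j u).
Proof.
case: u => [[a b] c]; rewrite (_ : (fun _ => _) =
  (fun w => z11 (upd j (a,b,c) w) * z22 (upd j (a,b,c) w) + ct (upd j (a,b,c) w) * ct (upd j (a,b,c) w))); last first.
  by apply/funext => w; rewrite NZE expr2.
case: j => [] [|[|[|//]]] lt; rewrite /upd /zcoord /nN /= /z11 /z22 /ct /=.
- by apply: isd_eq; [apply: isdD; [apply: isdM; [exact: isd_id|exact: isd_cst]|exact: isd_cst]|rewrite mul1r mulr0 !addr0].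
- by apply: isd_eq; [apply: isdD; [apply: isdM; [exact: isd_cst|exact: isd_id]|exact: isd_cst]|rewrite mulr1 mul0r !(add0r,addr0)].
- by apply: isd_eq; [apply: isdD; [exact: isd_cst|apply: isdM; [exact: isd_id|exact: isd_id]]|rewrite add0r mulr1 mul1r mulr_natl mulr2n].
Qed.

Lemma isdV f x a : isd f x a -> f x != 0 ->
  isd (fun y => (f y)^-1) x (- a / f x ^+ 2).
Proof.
move=> hf fx; apply: DeriveDef.
  by apply: derivableV => //; case: hf.
by rewrite deriveV //; case: hf => // _ ->; rewrite /GRing.scale /= mulrC mulrN mulNr.
Qed.

Lemma isd_continuous f x a : isd f x a -> {for (x : C^o), continuous (f : C^o -> C^o)}.
Proof. by move=> [h _]; apply: differentiable_continuous; apply/derivable1_diffP. Qed.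

Lemma near_reg j (u : pt R) : NZ u != 0 ->
  \forall w \near (zcoord j u : C^o), NZ (upd j u w) != 0.
Proof.
move=> hu; have h := isd_continuous (isd_NZ j u).
by apply: (cvgr_neq0 _ h); rewrite upd_zcoord.
Qed.

Lemma ext0E (h : Fn) (u : pt R) (hu : NZ u != 0) : ext0 h u = h (exist _ u hu).
Proof. by rewrite /ext0 insubT. Qed.

Lemma ext0_val (h : Fn) (u : reg) : ext0 h (val u) = h u.
Proof. by rewrite /ext0 valK. Qed.

(** N stays nonzero near a regular point along each coordinate line, so there the extension by 0
    agrees with [h]. *)
Lemma pd0_ext (h : pt R -> C) j (d : Fn) :
  (forall u : reg, isd (fun w => h (upd j (val u) w)) (zcoord j (val u)) (d u)) ->
  pd0 j (fun u => h (val u)) d.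
Proof.
move=> hd u; apply: isd_near (hd u).
near=> w; rewrite ext0E //; near: w; exact: near_reg (valP u).
Unshelve. all: by end_near. Qed.

Lemma pd0_eq j (h d d' : Fn) : pd0 j h d -> d =1 d' -> pd0 j h d'.
Proof. by move=> hd /funext <-. Qed.

Lemma pd0_cst c j : pd0 j (fun=> c) (fun=> 0).
Proof. by apply: (@pd0_ext (fun=> c)) => u; exact: isd_cst. Qed.

Lemma ext0D (g h : Fn) v : ext0 (fun u => g u + h u) v = ext0 g v + ext0 h v.
Proof. by rewrite /ext0; case: insub => //=; rewrite addr0. Qed.

Lemma ext0M (g h : Fn) v : ext0 (fun u => g u * h u) v = ext0 g v * ext0 h v.
Proof. by rewrite /ext0; case: insub => //=; rewrite mulr0. Qed.

Lemma ext0V (g : Fn) v : ext0 (fun u => (g u)^-1) v = (ext0 g v)^-1.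
Proof. by rewrite /ext0; case: insub => //=; rewrite invr0. Qed.

Lemma pd0D j (g h dg dh : Fn) : pd0 j g dg -> pd0 j h dh ->
  pd0 j (fun u => g u + h u) (fun u => dg u + dh u).
Proof.
move=> hg hh u; rewrite (_ : (fun _ => _) = (fun w => ext0 g (upd j (val u) w) +
  ext0 h (upd j (val u) w))); first exact: isdD.
by apply/funext => w; rewrite ext0D.
Qed.

Lemma pd0M j (g h dg dh : Fn) : pd0 j g dg -> pd0 j h dh ->
  pd0 j (fun u => g u * h u) (fun u => dg u * h u + g u * dh u).
Proof.
move=> hg hh u; rewrite (_ : (fun _ => _) = (fun w => ext0 g (upd j (val u) w) *
  ext0 h (upd j (val u) w))); last by apply/funext => w; rewrite ext0M.
have := isdM (hg u) (hh u).
by rewrite upd_zcoord !ext0_val.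
Qed.

Lemma pd0Z j (c : C) (h dh : Fn) : pd0 j h dh ->
  pd0 j (fun u => c * h u) (fun u => c * dh u).
Proof.
move=> hh; apply: (pd0_eq (pd0M (pd0_cst c j) hh)) => u.
by rewrite mul0r add0r.
Qed.

Lemma pd0_sum j (I : Type) (r : seq I) (g dg : I -> Fn) :
  (forall a, pd0 j (g a) (dg a)) ->
  pd0 j (fun u => \sum_(a <- r) g a u) (fun u => \sum_(a <- r) dg a u).
Proof.
move=> hg; elim: r => [|a r IH].
  rewrite (_ : (fun _ => _) = fun=> 0); last by apply/funext => u; rewrite big_nil.
  by apply: (pd0_eq (pd0_cst 0 j)) => u; rewrite big_nil.
rewrite (_ : (fun _ => _) = fun u => g a u + \sum_(b <- r) g b u); last first.
  by apply/funext => u; rewrite big_cons.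
by apply: (pd0_eq (pd0D (hg a) IH)) => u; rewrite big_cons.
Qed.

Lemma pd0_N j : pd0 j (fun u => NV u) (fun u => nN j (val u)).
Proof. by apply: pd0_ext => u; exact: isd_NZ. Qed.

Lemma NexpS (u : reg) (k : int) : NV u ^ (k + 1) = NV u ^ k * NV u.
Proof. by rewrite expfzDr ?Nneq0 // expr1z. Qed.

Lemma NexpP (u : reg) (k : int) : NV u ^ (k - 1) = NV u ^ k / NV u.
Proof. by rewrite expfzDr ?Nneq0 // exprN1. Qed.

Lemma pd0_Nexp j (k : int) :
  pd0 j (fun u => NV u ^ k) (fun u => k%:~R * NV u ^ (k - 1) * nN j (val u)).
Proof.
have hn (n : nat) : pd0 j (fun u => NV u ^+ n)
    (fun u => n%:R * NV u ^ (n%:Z - 1) * nN j (val u)).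
  elim: n => [|n IH].
    by apply: (pd0_eq (pd0_cst 1 j)) => u; rewrite !mul0r.
  rewrite (_ : (fun _ => _) = fun u => NV u * NV u ^+ n); last first.
    by apply/funext => u; rewrite exprS.
  apply: (pd0_eq (pd0M (pd0_N j) IH)) => u.
  rewrite -addn1 PoszD addrK natrD -exprnP.
  rewrite NexpP -exprnP; by field; exact: Nneq0.
case: k => n; first exact: hn.
rewrite NegzE.
rewrite (_ : (fun u => _ ^ _) = fun u => (NV u ^+ n.+1)^-1); last first.
  by apply/funext => u; rewrite -exprnN.
move=> u; have := isdV (hn n.+1 u).
rewrite upd_zcoord (ext0_val (fun u => NV u ^+ n.+1)) expf_neq0 ?Nneq0 // => /(_ isT) h.
rewrite (_ : (fun w => _) = fun y => (ext0 (fun u0 => NV u0 ^+ n.+1) (upd j (val u) y))^-1); last first.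
  by apply/funext => w; rewrite ext0V.
apply: (isd_eq h).
rewrite !NexpP -exprnN -exprnP mulrNz -pmulrn.
have := Nneq0 u; set x := NV u => x0.
have x1 : x ^+ n != 0 by rewrite expf_neq0.
by rewrite !exprS; field; apply/andP.
Qed.

Lemma pd0_coord j :
  [/\ pd0 j (fun u => z11 (val u)) (fun=> nth 0 [:: 1; 0; 0] j),
      pd0 j (fun u => z22 (val u)) (fun=> nth 0 [:: 0; 1; 0] j) &
      pd0 j (fun u => ct (val u)) (fun=> nth 0 [:: 0; 0; 1] j)].
Proof.
by split; apply: pd0_ext => -[[[a b] c] /= _]; case: j => [] [|[|[|//]]] ?;
   rewrite /upd /zcoord /=; (exact: isd_id || exact: isd_cst).
Qed.

Lemma pd0_partial j (h d : Fn) u : pd0 j h d -> partial j (ext0 h) (val u) = d u.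
Proof. by move=> /(_ u)/isd_val. Qed.

Lemma pderE e j (h d : Fn) u : pd0 j h d ->
  pder e j h u = d u + e%:R / 2 * (nN j (val u) / NV u) * h u.
Proof.
move=> hd; rewrite /pder (pd0_partial u hd).
by rewrite /partial (isd_val (isd_NZ j (val u))).
Qed.

End Derivatives.

(** * Powers of the generating function *)

Section GeneratingFunction.
Variable R : realType.
Local Notation C := R[i].
Local Notation reg := (reg R).
Local Notation Fn := (reg -> C^o).

(* The generating function of the solid harmonics: see [solidRE]. *)
Definition Qp (u : pt R) : {poly C} :=
  (- z22 u)%:P + (2 * ct u)%:P * 'X + (z11 u)%:P * 'X^2.

(** The gradient of Q. It does not depend on the point, and it is isotropic for the Laplacian: X^2
    (-1) + (2 X)^2 / 4 = 0. *)
Definition dQ (j : 'I_3) : {poly C} := nth 0 [:: 'X^2; -1; 2 *: 'X] j.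

Lemma deriv_Qp u : (Qp u)^`() = (2 * ct u)%:P + (2 * z11 u)%:P * 'X.
Proof.
rewrite /Qp !derivD !derivM !derivC !derivX.
by rewrite !(polyCM, polyCN, polyCD, polyC_natr); ring.
Qed.

Lemma deriv2_Qp u : (Qp u)^`()^`() = (2 * z11 u)%:P.
Proof. by rewrite deriv_Qp !derivD !derivM !derivC derivX mul0r !add0r mulr1. Qed.

(** The discriminant of Q as a quadratic polynomial in X is 4 N. *)
Lemma Qp_discriminant u :
  (Qp u)^`() ^+ 2 = (4 * NZ u)%:P + (4 * z11 u)%:P * Qp u.
Proof. by rewrite deriv_Qp NZE /Qp !(polyCM, polyCD, polyCN, polyC_exp); ring. Qed.

Lemma deriv_Qpl u l : ((Qp u) ^+ l.+1)^`() = l.+1%:R *: (Qp u ^+ l * (Qp u)^`()).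
Proof. by rewrite deriv_exp -scaler_nat mulrC. Qed.

(** The square of Q' is eliminated by the discriminant. Read backwards, this expresses z11 Q^l
    through X-derivatives of Q^(l+1) and N Q^(l-1). *)
Lemma deriv2_Qpl u l : ((Qp u) ^+ l.+1)^`()^`() =
  l.+1%:R *: ((2 * l%:R + 1) *: ((2 * z11 u) *: Qp u ^+ l)
              + (4 * l%:R * NZ u) *: Qp u ^+ l.-1).
Proof.
rewrite deriv_Qpl derivZ; congr (_ *: _).
rewrite derivM deriv2_Qp; case: l => [|l].
  rewrite expr0 -(polyC1 C) derivC -!mul_polyC.
  by rewrite !(polyCM, polyCD, polyC_natr) /=; ring.
rewrite deriv_Qpl -!mul_polyC.
have -> x : x%:P * (Qp u ^+ l * (Qp u)^`()) * (Qp u)^`() =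
  x%:P * Qp u ^+ l * (Qp u)^`() ^+ 2 by ring.
rewrite Qp_discriminant exprS.
by rewrite !(polyCM, polyCD, polyC_natr) /=; ring.
Qed.

(* The part of (2 l + 1) n_j Q^l, with n_j = d_j N, that is built from Q^(l+1)
   and its derivatives, hence is harmonic: see [nQ]. *)
Definition Vp (l : nat) (A : {poly C}) (j : 'I_3) : {poly C} :=
  let c := (2 * l%:R + 1) / (l%:R + 1) in let d := (2 * (l%:R + 1))^-1 in
  nth 0 [:: - (2 * l%:R + 1) *: A + c *: ('X * A^`()) - d *: ('X * ('X * A^`()^`()));
            d *: A^`()^`();
            c *: A^`() - (2 * d) *: ('X * A^`()^`())] j.

Lemma natS_neq0 n : n%:R + 1 != 0 :> C.
Proof. by rewrite natr1 pnatr_eq0. Qed.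

(** The decomposition of a coordinate times a harmonic of degree l into a harmonic of degree l + 1
    and N times a harmonic of degree l - 1. For l = 0 the factor l removes the meaningless power. *)
Lemma nQ l u j : (2 * l%:R + 1) *: (nN j u *: Qp u ^+ l) =
  Vp l (Qp u ^+ l.+1) j + (2 * l%:R * NZ u) *: (dQ j * Qp u ^+ l.-1).
Proof.
have hl := natS_neq0 l.
have e2 : (2 * (l%:R + 1))^-1 *: ((Qp u ^+ l.+1)^`()^`()) =
  (2 * l%:R + 1) *: (z11 u *: Qp u ^+ l) + (2 * l%:R * NZ u) *: Qp u ^+ l.-1.
  rewrite deriv2_Qpl scalerA scalerDr scalerDr !scalerA -[l.+1%:R]natr1.
  by congr (_ + _); congr (_ *: _); field.
have e1 : ((2 * l%:R + 1) / (l%:R + 1)) *: (Qp u ^+ l.+1)^`() =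
   (2 * l%:R + 1) *: (Qp u ^+ l * (Qp u)^`()).
  by rewrite deriv_Qpl scalerA -[l.+1%:R]natr1 divfK.
rewrite /Vp /nN /dQ; case: j => [] [|[|[|//]]] ? /=.
- rewrite !scalerAr e1 e2 exprS deriv_Qp /Qp.
  by rewrite -!mul_polyC !(polyCM, polyCN, polyCD, polyC_natr); ring.
- rewrite e2.
  by rewrite -!mul_polyC !(polyCM, polyCN, polyCD, polyC_natr); ring.
rewrite -(scalerA 2 (2 * (l%:R + 1))^-1) !scalerAr e1 e2 deriv_Qp.
by rewrite -!mul_polyC !(polyCM, polyCN, polyCD, polyC_natr); ring.
Qed.

(** Treating all coefficients at once makes multiplication by X and differentiation in X harmless:
    they only shift and rescale the coefficients. *)
Definition cS (S : set Fn) (A : reg -> {poly C}) : Prop :=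
  forall n, S (fun u => (A u)`_n).

Section cS.
Variables (S : set Fn) (hS : subsp S).
Implicit Types A B : reg -> {poly C}.

Lemma sub_eq (f g : Fn) : S f -> f =1 g -> S g.
Proof. by move=> hf /funext <-. Qed.

Lemma cS0 : cS S (fun=> 0).
Proof. by move=> n; apply: sub_eq hS.1 _ => u; rewrite coef0. Qed.

Lemma cSD A B : cS S A -> cS S B -> cS S (fun u => A u + B u).
Proof.
by move=> hA hB n; apply: sub_eq (subspD hS (hA n) (hB n)) _ => u; rewrite coefD.
Qed.

Lemma cSZ c A : cS S A -> cS S (fun u => c *: A u).
Proof.
by move=> hA n; apply: sub_eq (subspZ c hS (hA n)) _ => u; rewrite coefZ.
Qed.

Lemma cSX A : cS S A -> cS S (fun u => 'X * A u).
Proof.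
move=> hA [|n]; first by apply: sub_eq hS.1 _ => u; rewrite coefXM.
by apply: sub_eq (hA n) _ => u; rewrite coefXM.
Qed.

Lemma cSderiv A : cS S A -> cS S (fun u => (A u)^`()).
Proof.
move=> hA n; apply: sub_eq (subspZ n.+1%:R hS (hA n.+1)) _ => u.
by rewrite coef_deriv -[RHS]mulr_natl.
Qed.

Lemma cS_eq A B : cS S A -> A =1 B -> cS S B.
Proof. by move=> hA /funext <-. Qed.

Lemma cSV (f : reg -> C) A l j : cS S (fun u => f u *: A u) ->
  cS S (fun u => f u *: Vp l (A u) j).
Proof.
move=> hA.
have h1 : cS S (fun u => f u *: (A u)^`()).
  by apply: cS_eq (cSderiv hA) _ => u; rewrite derivZ.
have h2 : cS S (fun u => f u *: (A u)^`()^`()).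
  by apply: cS_eq (cSderiv h1) _ => u; rewrite derivZ.
have h1X : cS S (fun u => f u *: ('X * (A u)^`())).
  by apply: cS_eq (cSX h1) _ => u; rewrite scalerAr.
have h2X : cS S (fun u => f u *: ('X * (A u)^`()^`())).
  by apply: cS_eq (cSX h2) _ => u; rewrite scalerAr.
have h2XX : cS S (fun u => f u *: ('X * ('X * (A u)^`()^`()))).
  by apply: cS_eq (cSX h2X) _ => u; rewrite -!mul_polyC; ring.
rewrite /Vp; set c := (2 * l%:R + 1) / _; set d := _^-1.
case: j => [] [|[|[|//]]] ? /=.
- apply: cS_eq (cSD (cSD (cSZ (- (2 * l%:R + 1)) hA) (cSZ c h1X)) (cSZ (- d) h2XX)) _ => u.
  by rewrite -!mul_polyC !(polyCM, polyCN, polyCD, polyC_natr); ring.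
- apply: cS_eq (cSZ d h2) _ => u.
  by rewrite -!mul_polyC; ring.
apply: cS_eq (cSD (cSZ c h1) (cSZ (- (2 * d)) h2X)) _ => u.
by rewrite -!mul_polyC !(polyCM, polyCN, polyCD, polyC_natr); ring.
Qed.

Lemma cS_dQ (f : reg -> C) A j : cS S (fun u => f u *: A u) ->
  cS S (fun u => f u *: (dQ j * A u)).
Proof.
move=> hA; rewrite /dQ; case: j => [] [|[|[|//]]] ? /=.
- by apply: cS_eq (cSX (cSX hA)) _ => u; rewrite -!mul_polyC expr2; ring.
- by apply: cS_eq (cSZ (-1) hA) _ => u; rewrite -!mul_polyC polyCN; ring.
by apply: cS_eq (cSZ 2 (cSX hA)) _ => u; rewrite -!mul_polyC; ring.
Qed.

End cS.

Definition HS (c : int -> nat -> Prop) : set Fn :=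
  lspan [set h | exists k l n, c k l /\ h = fun u => (NV u ^ k *: Qp (val u) ^+ l)`_n].

Lemma HS_subsp c : subsp (HS c). Proof. exact: lspan_subsp. Qed.

Lemma HS_gen (c : int -> nat -> Prop) k l : c k l ->
  cS (HS c) (fun u => NV u ^ k *: Qp (val u) ^+ l).
Proof. by move=> hc n; apply: lspan_gen; exists k, l, n. Qed.

Lemma HS_ind (c : int -> nat -> Prop) (T : set Fn) : subsp T ->
  (forall k l, c k l -> cS T (fun u => NV u ^ k *: Qp (val u) ^+ l)) ->
  HS c `<=` T.
Proof. by move=> hT h; apply: lspan_min => // _ [k [l [n [hc ->]]]]; exact: h. Qed.

Lemma HS_sub (c d : int -> nat -> Prop) : (forall k l, c k l -> d k l) ->
  HS c `<=` HS d.
Proof. by move=> h; apply: HS_ind; [exact: HS_subsp|move=> k l /h; exact: HS_gen]. Qed.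

Lemma odd_neq0 l : 2 * l%:R + 1 != 0 :> C.
Proof. by rewrite -natrM natr1 pnatr_eq0. Qed.

Lemma HS_nQdQ (c : int -> nat -> Prop) (x y : C) k l j :
  c k l.+1 -> ((0 < l)%N -> c (k + 1) l.-1 \/ 2 * x + (2 * l%:R + 1) * y = 0) ->
  cS (HS c) (fun u => (x * NV u ^ k * nN j (val u)) *: Qp (val u) ^+ l
    + (l%:R * y * NV u ^ (k + 1)) *: (dQ j * Qp (val u) ^+ l.-1)).
Proof.
move=> h1 h2; have hS := HS_subsp c.
have E (u : reg) : (x / (2 * l%:R + 1)) *: (NV u ^ k *: Vp l (Qp (val u) ^+ l.+1) j)
   + (l%:R * (2 * x + (2 * l%:R + 1) * y) / (2 * l%:R + 1)) *: (NV u ^ (k + 1) *: (dQ j * Qp (val u) ^+ l.-1))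
  = (x * NV u ^ k * nN j (val u)) *: Qp (val u) ^+ l
    + (l%:R * y * NV u ^ (k + 1)) *: (dQ j * Qp (val u) ^+ l.-1).
  apply: (scalerI (odd_neq0 l)).
  have -> : (2 * l%:R + 1) *: ((x * NV u ^ k * nN j (val u)) *: Qp (val u) ^+ l
      + (l%:R * y * NV u ^ (k + 1)) *: (dQ j * Qp (val u) ^+ l.-1)) =
    (x * NV u ^ k) *: ((2 * l%:R + 1) *: (nN j (val u) *: Qp (val u) ^+ l))
      + ((2 * l%:R + 1) * (l%:R * y * NV u ^ (k + 1))) *: (dQ j * Qp (val u) ^+ l.-1).
    by rewrite scalerDr !scalerA; congr (_ *: _ + _); ring.
  rewrite nQ NexpS !scalerDr !scalerA -[RHS]addrA -scalerDl.
  by congr (_ *: _ + _ *: _); field; rewrite ?Nneq0 ?odd_neq0 //.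
apply: cS_eq E; apply: cSD => //.
  by apply: cSZ => //; apply: cSV => //; apply: HS_gen.
case: l h1 h2 => [|l] h1 h2.
  by apply: cS_eq (cS0 hS) _ => u; rewrite !mul0r scale0r.
have [//|h|h] := h2; last by apply: cS_eq (cS0 hS) _ => u; rewrite h mulr0 mul0r scale0r.
by apply: cSZ => //; apply: cS_dQ => //; apply: HS_gen.
Qed.

Lemma HS_nQ (c : int -> nat -> Prop) k l j :
  c k l.+1 -> ((0 < l)%N -> c (k + 1) l.-1) ->
  cS (HS c) (fun u => (NV u ^ k * nN j (val u)) *: Qp (val u) ^+ l).
Proof.
move=> h1 h2; apply: cS_eq (@HS_nQdQ c 1 0 k l j h1 _) _ => [/h2|u]; first by left.
by rewrite mul1r mulr0 mul0r scale0r addr0.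
Qed.

Definition pis0 j (A dA : reg -> {poly C}) : Prop :=
  forall n, pd0 j (fun u => (A u)`_n) (fun u => (dA u)`_n).

Lemma pis0_eq j A dA dA' : pis0 j A dA -> dA =1 dA' -> pis0 j A dA'.
Proof. by move=> h /funext <-. Qed.

Lemma pis0_cst j p : pis0 j (fun=> p) (fun=> 0).
Proof. by move=> n; apply: (pd0_eq (pd0_cst _ j)) => u; rewrite coef0. Qed.

Lemma pis0D j A B dA dB : pis0 j A dA -> pis0 j B dB ->
  pis0 j (fun u => A u + B u) (fun u => dA u + dB u).
Proof.
move=> hA hB n; rewrite (_ : (fun _ => _) = fun u => (A u)`_n + (B u)`_n).
  by apply: (pd0_eq (pd0D (hA n) (hB n))) => u; rewrite coefD.
by apply/funext => u; rewrite coefD.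
Qed.

Lemma pis0M j A B dA dB : pis0 j A dA -> pis0 j B dB ->
  pis0 j (fun u => A u * B u) (fun u => dA u * B u + A u * dB u).
Proof.
move=> hA hB n.
rewrite (_ : (fun _ => _) = fun u => \sum_(a < n.+1) (A u)`_a * (B u)`_(n - a)).
  apply: (pd0_eq (pd0_sum _ (fun a => pd0M (hA _) (hB _)))) => u.
  by rewrite coefD !coefM -big_split.
by apply/funext => u; rewrite coefM.
Qed.

Lemma pis0Z j (f df : Fn) A dA : pd0 j f df -> pis0 j A dA ->
  pis0 j (fun u => f u *: A u) (fun u => df u *: A u + f u *: dA u).
Proof.
move=> hf hA n; rewrite (_ : (fun _ => _) = fun u => f u * (A u)`_n).
  by apply: (pd0_eq (pd0M hf (hA n))) => u; rewrite coefD !coefZ.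
by apply/funext => u; rewrite coefZ.
Qed.

Lemma pis0_polyC j (f df : Fn) : pd0 j f df -> pis0 j (fun u => (f u)%:P) (fun u => (df u)%:P).
Proof.
move=> hf [|n].
  rewrite (_ : (fun _ => _) = f); last by apply/funext => u; rewrite coefC.
  by apply: (pd0_eq hf) => u; rewrite coefC.
rewrite (_ : (fun _ => _) = fun=> 0); last by apply/funext => u; rewrite coefC.
by apply: (pd0_eq (pd0_cst _ j)) => u; rewrite coefC.
Qed.

Lemma pis0_Q j : pis0 j (fun u => Qp (val u)) (fun=> dQ j).
Proof.
have [h1 h2 h3] := pd0_coord R j.
have hX (f df : Fn) p : pd0 j f df ->
    pis0 j (fun u => (f u)%:P * p) (fun u => (df u)%:P * p).
  move=> h; apply: (pis0_eq (pis0M (pis0_polyC h) (pis0_cst j p))) => u.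
  by rewrite mulr0 addr0.
apply: (pis0_eq (pis0D (pis0D (pis0_polyC _) (hX _ _ 'X (pd0Z 2 h3))) (hX _ _ 'X^2 h1))).
  rewrite (_ : (fun _ => _) = fun u => (-1) * z22 (val u)); first exact: pd0Z h2.
  by apply/funext => u; rewrite mulN1r.
move=> u; rewrite /dQ; case: j {h1 h2 h3 hX} => [] [|[|[|//]]] ? /=.
- by rewrite mulr0 polyC0 mulr0 mul0r !add0r mul1r.
- by rewrite mulr0 polyC0 mulr1 !mul0r !addr0 polyCN.
by rewrite mulr0 polyC0 mul0r mulr1 addr0 add0r mul_polyC.
Qed.

Lemma pis0_Qexp j l :
  pis0 j (fun u => Qp (val u) ^+ l) (fun u => l%:R *: (dQ j * Qp (val u) ^+ l.-1)).
Proof.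
elim: l => [|l IH].
  by apply: (pis0_eq (pis0_cst j 1)) => u; rewrite scale0r.
rewrite (_ : (fun _ => _) = fun u => Qp (val u) * Qp (val u) ^+ l); last first.
  by apply/funext => u; rewrite exprS.
apply: (pis0_eq (pis0M (pis0_Q j) IH)) => u.
rewrite -!mul_polyC !polyC_natr /= -natr1.
by case: l {IH} => [|l]; rewrite /= ?exprS; ring.
Qed.

Lemma pis0_NQ j k l :
  pis0 j (fun u => NV u ^ k *: Qp (val u) ^+ l)
    (fun u => (k%:~R * NV u ^ (k - 1) * nN j (val u)) *: Qp (val u) ^+ l
            + (l%:R * NV u ^ k) *: (dQ j * Qp (val u) ^+ l.-1)).
Proof.
apply: (pis0_eq (pis0Z (pd0_Nexp j k) (pis0_Qexp j l))) => u.
by rewrite scalerA (mulrC l%:R).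
Qed.

Definition dif (h : Fn) : Prop := forall j, exists d, pd0 j h d.

Lemma difP h j : dif h -> pd0 j h (pder 0 j h).
Proof.
move=> /(_ j)[d hd]; apply: (pd0_eq hd) => u.
by rewrite (pderE 0 u hd) !mul0r addr0.
Qed.

Lemma pis0_dif A n : (forall j, exists dA, pis0 j A dA) -> dif (fun u => (A u)`_n).
Proof. by move=> h j; have [dA hA] := h j; exists (fun u => (dA u)`_n). Qed.

Lemma dif_subsp : subsp dif.
Proof.
split=> [j|a u v hu hv j]; first by exists (fun=> 0); exact: pd0_cst.
have [du hdu] := hu j; have [dv hdv] := hv j.
by exists (fun x => a * du x + dv x); apply: pd0D => //; exact: pd0Z.
Qed.

Lemma difM (g h : Fn) : dif g -> dif h -> dif (fun u => g u * h u).
Proof.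
move=> hg hh j; have [dg hdg] := hg j; have [dh hdh] := hh j.
by exists (fun u => dg u * h u + g u * dh u); exact: pd0M.
Qed.

Lemma dif_cst c : dif (fun=> c).
Proof. by move=> j; exists (fun=> 0); exact: pd0_cst. Qed.

Lemma pder_lin e j a (g h : Fn) u : dif g -> dif h ->
  pder e j (a *: g + h) u = a * pder e j g u + pder e j h u.
Proof.
move=> hg hh; have hg' := difP j hg; have hh' := difP j hh.
rewrite (pderE e u (pd0D (pd0Z a hg') hh')) (pderE e u hg') (pderE e u hh') /=.
by ring.
Qed.

(** Levels add because N^(e/2) g times N^(e'/2) h is N^((e+e')/2) g h. *)
Lemma pderM e e' j (g h : Fn) u : dif g -> dif h ->
  pder (e + e') j (fun u => g u * h u) u = pder e j g u * h u + g u * pder e' j h u.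
Proof.
move=> hg hh; have hg' := difP j hg; have hh' := difP j hh.
by rewrite (pderE _ u (pd0M hg' hh')) (pderE e u hg') (pderE e' u hh') natrD; ring.
Qed.

Lemma pder0_cst j c u : pder 0 j (fun _ : reg => c) u = 0.
Proof. by rewrite (pderE 0 u (pd0_cst c j)) !mul0r addr0. Qed.

Lemma pder_NQ e j k l n u :
  pder e j (fun u => (NV u ^ k *: Qp (val u) ^+ l)`_n) u =
  (((k%:~R + e%:R / 2) * NV u ^ (k - 1) * nN j (val u)) *: Qp (val u) ^+ l
   + (l%:R * NV u ^ k) *: (dQ j * Qp (val u) ^+ l.-1))`_n.
Proof.
rewrite (pderE e u (pis0_NQ j k l n)) !coefD !coefZ NexpP.
by field; rewrite Nneq0.
Qed.

Lemma dif_NQ k l n : dif (fun u => (NV u ^ k *: Qp (val u) ^+ l)`_n).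
Proof. by apply: pis0_dif => j; eexists; exact: pis0_NQ. Qed.

Lemma HS_dif c : HS c `<=` dif.
Proof. by apply: HS_ind; [exact: dif_subsp|move=> k l _ n; exact: dif_NQ]. Qed.

(** The gradient of N^s Q^l, with s = k + e/2, has a part of bidegree (k, l - 1) proportional to 2 s
    + 2 l + 1. It disappears exactly for s = - l - 1/2, where N^s Q^l is harmonic. *)
Lemma HS_pder (c d : int -> nat -> Prop) e j :
  (forall k l, c k l -> d (k - 1) l.+1 /\
     ((0 < l)%N -> d k l.-1 \/ 2 * k + e%:Z + 2 * l%:Z + 1 = 0)) ->
  forall h, HS c h -> HS d (pder e j h).
Proof.
move=> hcd h hh; suff : [set h | dif h /\ HS d (pder e j h)] h by case.
have hS := HS_subsp d.
move: h hh; apply: HS_ind.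
  split=> [|a u v [hu hu'] [hv hv']].
    split; first exact: dif_subsp.1.
    by apply: sub_eq hS.1 _ => u; rewrite (pderE _ u (pd0_cst 0 j)) mulr0 addr0.
  split; first exact: dif_subsp.2.
  by apply: sub_eq (hS.2 a _ _ hu' hv') _ => x; rewrite pder_lin.
move=> k l /hcd[hc1 hc2] n; split; first exact: dif_NQ.
suff : cS (HS d) (fun u => ((k%:~R + e%:R / 2) * NV u ^ (k - 1) * nN j (val u)) *: Qp (val u) ^+ l
   + (l%:R * NV u ^ k) *: (dQ j * Qp (val u) ^+ l.-1)).
  by move=> /(_ n) H; apply: sub_eq H _ => u; rewrite pder_NQ.
pose x : C := k%:~R + e%:R / 2.
apply: cS_eq (@HS_nQdQ d x 1 (k - 1) l j hc1 _) _ => [l0|u]; rewrite subrK ?mulr1 //.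
have [h|h] := hc2 l0; [by left|right].
have := congr1 (fun z : int => z%:~R : C) h; rewrite !(rmorphD, rmorphM) rmorph0 => <-.
by rewrite /x; field.
Qed.

Lemma linear_mul (a b x y : C) : a * (b * x) + b * y = b * (a * x + y).
Proof. by rewrite mulrDr mulrCA. Qed.

Definition mulcl (S : set Fn) (a : reg -> C) : Prop :=
  forall h, S h -> S (fun u => a u * h u).

Lemma mulcl_cst S c : subsp S -> mulcl S (fun=> c).
Proof. by move=> hS h hh; apply: sub_eq (subspZ c hS hh) _. Qed.

Lemma mulclD S a b : subsp S -> mulcl S a -> mulcl S b -> mulcl S (fun u => a u + b u).
Proof.
move=> hS ha hb h hh; apply: sub_eq (subspD hS (ha h hh) (hb h hh)) _ => u.
by rewrite mulrDl.
Qed.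

Lemma mulclM S a b : mulcl S a -> mulcl S b -> mulcl S (fun u => a u * b u).
Proof. by move=> ha hb h hh; apply: sub_eq (ha _ (hb h hh)) _ => u; rewrite mulrA. Qed.

Lemma mulcl_eq S a b : mulcl S a -> a =1 b -> mulcl S b.
Proof. by move=> ha /funext <-. Qed.

Lemma HS_mulN (c d : int -> nat -> Prop) i :
  (forall k l, c k l -> d (k + i) l) ->
  forall h, HS c h -> HS d (fun u => NV u ^ i * h u).
Proof.
move=> hcd h hh; suff : [set h : Fn | HS d (fun u => NV u ^ i * h u)] h by [].
have hS := HS_subsp d.
move: h hh; apply: HS_ind.
  split=> [|a u v hu hv]; first by apply: sub_eq hS.1 _ => u; rewrite mulr0.
  apply: sub_eq (hS.2 a _ _ hu hv) _ => x.
  exact: (linear_mul a (NV x ^ i)).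
move=> k l /hcd hd n; apply: sub_eq (HS_gen hd n) _ => u.
by rewrite !coefZ expfzDr ?Nneq0 //; ring.
Qed.

(** Used with z = 0 for the coordinates, that is, the entries of Z, and with z = - 1 for the entries
    of Z^(-1). *)
Lemma mulcl_NnN (c : int -> nat -> Prop) z j :
  (forall k l, c k l -> c (k + z) l.+1 /\ ((0 < l)%N -> c (k + z + 1) l.-1)) ->
  mulcl (HS c) (fun u => NV u ^ z * nN j (val u)).
Proof.
move=> hc h hh; suff : [set h : Fn | HS c (fun u => NV u ^ z * nN j (val u) * h u)] h by [].
have hS := HS_subsp c.
move: h hh; apply: HS_ind.
  split=> [|a u v hu hv]; first by apply: sub_eq hS.1 _ => u; rewrite mulr0.
  apply: sub_eq (hS.2 a _ _ hu hv) _ => x.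
  exact: (linear_mul a (NV x ^ z * nN j (val x))).
move=> k l /hc[h1 h2] n.
apply: sub_eq (@HS_nQ c (k + z) l j h1 h2 n) _ => u.
by rewrite !coefZ expfzDr ?Nneq0 //; ring.
Qed.

Lemma HS_mulnN (c : int -> nat -> Prop) j :
  (forall k l, c k l -> c k l.+1 /\ ((0 < l)%N -> c (k + 1) l.-1)) ->
  mulcl (HS c) (fun u => nN j (val u)).
Proof.
move=> hc; apply: (@mulcl_eq (HS c) (fun u => NV u ^ 0 * nN j (val u))) => [|u].
  by apply: mulcl_NnN => k l /hc; rewrite addr0.
by rewrite expr0z mul1r.
Qed.

End GeneratingFunction.

(** * The Laplacian *)

Section Laplacian.
Variable R : realType.
Local Notation C := R[i].
Local Notation i := ('i%C : C).
Local Notation reg := (reg R).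
Local Notation Fn := (reg -> C^o).

Lemma nN0 (u : pt R) : nN j0 u = z22 u. Proof. by rewrite /nN inordK. Qed.

Lemma nN1 (u : pt R) : nN j1 u = z11 u. Proof. by rewrite /nN inordK. Qed.

Lemma nN2 (u : pt R) : nN j2 u = 2 * ct u. Proof. by rewrite /nN inordK. Qed.

Lemma dQ0 : dQ R j0 = 'X^2. Proof. by rewrite /dQ inordK. Qed.

Lemma dQ1 : dQ R j1 = -1. Proof. by rewrite /dQ inordK. Qed.

Lemma dQ2 : dQ R j2 = 2 *: 'X. Proof. by rewrite /dQ inordK. Qed.

Lemma lin_fct (a : C) (g h : Fn) u : (a *: g + h) u = a * g u + h u.
Proof. by []. Qed.

Section Coordinates.
Variable S : set Fn.
Hypotheses (hS : subsp S) (hn : forall j, mulcl S (fun u => nN j (val u))).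

Lemma mulcl_z11 : mulcl S (fun u => z11 (val u)).
Proof. by apply: mulcl_eq (hn j1) _ => u; rewrite nN1. Qed.

Lemma mulcl_z22 : mulcl S (fun u => z22 (val u)).
Proof. by apply: mulcl_eq (hn j0) _ => u; rewrite nN0. Qed.

Lemma mulcl_ct : mulcl S (fun u => ct (val u)).
Proof.
apply: mulcl_eq (mulclM (mulcl_cst 2^-1 hS) (hn j2)) _ => u.
by rewrite nN2 mulrA mulVf ?mul1r // pnatr_eq0.
Qed.

Lemma mulcl_z12 : mulcl S (fun u => z12 (val u)).
Proof. exact: mulclM (mulcl_cst i hS) mulcl_ct. Qed.

Lemma mulcl_Z p q : mulcl S (fun u => Zmx (val u) p q).
Proof.
case: p q => [] [|[|//]] ? [] [|[|//]] ?.
- by apply: mulcl_eq mulcl_z11 _ => u; rewrite mxE.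
- by apply: mulcl_eq mulcl_z12 _ => u; rewrite mxE.
- by apply: mulcl_eq mulcl_z12 _ => u; rewrite mxE.
by apply: mulcl_eq mulcl_z22 _ => u; rewrite mxE.
Qed.

Lemma mulclX a n : mulcl S a -> mulcl S (fun u => a u ^+ n).
Proof.
move=> ha; elim: n => [|n IH]; first exact: mulcl_cst.
by apply: mulcl_eq (mulclM ha IH) _ => u; rewrite exprS.
Qed.

Lemma cS_mulcl a (A : reg -> {poly C}) : mulcl S a -> cS S A -> cS S (fun u => a u *: A u).
Proof. by move=> ha hA n; apply: sub_eq (ha _ (hA n)) _ => u; rewrite coefZ. Qed.

Lemma cS_Q (A : reg -> {poly C}) : cS S A -> cS S (fun u => Qp (val u) * A u).
Proof.
move=> hA.
have h1 := cS_mulcl mulcl_z22 hA; have h2 := cS_mulcl mulcl_ct hA.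
have h3 := cS_mulcl mulcl_z11 hA.
apply: cS_eq (cSD hS (cSD hS (cSZ hS (-1) h1) (cSZ hS 2 (cSX hS h2)))
  (cSX hS (cSX hS h3))) _ => u.
by rewrite /Qp -!mul_polyC !(polyCM, polyCN, polyC_natr); ring.
Qed.

End Coordinates.

Definition cT : int -> nat -> Prop := fun _ _ => True.

Lemma P_subsp : subsp (@P R). Proof. exact: lspan_subsp. Qed.

Lemma P_mono a b c k : @P R (laurent_monomial a b c k).
Proof. by apply: lspan_gen; exists a, b, c, k. Qed.

Lemma P_mulcl_mono a b c k : mulcl (@P R) (laurent_monomial a b c k).
Proof.
move=> h hh; suff : [set h : Fn | @P R (fun u => laurent_monomial a b c k u * h u)] h by [].
move: h hh; apply: lspan_min.
  split=> [|x u v hu hv]; first by apply: sub_eq P_subsp.1 _ => u; rewrite mulr0.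
  apply: sub_eq (P_subsp.2 x _ _ hu hv) _ => y; exact: linear_mul.
move=> _ [a' [b' [c' [k' ->]]]]; apply: sub_eq (P_mono (a + a') (b + b') (c + c') (k + k')) _ => u.
by rewrite /laurent_monomial expfzDr ?Nneq0 // !exprD; ring.
Qed.

Lemma PM (g h : Fn) : P g -> P h -> P (fun u => g u * h u : C^o).
Proof.
move=> hg hh; suff : [set g : Fn | @P R (fun u => g u * h u : C^o)] g by [].
move: g hg; apply: lspan_min.
  split=> [|x u v hu hv]; first by apply: sub_eq P_subsp.1 _ => u; rewrite mul0r.
  apply: sub_eq (P_subsp.2 x _ _ hu hv) _ => y.
  by rewrite !lin_fct mulrA -mulrDl.
by move=> _ [a [b [c [k ->]]]]; exact: P_mulcl_mono.
Qed.

Lemma P_mulcl a : P (a : Fn) -> mulcl (@P R) a.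
Proof. by move=> ha h; exact: PM. Qed.

Lemma P_nN j : mulcl (@P R) (fun u => nN j (val u)).
Proof.
case: j => [] [|[|[|//]]] ?.
- by apply: mulcl_eq (P_mulcl_mono 0 1 0 0) _ => u; rewrite /laurent_monomial /nN /= !expr0 expr0z expr1; ring.
- by apply: mulcl_eq (P_mulcl_mono 1 0 0 0) _ => u; rewrite /laurent_monomial /nN /= !expr0 expr0z expr1; ring.
apply: mulcl_eq (mulclM (mulcl_cst (- (2 * i)) P_subsp) (P_mulcl_mono 0 0 1 0)) _ => u.
rewrite /laurent_monomial /nN /z12 /= !expr0 expr0z expr1.
have h : i * i = -1 by rewrite -expr2 sqr_i.
by ring: h.
Qed.

Lemma P_cst c : @P R (fun=> c).
Proof.
apply: sub_eq (mulcl_cst c P_subsp (P_mono 0 0 0 0)) _ => u.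
by rewrite /laurent_monomial !expr0 expr0z !mulr1.
Qed.

Lemma P_Nexp k : @P R (fun u => NV u ^ k).
Proof.
by apply: sub_eq (P_mono 0 0 0 k) _ => u; rewrite /laurent_monomial !expr0; ring.
Qed.

(** The right side contains the powers of N and is closed under multiplication by coordinates;
    conversely the coefficients of Q^l are polynomials in the coordinates. *)
Lemma PE : @P R = HS cT.
Proof.
apply/seteqP; split.
  apply: lspan_min; first exact: HS_subsp.
  move=> _ [a [b [c [k ->]]]].
  have hS := @HS_subsp R cT.
  have hn j : mulcl (HS cT) (fun u : reg => nN j (val u)) by apply: HS_mulnN.
  have h1 : HS cT (fun u : reg => NV u ^ k).
    have := @HS_gen R cT k 0 Logic.I.
    by move=> /(_ 0%N) H; apply: sub_eq H _ => u; rewrite expr0 coefZ coef1 mulr1.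
  have := mulclM (mulclM (mulclX hS a (mulcl_z11 hn)) (mulclX hS b (mulcl_z22 hn)))
    (mulclX hS c (mulcl_z12 hS hn)).
  by move=> /(_ _ h1).
apply: HS_ind; first exact: P_subsp.
move=> k l _; elim: l => [|l IH].
  case=> [|n]; first by apply: sub_eq (P_Nexp k) _ => u; rewrite expr0 coefZ coef1 mulr1.
  by apply: sub_eq P_subsp.1 _ => u; rewrite expr0 coefZ coef1 mulr0.
apply: cS_eq (cS_Q P_subsp P_nN IH) _ => u.
by rewrite exprS scalerAr.
Qed.

Lemma P_dif h : @P R h -> dif h. Proof. by rewrite PE; exact: HS_dif. Qed.

Lemma P_pder e j h : @P R h -> @P R (pder e j h).
Proof. by rewrite PE; apply: HS_pder => k l _; split=> // _; left. Qed.

Definition hessN (a b : 'I_3) : C :=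
  nth 0 (nth [::] [:: [:: 0; 1; 0]; [:: 1; 0; 0]; [:: 0; 0; 2]] a) b.

Lemma pd0_nN a b : pd0 a (fun u => nN b (val u)) (fun=> hessN a b).
Proof.
have [h1 h2 h3] := pd0_coord R a.
case: b => [] [|[|[|//]]] ?.
- by apply: (pd0_eq h2) => u; rewrite /hessN; case: a {h1 h2 h3} => [] [|[|[|//]]] ?.
- by apply: (pd0_eq h1) => u; rewrite /hessN; case: a {h1 h2 h3} => [] [|[|[|//]]] ?.
apply: (pd0_eq (pd0Z 2 h3)) => u; rewrite /hessN.
by case: a {h1 h2 h3} => [] [|[|[|//]]] ? /=; rewrite ?mulr0 ?mulr1.
Qed.

Lemma pder2_NQ e a b k l n u (x := k%:~R + e%:R / 2 : C) :
  pder e a (pder e b (fun u : reg => (NV u ^ k *: Qp (val u) ^+ l)`_n)) u =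
  ((x * (x - 1) * NV u ^ (k - 1 - 1) * nN a (val u) * nN b (val u)
     + x * NV u ^ (k - 1) * hessN a b) *: Qp (val u) ^+ l
   + (x * l%:R * NV u ^ (k - 1)) *:
       ((nN b (val u) *: dQ R a + nN a (val u) *: dQ R b) * Qp (val u) ^+ l.-1)
   + (l%:R * l.-1%:R * NV u ^ k) *: (dQ R a * dQ R b * Qp (val u) ^+ l.-1.-1))`_n.
Proof.
rewrite (_ : pder e b _ = fun u : reg => ((x * (NV u ^ (k - 1) * nN b (val u))) *: Qp (val u) ^+ l
   + (l%:R * NV u ^ k) *: (dQ R b * Qp (val u) ^+ l.-1))`_n); last first.
  by apply/funext => v; rewrite pder_NQ -!mulrA.
have hA := pis0Z (pd0Z x (pd0M (pd0_Nexp a (k - 1)) (pd0_nN a b))) (pis0_Qexp a l).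
have hB := pis0Z (pd0Z l%:R (pd0_Nexp a k)) (pis0M (pis0_cst a (dQ R b)) (pis0_Qexp a l.-1)).
rewrite (pderE e u (pis0D hA hB n)) mul0r add0r.
have e1 (c : C) (X : {poly C}) : dQ R b * (c *: (dQ R a * X)) = c *: (dQ R a * dQ R b * X).
  by rewrite -!mul_polyC; ring.
have e2 (X : {poly C}) : (nN b (val u) *: dQ R a + nN a (val u) *: dQ R b) * X =
    nN b (val u) *: (dQ R a * X) + nN a (val u) *: (dQ R b * X).
  by rewrite mulrDl -!scalerAl.
rewrite e1 e2 !(coefD, coefZ) !NexpP rmorphB /= /x.
by field; rewrite Nneq0.
Qed.

Lemma hessNC a b : hessN a b = hessN b a.
Proof. by case: a b => [] [|[|[|//]]] ? [] [|[|[|//]]] ?. Qed.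

Lemma pder_linf e j (x : C) (g h : Fn) : dif g -> dif h ->
  pder e j (x *: g + h) = x *: pder e j g + pder e j h.
Proof. by move=> hg hh; apply/funext => u; rewrite pder_lin. Qed.

Lemma pder2_lin e a b (x : C) (g h : Fn) u : P g -> P h ->
  pder e a (pder e b (x *: g + h)) u = x * pder e a (pder e b g) u + pder e a (pder e b h) u.
Proof.
move=> hg hh; rewrite (pder_linf e b x (P_dif hg) (P_dif hh)).
by apply: pder_lin; apply: P_dif; exact: P_pder.
Qed.

Lemma pder_0 e j : pder e j (0 : Fn) = 0.
Proof. by apply/funext => u; rewrite (pderE _ u (pd0_cst 0 j)) mulr0 addr0. Qed.

(** Symmetry is read off from the explicit second derivatives of the spanning functions. *)
Lemma pderC e a b h : @P R h -> pder e a (pder e b h) =1 pder e b (pder e a h).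
Proof.
rewrite PE => hh; suff : [set h : Fn | P h /\
   pder e a (pder e b h) =1 pder e b (pder e a h)] h by case.
move: h hh; apply: HS_ind.
  split; first by split; [exact: P_subsp.1|rewrite !pder_0].
  move=> x g h [hg E] [hh E']; split; first exact: P_subsp.2.
  by move=> u; rewrite (pder2_lin e a b x u hg hh) (pder2_lin e b a x u hg hh) E E'.
move=> k l _ n; split; first by rewrite PE; exact: HS_gen.
move=> u; rewrite !pder2_NQ hessNC (mulrC (dQ R a)) (addrC (nN b _ *: _)).
by congr (nth _ _ _); congr (polyseq _); congr (_ *: _ + _ + _); ring.
Qed.

Definition lap e (h : Fn) : Fn := fun u =>
  pder e j0 (pder e j1 h) u + 4^-1 * pder e j2 (pder e j2 h) u.

Lemma lap_lin e (a : C) (g h : Fn) : P g -> P h ->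
  lap e (a *: g + h) = a *: lap e g + lap e h.
Proof.
move=> hg hh; apply/funext => u.
rewrite [LHS]/(_ + _ * _) (pder2_lin e j0 j1 a u hg hh) (pder2_lin e j2 j2 a u hg hh).
have E (c x y x' y' : C) : a * x + y + c * (a * x' + y') = a * (x + c * x') + (y + c * y').
  by ring.
exact: E.
Qed.

(** Of the three groups of terms in [pder2_NQ], the last is killed by isotropy of the gradient of Q.
    The mixed group is evaluated by [hQ], the first by the formula for N. *)
Lemma lap_NQ e k l n u (x := k%:~R + e%:R / 2 : C) :
  lap e (fun u : reg => (NV u ^ k *: Qp (val u) ^+ l)`_n) u =
  x * (x + l%:R + 2^-1) * (NV u ^ (k - 1) *: Qp (val u) ^+ l)`_n.
Proof.
rewrite /lap !pder2_NQ -/x; clearbody x; rewrite /hessN !inordK // nN0 nN1 nN2 dQ0 dQ1 dQ2 /=.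
rewrite -!coefZ -coefD; congr (nth _ _ _); congr polyseq.
(* Q is linear in the coordinates, so contracting them with its gradient returns Q; the factor l
   covers l = 0. *)
have hQ : l%:R *: Qp (val u) ^+ l = l%:R *: ((z11 (val u) *: 'X^2 - z22 (val u) *: 1
   + ct (val u) *: (2 *: 'X)) * Qp (val u) ^+ l.-1).
  case: l => [|l]; first by rewrite !scale0r.
  by rewrite exprS /Qp -!mul_polyC !(polyCM, polyCN, polyC_natr); congr (_ * _); ring.
have hN : NV u ^ (k - 1) = NV u ^ (k - 1 - 1) * (z11 (val u) * z22 (val u) + ct (val u) ^+ 2).
  by rewrite -NZE -NexpS subrK.
rewrite [4^-1 *: _]scalerDr [4^-1 *: (_ + _)]scalerDr 3!(scalerA 4^-1).
have -> : 4^-1 * (x * (x - 1) * NV u ^ (k - 1 - 1) * (2 * ct (val u)) * (2 * ct (val u))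
    + x * NV u ^ (k - 1) * 2) =
    x * (x - 1) * NV u ^ (k - 1 - 1) * ct (val u) ^+ 2 + x * NV u ^ (k - 1) * 2^-1 by field.
have -> : 4^-1 * (x * l%:R * NV u ^ (k - 1)) = (x * NV u ^ (k - 1)) * (l%:R * 4^-1) by ring.
have e2 (c : C) X : (c * 4^-1) *: ((((2 * ct (val u)) *: (2 *: 'X) + (2 * ct (val u)) *: (2 *: 'X))) * X)
     = c *: (ct (val u) *: (2 *: 'X) * X) :> {poly C}.
  rewrite -scalerDl (_ : 2 * ct (val u) + 2 * ct (val u) = 4 * ct (val u)); last by ring.
  by rewrite -(scalerA 4) -scalerAl scalerA divfK // pnatr_eq0.
have e3 (c : C) X : (4^-1 * c) *: ((2 *: 'X) * (2 *: 'X) * X) = c *: ('X^2 * X) :> {poly C}.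
  by rewrite -!scalerAl -!scalerAr -!scalerAl !scalerA -expr2; congr (_ *: _); field.
rewrite e3.
have -> : (x * (x + l%:R + 2^-1)) *: (NV u ^ (k - 1) *: Qp (val u) ^+ l) =
   (x * (x - 1) * NV u ^ (k - 1) + x * NV u ^ (k - 1) * (1 + 2^-1)) *: Qp (val u) ^+ l
  + (x * NV u ^ (k - 1)) *: (l%:R *: Qp (val u) ^+ l).
  by rewrite !scalerA -!scalerDl; congr (_ *: _); field.
rewrite (mulrA (x * NV u ^ (k - 1)) l%:R) e2 hQ !hN.
set h := 2^-1.
by rewrite -!mul_polyC !(polyCM, polyCN, polyCD, polyC_natr, polyC_exp); ring.
Qed.

End Laplacian.

(** * Harmonic components *)

Section Eigenvectors.
Variables (K : fieldType) (V : lmodType K) (D S0 : set V) (T : V -> V).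
Hypotheses (hD : subsp D) (hS0 : subsp S0) (S0D : S0 `<=` D).
Hypothesis T_lin : forall a u v, D u -> D v -> T (a *: u + v) = a *: T u + T v.
Hypothesis T_S0 : forall z, S0 z -> T z = 0.

(** Sums of a kernel vector and [n] eigenvectors with nonzero eigenvalues. Neither independence nor
    distinct eigenvalues are required, and an eigenvector may be 0; [n] is the measure for the
    induction in [eigsum_ker]. *)
Inductive eigsum : nat -> V -> Prop :=
| eigsum0 z : S0 z -> eigsum 0 z
| eigsumS n b lam h : D b -> T b = lam *: b -> lam != 0 -> eigsum n h ->
    eigsum n.+1 (b + h).

Lemma eigsum_D n h : eigsum n h -> D h.
Proof. by elim=> [z /S0D //|m b lam g hb _ _ _ hg]; apply: subspD. Qed.

Lemma T_Z a u : D u -> T (a *: u) = a *: T u.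
Proof.
move=> hu; have h0 : T 0 = 0 by exact: T_S0 hS0.1.
by rewrite -[a *: u]addr0 T_lin ?h0 ?addr0 //; exact: hD.1.
Qed.

Lemma eigsumZ a n h : eigsum n h -> eigsum n (a *: h).
Proof.
elim=> [z hz|m b lam g hb Tb l0 _ IH]; first by apply: eigsum0; exact: subspZ.
rewrite scalerDr; apply: (@eigsumS m _ lam) => //; first exact: subspZ.
by rewrite T_Z // Tb !scalerA mulrC.
Qed.

Lemma eigsumD n h m g : eigsum n h -> eigsum m g -> eigsum (n + m) (h + g).
Proof.
elim=> [z hz|p b lam f hb Tb l0 _ IH] hg; last first.
  by rewrite addSn -addrA; apply: (@eigsumS _ _ lam) => //; exact: IH.
rewrite add0n; elim: hg => [y hy|p b lam f hb Tb l0 _ IH].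
  by apply: eigsum0; exact: subspD.
by rewrite addrCA; apply: (@eigsumS _ _ lam).
Qed.

(** The operator 1 - mu T rescales each eigenvector by 1 - mu lam and fixes the kernel part, so the
    shape and the length of the sum are kept. *)
Lemma eigsum_shift mu n h : eigsum n h -> eigsum n (h - mu *: T h).
Proof.
elim=> [z hz|m b lam g hb Tb l0 hg IH].
  by rewrite T_S0 // scaler0 subr0; apply: eigsum0.
have -> : T (b + g) = lam *: b + T g.
  by rewrite -[b]scale1r T_lin ?scale1r ?Tb //; exact: eigsum_D hg.
have -> : b + g - mu *: (lam *: b + T g) = (1 - mu * lam) *: b + (g - mu *: T g).
  by rewrite scalerDr opprD addrACA scalerBl scale1r scalerA.
apply: (@eigsumS _ _ lam) => //; first exact: subspZ.
by rewrite T_Z // Tb !scalerA mulrC.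
Qed.

(* If [T h = 0] then [h = h - lam^-1 T h], and this operation removes the
   eigenvector of eigenvalue [lam]. *)
Lemma eigsum_ker n h : eigsum n h -> T h = 0 -> S0 h.
Proof.
elim: n h => [|n IH] h; first by move=> H; inversion H.
move=> H Th; inversion H as [|m b lam g hb Tb l0 hg E1 E2]; subst.
apply: IH => //.
have := eigsum_shift lam^-1 hg.
suff -> : g - lam^-1 *: T g = b + g by [].
have : T (b + g) = lam *: b + T g.
  by rewrite -[b]scale1r T_lin ?scale1r ?Tb //; exact: eigsum_D hg.
rewrite Th => /eqP; rewrite eq_sym addrC addr_eq0 => /eqP ->.
by rewrite scalerN opprK scalerA mulVf // scale1r addrC.
Qed.

End Eigenvectors.

(** * Solutions of the first-order equation and their harmonic components *)

Section Spinors.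
Variable R : realType.
Local Notation C := R[i].
Local Notation i := ('i%C : C).
Local Notation reg := (reg R).
Local Notation Fn := (reg -> C^o).

(* N^(k+e/2) Q^l is harmonic. *)
Definition cK (e : nat) (k : int) (l : nat) : Prop :=
  (2 * k + e%:Z) * (2 * k + e%:Z + 2 * l%:Z + 1) = 0.

Lemma scl_fct (a : C) (g : Fn) u : (a *: g) u = a * g u. Proof. by []. Qed.

Lemma inord_nth (s : seq C) : (nth 0 s j0 = nth 0 s 0) * (nth 0 s j1 = nth 0 s 1) *
  (nth 0 s j2 = nth 0 s 2).
Proof. by rewrite !inordK. Qed.

(** The operator N times the Laplacian has every coefficient of N^k Q^l as an eigenvector, with
    eigenvalue 0 exactly for the pairs in [cK e]. Hence every element of P is an [eigsum], and
    [eigsum_ker] gives the kernel. *)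
Lemma harmonic_HS e h : @P R h -> lap e h =1 (fun=> 0) -> HS (cK e) h.
Proof.
move=> hh h0.
pose T (g : Fn) : Fn := fun u => NV u * lap e g u.
have hS0 := @HS_subsp R (cK e).
have S0D : HS (cK e) `<=` @P R by rewrite PE; apply: HS_sub.
have T_lin a u v : P u -> P v -> T (a *: u + v) = a *: T u + T v.
  move=> hu hv; apply/funext => x; rewrite [LHS]/(_ * _) lap_lin //.
  exact/esym/(linear_mul a (NV x)).
pose x k : C := k%:~R + e%:R / 2.
have T_NQ k l n : T (fun u => (NV u ^ k *: Qp (val u) ^+ l)`_n) =
    (x k * (x k + l%:R + 2^-1)) *: ((fun u => (NV u ^ k *: Qp (val u) ^+ l)`_n) : Fn).
  apply/funext => u; rewrite /T lap_NQ -/(x k) scl_fct !coefZ NexpP.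
  by field; exact: Nneq0.
have eig k l : x k * (x k + l%:R + 2^-1) = 0 <-> cK e k l.
  have -> : x k * (x k + l%:R + 2^-1) =
      ((2 * k + e%:Z) * (2 * k + e%:Z + 2 * l%:Z + 1))%:~R / 4.
    by rewrite /x; field.
  rewrite /cK; split=> [/eqP|->]; last by rewrite mul0r.
  by rewrite mulf_eq0 invr_eq0 pnatr_eq0 orbF intr_eq0 => /eqP.
have T_S0 z : HS (cK e) z -> T z = 0.
  move=> hz; suff : [set z : Fn | P z /\ T z = 0] z by case.
  move: z hz; apply: HS_ind.
    split=> [|a u v [hu Tu] [hv Tv]].
      split; first exact: (P_subsp R).1.
      by apply/funext => u; rewrite /T /lap !pder_0 !(mulr0, addr0).
    by split; [exact: (P_subsp R).2|rewrite T_lin // Tu Tv scaler0 addr0].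
  move=> k l hkl n; split; first by apply: S0D; exact: HS_gen.
  by rewrite T_NQ (eig k l).2 // scale0r.
suff [n hn] : exists n, eigsum (@P R) (HS (cK e)) T n h.
  apply: (eigsum_ker (P_subsp R) hS0 S0D T_lin T_S0 hn).
  by apply/funext => u; rewrite /T h0 mulr0.
move: h hh {h0}; rewrite PE; apply: HS_ind.
  split=> [|a u v [n hu] [m hv]]; first by exists 0%N; apply: eigsum0; exact: hS0.1.
  exists (n + m)%N; apply: eigsumD => //.
  by apply: eigsumZ => //; rewrite -PE; first exact: (P_subsp R).
move=> k l _ n; have hP : P (fun u : reg => (NV u ^ k *: Qp (val u) ^+ l)`_n : C^o).
  by rewrite PE; exact: HS_gen.
have [e0|e0] := eqVneq (x k * (x k + l%:R + 2^-1)) 0.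
  by exists 0%N; apply: eigsum0; apply: HS_gen; apply/eig.
exists 1%N; rewrite -[X in eigsum _ _ _ _ X]addr0; apply: (@eigsumS _ _ _ _ _ _ _ _ _ _ _ e0).
- by rewrite -PE.
- exact: T_NQ.
- by apply: eigsum0; exact: hS0.1.
Qed.

Lemma pder2_coord e a b (f : Fn) (c : 'I_3 -> C) (h : Fn) u :
  (forall j, pd0 j f (fun=> c j)) -> P h ->
  pder e a (pder e b (fun v => f v * h v)) u =
  c b * pder e a h u + c a * pder e b h u + f u * pder e a (pder e b h) u.
Proof.
move=> hf hh; have hd := P_dif hh; have hd' := P_dif (P_pder e b hh).
have fd : dif f by move=> j; eexists; exact: hf.
have E j v : pder 0 j f v = c j by rewrite (pderE 0 v (hf j)) !mul0r addr0.
rewrite (_ : pder e b _ = c b *: h + (fun v => f v * pder e b h v)); last first.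
  by apply/funext => v; rewrite [e in pder e b (fun _ => _)](erefl : e = (0 + e)%N) (pderM 0 e) // E.
rewrite (pder_lin e a (c b) u hd (difM fd hd')) -addrA; congr (_ + _).
by rewrite -[in LHS](add0n e) pderM // E.
Qed.

(** The commutator of the Laplacian with a coordinate is a first-order derivative; the same holds in
    the next two lemmas. *)
Lemma lap_z11 e (h : Fn) u : P h ->
  lap e (fun v => z11 (val v) * h v) u = z11 (val u) * lap e h u + pder e j1 h u.
Proof.
move=> hh; have hc j : pd0 j (fun v : reg => z11 (val v)) (fun=> nth 0 [:: 1; 0; 0] j).
  by case: (pd0_coord R j).
rewrite /lap (pder2_coord e j0 j1 u hc hh) (pder2_coord e j2 j2 u hc hh) !inord_nth.
move: (pder e j0 h u) (pder e j1 h u) (pder e j2 h u) (pder e j0 (pder e j1 h) u)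
  (pder e j2 (pder e j2 h) u) => a b c d f.
by rewrite /=; ring.
Qed.

Lemma lap_z22 e (h : Fn) u : P h ->
  lap e (fun v => z22 (val v) * h v) u = z22 (val u) * lap e h u + pder e j0 h u.
Proof.
move=> hh; have hc j : pd0 j (fun v : reg => z22 (val v)) (fun=> nth 0 [:: 0; 1; 0] j).
  by case: (pd0_coord R j).
rewrite /lap (pder2_coord e j0 j1 u hc hh) (pder2_coord e j2 j2 u hc hh) !inord_nth.
move: (pder e j0 h u) (pder e j1 h u) (pder e j2 h u) (pder e j0 (pder e j1 h) u)
  (pder e j2 (pder e j2 h) u) => a b c d f.
by rewrite /=; ring.
Qed.

Lemma lap_ct e (h : Fn) u : P h ->
  lap e (fun v => ct (val v) * h v) u = ct (val u) * lap e h u + 2^-1 * pder e j2 h u.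
Proof.
move=> hh; have hc j : pd0 j (fun v : reg => ct (val v)) (fun=> nth 0 [:: 0; 0; 1] j).
  by case: (pd0_coord R j).
rewrite /lap (pder2_coord e j0 j1 u hc hh) (pder2_coord e j2 j2 u hc hh) !inord_nth.
move: (pder e j0 h u) (pder e j1 h u) (pder e j2 h u) (pder e j0 (pder e j1 h) u)
  (pder e j2 (pder e j2 h) u) => a b c d f.
by rewrite /=; field.
Qed.

Section HarmonicSpinor.
Variables (e : nat) (f1 f2 : Fn).
Hypotheses (P1 : P f1) (P2 : P f2).
Hypothesis E1 : forall u, pder e j1 f1 u + i / 2 * pder e j2 f2 u = 0.
Hypothesis E2 : forall u, i / 2 * pder e j2 f1 u + pder e j0 f2 u = 0.

Let ii : i * i = -1. Proof. by rewrite -expr2 sqr_i. Qed.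

Let D1 : pder e j1 f1 = (- (i / 2)) *: pder e j2 f2 + 0.
Proof.
apply/funext => u; apply/eqP; rewrite addr0 -subr_eq0 -(E1 u); apply/eqP.
by rewrite scl_fct; ring.
Qed.

Let D2 : pder e j0 f2 = (- (i / 2)) *: pder e j2 f1 + 0.
Proof.
apply/funext => u; apply/eqP; rewrite addr0 -subr_eq0 -(E2 u); apply/eqP.
by rewrite scl_fct; ring.
Qed.

Let dd j h u : P h -> pder e j ((- (i / 2)) *: h + 0) u = - (i / 2) * pder e j h u.
Proof.
move=> /P_dif hh; rewrite (pder_lin e j _ u hh (dif_subsp R).1).
by rewrite (pderE _ u (pd0_cst 0 j)) mulr0 !addr0.
Qed.

(** The Laplacian factors through the first-order operator: one derivative in each term is replaced
    by means of [E1] or [E2], and the mixed second derivatives cancel. *)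
Lemma spinor_lap1 : lap e f1 =1 (fun=> 0).
Proof.
move=> u; have P22 := P_pder e j2 P2; have P12 := P_pder e j2 P1.
have e1 : pder e j0 (pder e j1 f1) u = - (i / 2) * pder e j0 (pder e j2 f2) u.
  by rewrite D1 (dd j0 u P22).
have e2 : pder e j2 (pder e j0 f2) u = - (i / 2) * pder e j2 (pder e j2 f1) u.
  by rewrite D2 (dd j2 u P12).
rewrite /lap e1 (pderC e j0 j2 P2) e2.
by field: ii.
Qed.

Lemma spinor_lap2 : lap e f2 =1 (fun=> 0).
Proof.
move=> u; have P22 := P_pder e j2 P2; have P12 := P_pder e j2 P1.
have e1 : pder e j1 (pder e j0 f2) u = - (i / 2) * pder e j1 (pder e j2 f1) u.
  by rewrite D2 (dd j1 u P12).
have e2 : pder e j2 (pder e j1 f1) u = - (i / 2) * pder e j2 (pder e j2 f2) u.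
  by rewrite D1 (dd j2 u P22).
rewrite /lap (pderC e j0 j1 P2) e1 (pderC e j1 j2 P1) e2.
by field: ii.
Qed.

(** The components of f being harmonic, only commutators with the coordinates remain, and they add
    up to the left side of [E1]. In [spinor_lap2Z] they add up to that of [E2]. *)
Lemma spinor_lap1Z : lap e (fun u => z11 (val u) * f1 u + z12 (val u) * f2 u) =1 (fun=> 0).
Proof.
have Pz : P (fun v : reg => ct (val v) * f2 v : C^o) := mulcl_ct (P_subsp R) (@P_nN R) P2.
have Pz' : P (fun v : reg => z11 (val v) * f1 v : C^o) := mulcl_z11 (@P_nN R) P1.
move=> u.
rewrite (_ : (fun _ => _) = i *: ((fun v => ct (val v) * f2 v) : Fn) + ((fun v => z11 (val v) * f1 v) : Fn)).
  rewrite (lap_lin e i Pz Pz') lin_fct (lap_ct e u _) // (lap_z11 e u _) // spinor_lap1 spinor_lap2.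
  rewrite -[RHS](E1 u).
  by move: (pder e j1 f1 u) (pder e j2 f2 u) => a b; ring. 
by apply/funext => v; rewrite lin_fct /z12; ring.
Qed.

Lemma spinor_lap2Z : lap e (fun u => z12 (val u) * f1 u + z22 (val u) * f2 u) =1 (fun=> 0).
Proof.
have Pz : P (fun v : reg => ct (val v) * f1 v : C^o) := mulcl_ct (P_subsp R) (@P_nN R) P1.
have Pz' : P (fun v : reg => z22 (val v) * f2 v : C^o) := mulcl_z22 (@P_nN R) P2.
move=> u.
rewrite (_ : (fun _ => _) = i *: ((fun v => ct (val v) * f1 v) : Fn) + ((fun v => z22 (val v) * f2 v) : Fn)).
  rewrite (lap_lin e i Pz Pz') lin_fct (lap_ct e u _) // (lap_z22 e u _) // spinor_lap1 spinor_lap2.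
  rewrite -[RHS](E2 u).
  by move: (pder e j2 f1 u) (pder e j0 f2 u) => a b; ring.
by apply/funext => v; rewrite lin_fct /z12; ring.
Qed.

End HarmonicSpinor.

Lemma Vcol_eqs e (f : reg -> 'cV[C]_2) : Vcol e f ->
  [/\ P (entry f 0 0), P (entry f 1 0),
   forall u, pder e j1 (entry f 0 0) u + i / 2 * pder e j2 (entry f 1 0) u = 0 &
   forall u, i / 2 * pder e j2 (entry f 0 0) u + pder e j0 (entry f 1 0) u = 0].
Proof.
move=> [hf E]; split; [exact: hf|exact: hf| |] => u.
  have := E u 0; rewrite big_ord_recl big_ord1.
  by rewrite (_ : lift ord0 ord0 = 1 :> 'I_2); [exact: id|apply: val_inj].
have := E u 1; rewrite big_ord_recl big_ord1.
by rewrite (_ : lift ord0 ord0 = 1 :> 'I_2); [exact: id|apply: val_inj].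
Qed.

Lemma Vcol_harmonic e (f : reg -> 'cV[C]_2) p : Vcol e f -> HS (cK e) (entry f p 0).
Proof.
move=> /Vcol_eqs[P1 P2 E1 E2].
have h1 := harmonic_HS P1 (spinor_lap1 P1 P2 E1 E2).
have h2 := harmonic_HS P2 (spinor_lap2 P1 P2 E1 E2).
case: p => [] [|[|//]] lt.
  by rewrite (_ : Ordinal lt = 0) //; apply: val_inj.
by rewrite (_ : Ordinal lt = 1) //; apply: val_inj.
Qed.

Lemma Vcol_harmonicZ e (f : reg -> 'cV[C]_2) p : Vcol e f ->
  HS (cK e) (fun u => (Zmx (val u) *m f u) p 0).
Proof.
move=> /Vcol_eqs[P1 P2 E1 E2].
have Pz a b : P (a : Fn) -> P (b : Fn) -> P (fun v => a v + b v : C^o).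
  by move=> ha hb; exact: subspD (P_subsp R) ha hb.
have hn := @P_nN R; have hS := P_subsp R.
have h1 := harmonic_HS (Pz _ _ (mulcl_z11 hn P1) (mulcl_z12 hS hn P2)) (spinor_lap1Z P1 P2 E1 E2).
have h2 := harmonic_HS (Pz _ _ (mulcl_z12 hS hn P1) (mulcl_z22 hn P2)) (spinor_lap2Z P1 P2 E1 E2).
have l01 : lift ord0 ord0 = 1 :> 'I_2 by apply: val_inj.
case: p => [] [|[|//]] lt.
  apply: sub_eq h1 _ => u; rewrite mxE big_ord_recl big_ord1 !mxE /= l01 /entry.
  by congr (_ * _ + _ * _); congr (f u _ _); apply: val_inj.
apply: sub_eq h2 _ => u; rewrite mxE big_ord_recl big_ord1 !mxE /= l01 /entry.
by congr (_ * _ + _ * _); congr (f u _ _); apply: val_inj.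
Qed.

(** The matrix of the first-order operator is symmetric, so transposition exchanges the row and
    column equations. *)
Lemma Vrow_tr e (g : reg -> 'rV[C]_2) : Vrow e g -> Vcol e (fun u => (g u)^T).
Proof.
move=> [hg E]; split=> [p q|u p].
  apply: sub_eq (hg q p) _ => u; by rewrite /entry mxE.
rewrite -[RHS](E u p); apply: eq_bigr => q _.
rewrite /dZplus addnC; congr (nth _ _ _).
by rewrite (_ : entry (fun u0 => (g u0)^T) q 0 = entry g 0 q) //; apply/funext => v; rewrite /entry mxE.
Qed.

(** Parity decides which factor vanishes: 2 k + 2 l + 1 is odd here, while in [cK1] it is 2 k + 1
    that is odd. *)
Lemma cK0 k l : cK 0 k l -> k = 0.
Proof. by rewrite /cK => /eqP; rewrite mulf_eq0 => /orP[] /eqP; lia. Qed.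

Lemma cK1 k l : cK 1 k l -> k = - (l%:Z + 1).
Proof. by rewrite /cK => /eqP; rewrite mulf_eq0 => /orP[] /eqP; lia. Qed.

End Spinors.

(** * Integration over the cycle *)

Section Integrals.
Variable R : realType.
Local Notation C := R[i].
Local Notation i := ('i%C : C).
Local Notation reg := (reg R).
Local Notation Fn := (reg -> C^o).
Local Notation mu := (@lebesgue_measure R).

Lemma rcontD (f g : R -> R) : continuous f -> continuous g -> continuous (fun x => f x + g x).
Proof. by move=> cf cg x; apply: cvgD; [exact: cf|exact: cg]. Qed.

Lemma rcontM (f g : R -> R) : continuous f -> continuous g -> continuous (fun x => f x * g x).
Proof. by move=> cf cg x; apply: cvgM; [exact: cf|exact: cg]. Qed.

Lemma rcontB (f g : R -> R) : continuous f -> continuous g -> continuous (fun x => f x - g x).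
Proof. by move=> cf cg x; apply: cvgB; [exact: cf|exact: cg]. Qed.

Lemma rcont_cst (c : R) : continuous (fun _ : R => c).
Proof. by move=> x; exact: cvg_cst. Qed.

(* A plain definition, lest type class resolution try to solve it. *)
Definition primitive (F f : R -> R) : Prop := forall x : R, is_derive x 1 F (f x).

Lemma FTC (F f : R -> R) (a b : R) : a < b -> primitive F f ->
  continuous f -> \int[mu]_(x in `[a, b]) f x = F b - F a.
Proof.
move=> ab dF cf; have cF x : {for x, continuous F}.
  by apply: differentiable_continuous; apply/derivable1_diffP; case: (dF x).
rewrite /Rintegral (@continuous_FTC2 _ f F a b) //.
- exact: continuous_subspaceT.
- split => [x _| |]; first by case: (dF x).
  + exact/cvg_at_right_filter/cF.
  + exact/cvg_at_left_filter/cF.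
- by move=> x _; rewrite derive1E; case: (dF x).
Qed.

Lemma integrable_continuous (f : R -> R) a b : continuous f ->
  mu.-integrable `[a, b] (EFin \o f).
Proof.
move=> cf; apply: continuous_compact_integrable; first exact: segment_compact.
exact: continuous_subspaceT.
Qed.

(** Continuity is split into real and imaginary parts because the complex integral [cint] is. *)
Definition ccont (f : R -> C) : Prop :=
  continuous (fun x => complex.Re (f x)) /\ continuous (fun x => complex.Im (f x)).

Lemma ReM (x y : C) : complex.Re (x * y) = complex.Re x * complex.Re y - complex.Im x * complex.Im y.
Proof. by case: x y => [a b] [c d]. Qed.

Lemma ImM (x y : C) : complex.Im (x * y) = complex.Re x * complex.Im y + complex.Im x * complex.Re y.
Proof. by case: x y => [a b] [c d]. Qed.

Lemma ReD (x y : C) : complex.Re (x + y) = complex.Re x + complex.Re y.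
Proof. by case: x y => [a b] [c d]. Qed.

Lemma ImD (x y : C) : complex.Im (x + y) = complex.Im x + complex.Im y.
Proof. by case: x y => [a b] [c d]. Qed.

Lemma ccont_cst c : ccont (fun=> c).
Proof. by split; exact: rcont_cst. Qed.

Lemma ccontD f g : ccont f -> ccont g -> ccont (fun x => f x + g x).
Proof.
move=> [f1 f2] [g1 g2]; split.
  under eq_fun do rewrite ReD.
  exact: rcontD.
under eq_fun do rewrite ImD.
exact: rcontD.
Qed.

Lemma ccontM f g : ccont f -> ccont g -> ccont (fun x => f x * g x).
Proof.
move=> [f1 f2] [g1 g2]; split.
  under eq_fun do rewrite ReM.
  by apply: rcontB; exact: rcontM.
under eq_fun do rewrite ImM.
by apply: rcontD; exact: rcontM.
Qed.

Lemma ccont_real (f : R -> R) : continuous f -> ccont (fun x => (f x)%:C%C).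
Proof. by move=> cf; split => //; exact: rcont_cst. Qed.

Lemma complexE (x y : C) : complex.Re x = complex.Re y -> complex.Im x = complex.Im y -> x = y.
Proof. by case: x y => [a b] [c d] /= -> ->. Qed.

Lemma RintegralZD (c d : R) (f g : R -> R) a b : continuous f -> continuous g ->
  \int[mu]_(x in `[a, b]) (c * f x + d * g x) =
  c * \int[mu]_(x in `[a, b]) f x + d * \int[mu]_(x in `[a, b]) g x.
Proof.
move=> cf cg; have h (k : R) (h : R -> R) : continuous h -> continuous (fun x => k * h x).
  by move=> ch; apply: rcontM => //; exact: rcont_cst.
rewrite RintegralD //; try by apply: integrable_continuous; exact: h.
by rewrite !RintegralZl //; exact: integrable_continuous.
Qed.

Lemma cint_lin a b (c : C) f g : ccont f -> ccont g ->
  cint a b (fun x => c * f x + g x) = c * cint a b f + cint a b g.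
Proof.
move=> [f1 f2] [g1 g2]; have one (h : R -> R) : continuous h ->
    \int[mu]_(x in `[a, b]) h x = \int[mu]_(x in `[a, b]) (1 * h x + 0 * h x).
  by move=> _; apply: eq_Rintegral => x _; rewrite mul1r mul0r addr0.
have E (u v w : R -> R) (p q : R) : continuous u -> continuous v -> continuous w ->
    \int[mu]_(x in `[a, b]) (p * u x + q * v x + w x) =
    p * \int[mu]_(x in `[a, b]) u x + q * \int[mu]_(x in `[a, b]) v x + \int[mu]_(x in `[a, b]) w x.
  move=> cu cv cw; have cz : continuous (fun x => p * u x + q * v x).
    by apply: rcontD; apply: rcontM => //; exact: rcont_cst.
  rewrite -(RintegralZD p q a b cu cv).
  have := RintegralZD 1 1 a b cz cw; rewrite !mul1r => <-.
  by apply: eq_Rintegral => x _; rewrite !mul1r.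
apply: complexE; rewrite /cint /=.
  transitivity (\int[mu]_(x in `[a, b]) (complex.Re c * complex.Re (f x)
     + (- complex.Im c) * complex.Im (f x) + complex.Re (g x))).
    by apply: eq_Rintegral => x _; rewrite ReD ReM mulNr.
  by rewrite E // ReD ReM /= mulNr.
transitivity (\int[mu]_(x in `[a, b]) (complex.Re c * complex.Im (f x)
   + complex.Im c * complex.Re (f x) + complex.Im (g x))).
  by apply: eq_Rintegral => x _; rewrite ImD ImM.
by rewrite E // ImD ImM.
Qed.

Lemma cint0 a b : cint a b (fun=> 0 : C) = 0.
Proof.
have := cint_lin a b (-1) (ccont_cst 0) (ccont_cst 0).
rewrite (_ : (fun _ => _) = fun=> 0); last by apply/funext => x; rewrite mulr0 addr0.
by rewrite mulN1r addNr.
Qed.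

Lemma ccont_sum n (c : 'I_n -> C) (f : 'I_n -> R -> C) : (forall m, ccont (f m)) ->
  ccont (fun x => \sum_(m < n) c m * f m x).
Proof.
elim: n c f => [|n IH] c f hf.
  by under eq_fun do rewrite big_ord0; exact: ccont_cst.
under eq_fun do rewrite big_ord_recl.
by apply: ccontD; [apply: ccontM => //; exact: ccont_cst|exact: IH].
Qed.

Lemma cint_sum n a b (c : 'I_n -> C) (f : 'I_n -> R -> C) : (forall m, ccont (f m)) ->
  cint a b (fun x => \sum_(m < n) c m * f m x) = \sum_(m < n) c m * cint a b (f m).
Proof.
elim: n c f => [|n IH] c f hf.
  by under eq_fun do rewrite big_ord0; rewrite cint0 big_ord0.
under eq_fun do rewrite big_ord_recl.
by rewrite cint_lin ?IH ?big_ord_recl //; exact: ccont_sum.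
Qed.

(** * Integrals of exponentials and of products of sines and cosines *)

Lemma cisD (x y : R) : cis (x + y) = cis x * cis y.
Proof.
apply: complexE; rewrite ?ReM ?ImM /= ?cosD ?sinD //.
by rewrite addrC.
Qed.

Lemma cis0 : cis 0 = 1 :> C.
Proof. by rewrite /cis cos0 sin0. Qed.

Lemma cis_neq0 (x : R) : cis x != 0.
Proof.
apply/eqP => h; have := cisD x (- x); rewrite subrr cis0 h mul0r => /eqP.
by rewrite oner_eq0.
Qed.

Lemma cisN (x : R) : cis (- x) = (cis x)^-1.
Proof.
apply: (mulfI (cis_neq0 x)); rewrite -cisD subrr cis0 mulfV //; exact: cis_neq0.
Qed.

Lemma cisX (x : R) (n : nat) : cis x ^+ n = cis (n%:R * x).
Proof.
elim: n => [|n IH]; first by rewrite expr0 mul0r cis0.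
by rewrite exprS IH -cisD -natr1 mulrDl mul1r addrC.
Qed.

Lemma cisXz (x : R) (n : int) : cis x ^ n = cis (n%:~R * x).
Proof.
case: n => n; first exact: cisX.
by rewrite NegzE -exprnN cisX -cisN mulrNz mulNr pmulrn.
Qed.

Lemma cis2pi : cis (2 * pi) = 1 :> C.
Proof. by rewrite /cis mulr_natl cos2pi sin2pi. Qed.

Lemma ccont_cisz (n : int) : ccont (fun x : R => cis x ^ n).
Proof.
under eq_fun do rewrite cisXz.
have c x : {for x, continuous (fun x : R => n%:~R * x)}.
  by apply: cvgM; [exact: cvg_cst|exact: cvg_id].
split => x /=; apply: continuous_comp; [exact: c|exact: continuous_cos|exact: c|exact: continuous_sin].
Qed.

(** For n nonzero both real antiderivatives are periodic, with values agreeing at 0 and 2 pi. *)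
Lemma cint_cisz (n : int) :
  cint 0 (2 * pi) (fun x : R => cis x ^ n) = (if n == 0 then 2 * pi else 0)%:C%C.
Proof.
have p0 : 0 < 2 * pi :> R by rewrite mulr_gt0 ?pi_gt0.
under eq_fun do rewrite cisXz.
have [->|n0] := eqVneq n 0.
  rewrite (_ : (fun _ => _) = fun=> 1); last by apply/funext => x; rewrite mul0r cis0.
  rewrite /cint /=.
  rewrite (@FTC (fun x => x) (fun=> 1)) ?(@FTC (fun=> 0) (fun=> 0)) //; try exact: rcont_cst.
  - by rewrite !subr0.
  - by move=> x; exact: is_derive_cst.
  - by move=> x; exact: is_derive_id.
have n0' : n%:~R != 0 :> R by rewrite intr_eq0.
have dl (x : R) : is_derive x 1 (fun y : R => n%:~R * y) n%:~R.
  have := @is_deriveZ _ _ _ id n%:~R x 1 1 (is_derive_id _ _).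
  by rewrite [n%:~R *: 1]mulr1.
have cl x : {for x, continuous (fun x : R => n%:~R * x)}.
  by apply: cvgM; [exact: cvg_cst|exact: cvg_id].
have ec : cos (n%:~R * (2 * pi)) = 1 :> R /\ sin (n%:~R * (2 * pi)) = 0 :> R.
  have : cis (n%:~R * (2 * pi)) = 1 :> C by rewrite -cisXz cis2pi exp1rz.
  by case.
rewrite /cint /=.
rewrite (@FTC (fun x => n%:~R^-1 * sin (n%:~R * x)) (fun x => cos (n%:~R * x))) //; last first.
- by move=> x; apply: continuous_comp; [exact: cl|exact: continuous_cos].
- move=> x; have h := is_derive1_comp (is_derive_sin (n%:~R * x)) (dl x).
  have := is_deriveZ n%:~R^-1 h.
  move=> H; apply: (is_derive_eq H); rewrite /GRing.scale /=.
  by rewrite mulrCA mulVf // mulr1.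
rewrite (@FTC (fun x => - n%:~R^-1 * cos (n%:~R * x)) (fun x => sin (n%:~R * x))) //; last first.
- by move=> x; apply: continuous_comp; [exact: cl|exact: continuous_sin].
- move=> x; have h := is_derive1_comp (is_derive_cos (n%:~R * x)) (dl x).
  have := is_deriveZ (- n%:~R^-1) h.
  move=> H; apply: (is_derive_eq H); rewrite /GRing.scale /=.
  by rewrite mulNr mulNr mulrN opprK mulrCA mulVf // mulr1.
by rewrite mulr0 sin0 cos0 ec.1 ec.2 !mulr0 !subrr.
Qed.

(** The theta-part of a monomial with equal exponents a of z11 and z22; the additional sine comes
    from the volume form. *)
Definition sc (a c : nat) (x : R) : R := sin x ^+ (2 * a + 1) * cos x ^+ c.
Definition Ssc (a c : nat) : R := \int[mu]_(x in `[0, pi]) sc a c x.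

Lemma continuousX (f : R -> R) n : continuous f -> continuous (fun x => f x ^+ n).
Proof.
move=> cf; elim: n => [|n IH]; first by under eq_fun do rewrite expr0; exact: rcont_cst.
under eq_fun do rewrite exprS.
exact: rcontM.
Qed.

Lemma continuous_sincos a c : continuous (fun x : R => sin x ^+ a * cos x ^+ c).
Proof.
by apply: rcontM; apply: continuousX; [exact: continuous_sin|exact: continuous_cos].
Qed.

Lemma is_derive_sincos a c (x : R) :
  is_derive x 1 (fun x : R => sin x ^+ a.+1 * cos x ^+ c)
    (a.+1%:R * (sin x ^+ a * cos x ^+ c.+1) - c%:R * (sin x ^+ a.+2 * cos x ^+ c.-1)).
Proof.
have := is_deriveM (is_deriveX a.+1 (is_derive_sin x)) (is_deriveX c (is_derive_cos x)).
rewrite (_ : _ * _ = fun x : R => sin x ^+ a.+1 * cos x ^+ c); last first.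
  by apply/funext => y; rewrite !fctE.
move=> H; apply: (is_derive_eq H); rewrite /GRing.scale /= !fctE.
by rewrite !exprS; ring.
Qed.

Lemma Ssc_split a c : Ssc a c = Ssc a.+1 c + Ssc a c.+2.
Proof.
rewrite -[Ssc a.+1 c]mul1r -[Ssc a c.+2]mul1r /Ssc -RintegralZD; try exact: continuous_sincos.
apply: eq_Rintegral => x _; rewrite /sc !mul1r !mulnS.
have h := cos2Dsin2 x.
by rewrite -[LHS]mulr1 -h !addSn add0n !exprS; ring.
Qed.

(** Integrate the derivative of sin^(2a+2) cos^(c+1), which vanishes at both ends. Together with
    [Ssc_split] and [Ssc1] this relation suffices for [stokes_mono], without closed forms of the
    integrals. *)
Lemma Ssc_rec a c : (2 * a%:R + 2) * Ssc a c.+2 = (c%:R + 1) * Ssc a.+1 c.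
Proof.
apply/eqP; rewrite -subr_eq0 -mulNr /Ssc -RintegralZD; try exact: continuous_sincos.
rewrite (@FTC (fun x => sin x ^+ (2 * a + 1).+1 * cos x ^+ c.+1)) ?pi_gt0 //.
- by rewrite sinpi sin0 !expr0n /= !mul0r subr0.
- move=> x; apply: (is_derive_eq (is_derive_sincos _ _ x)).
  rewrite /sc mulnS !addSn add0n /=; rewrite -!natr1 natrD natrM.
  by rewrite mulNr; ring.
- by apply: rcontD; apply: rcontM; by [exact: rcont_cst|exact: continuous_sincos].
Qed.

Lemma Ssc1 a : Ssc a 1 = 0.
Proof.
suff : (2 * a + 2)%:R * Ssc a 1 = 0.
  by move=> /eqP; rewrite mulf_eq0 pnatr_eq0 addn2 /= => /eqP.
rewrite /Ssc -RintegralZl //; last by apply: integrable_continuous; exact: continuous_sincos.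
rewrite (@FTC (fun x => sin x ^+ (2 * a + 1).+1 * cos x ^+ 0)) ?pi_gt0 //.
- by rewrite sinpi sin0 !expr0n /= !mul0r subr0.
- move=> x; apply: (is_derive_eq (is_derive_sincos _ _ x)).
  by rewrite /sc mul0r subr0 addn1 addn2.
- by apply: rcontM; [exact: rcont_cst|exact: continuous_sincos].
Qed.

Lemma Ssc00 : Ssc 0 0 = 2.
Proof.
rewrite /Ssc (@FTC (fun x => - cos x)) ?pi_gt0 //.
- by rewrite cospi cos0 opprK.
- move=> x; have H := is_deriveN (is_derive_cos x); apply: (is_derive_eq H).
  by rewrite opprK /sc expr1 expr0 mulr1.
- exact: continuous_sincos.
Qed.

(** * The volume form in the angular parametrization *)

Lemma det3 (f : nat -> nat -> C) : \det (\matrix_(p < 3, q < 3) f p q) =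
  f 0 0 * (f 1 1 * f 2 2 - f 1 2 * f 2 1) - f 0 1 * (f 1 0 * f 2 2 - f 1 2 * f 2 0)
  + f 0 2 * (f 1 0 * f 2 1 - f 1 1 * f 2 0).
Proof.
have d2 (A : 'M[C]_2) : \det A = A ord0 ord0 * A (lift ord0 ord0) (lift ord0 ord0)
    - A ord0 (lift ord0 ord0) * A (lift ord0 ord0) ord0.
  rewrite (expand_det_row _ ord0) !big_ord_recl big_ord0 /cofactor !det_mx11 !mxE /=.
  rewrite /bump /= !(addn0, addn1) expr0 expr1 mul1r mulN1r mulrN addr0.
  by congr (_ * A _ _ - _ * A _ _); apply: val_inj.
rewrite (expand_det_row _ ord0) !big_ord_recl big_ord0 /cofactor !d2 !mxE /=.
rewrite /bump /= !(addn0, add0n, addn1) expr0 expr1 sqrrN expr1n; ring.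
Qed.

Lemma cder_real (c : C) (r : R -> R) (dr x : R) : is_derive x 1 r dr ->
  cder (fun y => c * (r y)%:C%C) x = c * dr%:C%C.
Proof.
move=> hr; have E (k : R) : derive1 (fun y => k * r y) x = k * dr.
  by have := is_deriveZ k hr => h; rewrite derive1E; case: h => _ ->.
apply: complexE; rewrite /cder /= ?ReM ?ImM /=.
  rewrite mulr0 subr0 -E; congr (derive1 _ x); apply/funext => y.
  by rewrite ReM /= mulr0 subr0.
rewrite mulr0 add0r -E; congr (derive1 _ x); apply/funext => y.
by rewrite ImM /= mulr0 add0r.
Qed.

Lemma cder_cis (r x : R) : cder (fun y => cis y * r%:C%C) x = i * cis x * r%:C%C.
Proof.
have E (f : R -> R) df : is_derive x 1 f df -> derive1 (fun y => r * f y) x = r * df.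
  by move=> hf; have := is_deriveZ r hf => h; rewrite derive1E; case: h => _ ->.
apply: complexE; rewrite /cder /=.
  rewrite (_ : (fun y => _) = fun y => r * cos y).
    by rewrite (E _ _ (is_derive_cos x)); ring.
  by apply/funext => y; rewrite /=; ring.
rewrite (_ : (fun y => _) = fun y => r * sin y).
  by rewrite (E _ _ (is_derive_sin x)); ring.
by apply/funext => y; rewrite /=; ring.
Qed.

Lemma z013_gam (p : 'I_3) (theta phi alpha : R) :
  z013 p (gam theta phi alpha) = cis alpha *
    (nth 0 [:: sin theta * cos phi; - cos theta; - (sin theta * sin phi)] p)%:C%C.
Proof.
case: p => [] [|[|[|//]]] ?; apply: complexE;
  rewrite /z013 /gam /dilate /S2pt /z11 /z22 /z12 /ct /= -/(i) ?cosN ?sinN; simpc; rewrite /=;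
  by field.
Qed.

(** Every column of the determinant carries a factor [cis alpha], and the last one also i. What
    remains is a real determinant equal to minus the area density sin theta of the sphere. *)
Lemma dZ3E (theta phi alpha : R) :
  dZ3 theta phi alpha = - i * (sin theta)%:C%C * cis alpha ^+ 3.
Proof.
rewrite /dZ3; set A := \matrix_(p, q) _.
pose X (p : nat) (th ph : R) := nth 0 [:: sin th * cos ph; - cos th; - (sin th * sin ph)] p.
pose Xt (p : nat) := nth 0 [:: cos theta * cos phi; sin theta; - (cos theta * sin phi)] p.
pose Xp (p : nat) := nth 0 [:: - (sin theta * sin phi); 0; - (sin theta * cos phi)] p.
have -> : A = \matrix_(p < 3, q < 3) nth 0 [:: cis alpha * (Xt p)%:C%C;
    cis alpha * (Xp p)%:C%C; i * cis alpha * (X p theta phi)%:C%C] q.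
  apply/matrixP => p q; rewrite !mxE; congr (nth 0 [:: _; _; _] q).
  - under eq_fun do rewrite z013_gam.
    apply: cder_real; rewrite /Xt; case: p => [] [|[|[|//]]] ? /=.
    + have H := is_deriveZ (cos phi) (is_derive_sin theta).
      rewrite (_ : (fun _ => _) = cos phi \*: sin); last by apply/funext => y; rewrite mulrC.
      by apply: (is_derive_eq H); rewrite [LHS]mulrC.
    + by have H := is_deriveN (is_derive_cos theta); apply: (is_derive_eq H); rewrite opprK.
    + have H := is_deriveZ (- sin phi) (is_derive_sin theta).
      rewrite (_ : (fun _ => _) = - sin phi \*: sin); last first.
        by apply/funext => y; rewrite [RHS]mulNr mulrC.
      by apply: (is_derive_eq H); rewrite [LHS]mulNr mulrC.
  - under eq_fun do rewrite z013_gam.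
    apply: cder_real; rewrite /Xp; case: p => [] [|[|[|//]]] ? /=.
    + have H := is_deriveZ (sin theta) (is_derive_cos phi).
      by apply: (is_derive_eq H); rewrite [LHS]mulrN.
    + exact: is_derive_cst.
    + have H := is_deriveN (is_deriveZ (sin theta) (is_derive_sin phi)).
      exact: (is_derive_eq H).
  - under eq_fun do rewrite z013_gam.
    exact: cder_cis.
rewrite (det3 (fun p q => nth 0 [:: cis alpha * (Xt p)%:C%C;
    cis alpha * (Xp p)%:C%C; i * cis alpha * (X p theta phi)%:C%C] q)) /= /X /Xt /Xp /=.
have h1 := cos2Dsin2 theta; have h2 := cos2Dsin2 phi.
have h1' : (cos theta)%:C%C ^+ 2 + (sin theta)%:C%C ^+ 2 = 1 :> C.
  by rewrite -!rmorphXn -rmorphD h1.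
have h2' : (cos phi)%:C%C ^+ 2 + (sin phi)%:C%C ^+ 2 = 1 :> C.
  by rewrite -!rmorphXn -rmorphD h2.
rewrite !(rmorphN, rmorphM, rmorph0) /=.
set ct := (cos theta)%:C%C in h1' *; set st := (sin theta)%:C%C in h1' *.
set cp := (cos phi)%:C%C in h2' *; set sp := (sin phi)%:C%C in h2' *.
set z := cis alpha.
have -> : - i * st * z ^+ 3 = - i * st * (ct ^+ 2 + st ^+ 2) * (cp ^+ 2 + sp ^+ 2) * z ^+ 3.
  by rewrite h1' h2' !mulr1.
by ring.
Qed.

(** * Integrals of Laurent monomials over the cycle *)

Lemma NZ_gam (theta phi alpha : R) : NZ (gam theta phi alpha) = cis alpha ^+ 2.
Proof.
rewrite NZE /gam /dilate /S2pt /z11 /z22 /ct /= cisN.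
have h1' : (cos theta)%:C%C ^+ 2 + (sin theta)%:C%C ^+ 2 = 1 :> C.
  by rewrite -!rmorphXn -rmorphD cos2Dsin2.
rewrite -[RHS]mulr1 -h1'; field; exact: cis_neq0.
Qed.

Lemma gam_reg (theta phi alpha : R) : NZ (gam theta phi alpha) != 0.
Proof. by rewrite NZ_gam expf_neq0 // cis_neq0. Qed.

Lemma mono_gam a b c k (theta phi alpha : R) :
  ext0 (laurent_monomial a b c k) (gam theta phi alpha) =
  i ^+ c * (sin theta ^+ (a + b) * cos theta ^+ c)%:C%C
   * cis phi ^ (a%:Z - b%:Z) * cis alpha ^ ((a + b + c)%:Z + 2 * k).
Proof.
rewrite (ext0E _ (gam_reg theta phi alpha)) /laurent_monomial /= NZ_gam.
rewrite /z12 /gam /dilate /S2pt /z11 /z22 /ct /= cisN.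
have p0 := cis_neq0 phi; have a0 := cis_neq0 alpha.
rewrite !expfzDr // !PoszD !expfzDr // !rmorphM !rmorphXn /= !exprMn -exprnP.
rewrite (_ : cis phi ^ (- b%:Z) = (cis phi)^-1 ^+ b); last by rewrite -exprnN exprVn.
rewrite -exprnP -(exprz_exp (cis alpha) 2 k) -!exprnP exprD.
by ring.
Qed.

(** The phi-integral forces a = b. The alpha-integral forces total weight 0: a + b + c + 2 k from
    the monomial, e from the level, 3 from the volume form. The power of i reflects z12 = i t. *)
Definition Kint (e a b c : nat) (k : int) : C :=
  if (a == b) && ((a + b + c + e + 3)%:Z + 2 * k == 0)
  then - i * ((2 * pi) ^+ 2)%:C%C * i ^+ c * (Ssc a c)%:C%C else 0.

(** Additivity of an iterated integral requires continuity at each of its three stages. It is proved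
    once, for combinations of monomials, where every stage integrates a finite sum of continuous
    one-variable functions. *)
Lemma int_Gamma_mono_sum e n (x : 'I_n -> C) (a b c : 'I_n -> nat) (k : 'I_n -> int) :
  int_Gamma e (fun u => \sum_(m < n) x m * laurent_monomial (a m) (b m) (c m) (k m) u) =
  \sum_(m < n) x m * Kint e (a m) (b m) (c m) (k m).
Proof.
rewrite /int_Gamma.
pose d m : int := (a m + b m + c m + e + 3)%:Z + 2 * k m.
pose f m : int := (a m)%:Z - (b m)%:Z.
pose A m theta : C := (sin theta ^+ (a m + b m + 1) * cos theta ^+ c m)%:C%C.
pose y m : C := x m * (- i * i ^+ c m).
pose D (z : int) : C := (if z == 0 then 2 * pi else 0)%:C%C.
have E1 theta phi alpha : cis alpha ^+ e * ext0 (fun u => \sum_(m < n) x m *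
      laurent_monomial (a m) (b m) (c m) (k m) u) (gam theta phi alpha) * dZ3 theta phi alpha
    = \sum_(m < n) (y m * A m theta * cis phi ^ f m) * cis alpha ^ d m.
  have -> : ext0 (fun u => \sum_(m < n) x m * laurent_monomial (a m) (b m) (c m) (k m) u)
      (gam theta phi alpha) =
      \sum_(m < n) x m * ext0 (laurent_monomial (a m) (b m) (c m) (k m)) (gam theta phi alpha).
    rewrite (ext0E _ (gam_reg theta phi alpha)); apply: eq_bigr => m _.
    by rewrite (ext0E _ (gam_reg theta phi alpha)).
  rewrite dZ3E mulr_sumr mulr_suml; apply: eq_bigr => m _.
  rewrite mono_gam.
  rewrite /y /A /d /f !rmorphM !rmorphXn /= !exprD expr1.
  have a0 := cis_neq0 alpha; have f0 := cis_neq0 phi.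
  rewrite !PoszD !expfzDr // -(exprnP _ e) -(exprnP _ 3).
  by ring.
have E2 theta phi : cint 0 (2 * pi) (fun alpha => cis alpha ^+ e *
      ext0 (fun u => \sum_(m < n) x m * laurent_monomial (a m) (b m) (c m) (k m) u)
        (gam theta phi alpha) * dZ3 theta phi alpha) =
    \sum_(m < n) (y m * A m theta * D (d m)) * cis phi ^ f m.
  under eq_fun do rewrite E1.
  rewrite cint_sum; last by move=> m; exact: ccont_cisz.
  by apply: eq_bigr => m _; rewrite cint_cisz -/(D _) mulrAC.
have E3 theta : cint 0 (2 * pi) (fun phi => cint 0 (2 * pi) (fun alpha => cis alpha ^+ e *
      ext0 (fun u => \sum_(m < n) x m * laurent_monomial (a m) (b m) (c m) (k m) u)
        (gam theta phi alpha) * dZ3 theta phi alpha)) =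
    \sum_(m < n) (y m * D (d m) * D (f m)) * A m theta.
  under eq_fun do rewrite E2.
  rewrite cint_sum; last by move=> m; exact: ccont_cisz.
  by apply: eq_bigr => m _; rewrite cint_cisz -/(D _); ring.
under eq_fun do rewrite E3.
rewrite cint_sum; last first.
  by move=> m; apply: ccont_real; exact: continuous_sincos.
apply: eq_bigr => m _; rewrite /Kint /D -/(d m) /f subr_eq0 eqz_nat.
case: (a m =P b m) => [ab|_]; last by rewrite /= !(mulr0, mul0r).
case: (d m =P 0) => [d0|_] /=; last by rewrite !(mulr0, mul0r).
have -> : cint 0 pi (A m) = (Ssc (a m) (c m))%:C%C.
  rewrite /A -ab addnn -mul2n /Ssc /sc /cint /=.
  rewrite (@FTC (fun=> 0) (fun=> 0)) ?pi_gt0 ?subrr //; first by move=> z; exact: is_derive_cst.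
  exact: rcont_cst.
by rewrite /y rmorphXn; ring.
Qed.

Lemma int_Gamma_mono e a b c k : int_Gamma e (laurent_monomial a b c k) = Kint e a b c k.
Proof.
have := int_Gamma_mono_sum e (fun _ : 'I_1 => 1) (fun=> a) (fun=> b) (fun=> c) (fun=> k).
rewrite big_ord1 mul1r => <-; congr (int_Gamma e).
by apply/funext => u; rewrite big_ord1 mul1r.
Qed.

Lemma P_repr (h : Fn) : P h -> exists n (x : 'I_n -> C) (a b c : 'I_n -> nat) (k : 'I_n -> int),
  h = fun u => \sum_(m < n) x m * laurent_monomial (a m) (b m) (c m) (k m) u.
Proof.
move=> [n [x [f [hf ->]]]].
have /choice[t ht] : forall m, exists t : nat * nat * nat * int,
    f m = laurent_monomial t.1.1.1 t.1.1.2 t.1.2 t.2.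
  by move=> m; have [a [b [c [k ->]]]] := hf m; exists (a, b, c, k).
exists n, x, (fun m => (t m).1.1.1), (fun m => (t m).1.1.2), (fun m => (t m).1.2), (fun m => (t m).2).
apply/funext => u; rewrite fct_sumE; apply: eq_bigr => m _.
by rewrite -ht.
Qed.

(** Both functions are finite combinations of monomials; concatenating the two combinations reduces
    the claim to [int_Gamma_mono_sum]. *)
Lemma int_Gamma_lin e (y : C) (g h : Fn) : P g -> P h ->
  int_Gamma e (y *: g + h) = y * int_Gamma e g + int_Gamma e h.
Proof.
move=> /P_repr[n [x [a [b [c [k ->]]]]]] /P_repr[n' [x' [a' [b' [c' [k' ->]]]]]].
rewrite !int_Gamma_mono_sum.
pose J T (s : 'I_n -> T) (s' : 'I_n' -> T) (m : 'I_(n + n')) :=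
  match fintype.split m with inl j => s j | inr j => s' j end.
have Jl T s s' (m : 'I_n) : @J T s s' (lshift n' m) = s m.
  by rewrite /J (unsplitK (inl m : 'I_n + 'I_n')).
have Jr T s s' (m : 'I_n') : @J T s s' (rshift n m) = s' m.
  by rewrite /J (unsplitK (inr m : 'I_n + 'I_n')).
transitivity (int_Gamma e (fun u => \sum_(m < n + n') J _ (fun m => y * x m) x' m *
    laurent_monomial (J _ a a' m) (J _ b b' m) (J _ c c' m) (J _ k k' m) u)).
  congr (int_Gamma e); apply/funext => u; rewrite lin_fct big_split_ord /= mulr_sumr.
  congr (_ + _); apply: eq_bigr => m _; first by rewrite !Jl mulrA.
  by rewrite !Jr.
rewrite int_Gamma_mono_sum big_split_ord /= mulr_sumr.
congr (_ + _); apply: eq_bigr => m _; first by rewrite !Jl mulrA.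
by rewrite !Jr.
Qed.

Lemma int_Gamma0 e : int_Gamma e (0 : Fn) = 0.
Proof.
have := int_Gamma_lin e (-1) (P_subsp R).1 (P_subsp R).1.
by rewrite scaler0 addr0 mulN1r addNr.
Qed.

Lemma int_GammaD e (g h : Fn) : P g -> P h ->
  int_Gamma e (fun u => g u + h u) = int_Gamma e g + int_Gamma e h.
Proof.
move=> hg hh; have := int_Gamma_lin e 1 hg hh; rewrite mul1r => <-.
by congr (int_Gamma e); apply/funext => u; rewrite lin_fct mul1r.
Qed.

Lemma int_GammaZ e y (h : Fn) : P h -> int_Gamma e (fun u => y * h u) = y * int_Gamma e h.
Proof.
move=> hh; rewrite -[RHS]addr0 -(int_Gamma0 e) -(int_Gamma_lin e y hh (P_subsp R).1).
by congr (int_Gamma e); apply/funext => u; rewrite lin_fct [RHS]addr0.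
Qed.

(** * The integral of a derivative over the cycle *)

Lemma pd0X j (f df : Fn) n : pd0 j f df ->
  pd0 j (fun u => f u ^+ n) (fun u => n%:R * f u ^+ n.-1 * df u).
Proof.
move=> hf; elim: n => [|n IH].
  by apply: (pd0_eq (pd0_cst 1 j)) => u; rewrite !mul0r.
rewrite (_ : (fun _ => _) = fun u => f u * f u ^+ n); last first.
  by apply/funext => u; rewrite exprS.
apply: (pd0_eq (pd0M hf IH)) => u; rewrite /= -natr1.
by case: n {IH} => [|n]; rewrite /= ?exprS; ring.
Qed.

Local Notation mono := laurent_monomial.

(** In the t-direction the monomials are written in z12 = i t, whence 2 t = - 2 i z12 and the factor
    i in the last entry. *)
Lemma pder_mono e j a b c k u : pder e j (mono a b c k) u =
  (k%:~R + e%:R / 2) * nth 0 [:: mono a b.+1 c (k - 1) u; mono a.+1 b c (k - 1) u;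
     - (2 * i) * mono a b c.+1 (k - 1) u] j
  + nth 0 [:: a%:R * mono a.-1 b c k u; b%:R * mono a b.-1 c k u;
     c%:R * i * mono a b c.-1 k u] j.
Proof.
have [h1 h2 h3] := pd0_coord R j.
have H := pd0M (pd0M (pd0M (pd0X a h1) (pd0X b h2)) (pd0X c (pd0Z i h3))) (pd0_Nexp j k).
rewrite (pderE e u H) /laurent_monomial /nN NexpP.
have u0 := Nneq0 u; have ii : i * i = -1 by rewrite -expr2 sqr_i.
have hc : 2 * ct (val u) = - (2 * i) * (i * ct (val u)) by ring: ii.
rewrite /z12; move: (i * _) hc => w hc.
case: j {h1 h2 h3 H} => [] [|[|[|//]]] ? /=.
- by rewrite !exprS; field.
- by rewrite !exprS; field.
rewrite hc !exprS; by field.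
Qed.

(** The derivative consists of two monomials subject to the same angular conditions. When these
    hold, the weight condition fixes the total exponent [x] of N, and the two integrals cancel by
    [Ssc_split] and [Ssc_rec]. *)
Lemma stokes_mono e j a b c k : int_Gamma e (pder e j (mono a b c k : Fn)) = 0.
Proof.
pose x : C := k%:~R + e%:R / 2.
have ii : i * i = -1 by rewrite -expr2 sqr_i.
have E1 p q r s p' q' r' s' (y y' : C) : int_Gamma e (fun u => y * mono p q r s u + y' * mono p' q' r' s' u)
   = y * Kint e p q r s + y' * Kint e p' q' r' s'.
  rewrite int_GammaD; try by apply: (mulcl_cst _ (P_subsp R)); exact: P_mono.
  by rewrite !int_GammaZ ?int_Gamma_mono //; exact: P_mono.
have split1 (p q : nat) : (Ssc p q)%:C%C = (Ssc p.+1 q)%:C%C + (Ssc p q.+2)%:C%C :> C.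
  by rewrite -rmorphD -Ssc_split.
have rec1 (p q : nat) : (2 * p%:R + 2) * (Ssc p q.+2)%:C%C = (q%:R + 1) * (Ssc p.+1 q)%:C%C :> C.
  have := congr1 (fun z : R => z%:C%C : C) (Ssc_rec p q).
  by rewrite !(rmorphM, rmorphD, rmorph_nat, rmorph1).
have xE (z : int) : (2 * k + e%:Z + z = 0) -> x = - z%:~R / 2.
  move=> hz; apply/eqP; rewrite -subr_eq0.
  have -> : x - - z%:~R / 2 = (2 * k + e%:Z + z)%:~R / 2 by rewrite /x; field.
  by rewrite hz mul0r.
have cast3 (p q : nat) : (2 * p + q + 3)%:Z%:~R = 2 * p%:R + q%:R + 3 :> C.
  by rewrite -pmulrn natrD natrD natrM.
pose K (q : nat) : C := - i * ((2 * pi) ^+ 2)%:C%C * i ^+ q.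
have fin p q : - (2 * p + q + 3)%:Z%:~R / 2 * (K q * (Ssc p.+1 q)%:C%C)
    + p.+1%:R * (K q * (Ssc p q)%:C%C) = 0.
  transitivity (K q / 2 * ((2 * p%:R + 2) * (Ssc p q.+2)%:C%C - (q%:R + 1) * (Ssc p.+1 q)%:C%C)).
    by rewrite (split1 p q) cast3 -[p.+1%:R]natr1; field.
  by rewrite rec1 subrr mulr0.
case: j => [] [|[|[|//]]] lt.
- rewrite (_ : pder _ _ _ = fun u => x * mono a b.+1 c (k - 1) u + a%:R * mono a.-1 b c k u); last first.
    by apply/funext => u; rewrite pder_mono.
  rewrite E1 /Kint; case: a => [|a] /=; first by rewrite mul0r mulr0 addr0.
  rewrite eqSS; case: eqP => [<-|_] /=; last by rewrite !mulr0 addr0.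
  rewrite (_ : (a.+1 + a.+1 + c + e + 3)%:Z + 2 * (k - 1) = (a + a + c + e + 3)%:Z + 2 * k); last by lia.
  case: eqP => [h|_]; last by rewrite !mulr0 addr0.
  rewrite (xE (2 * a + c + 3)%:Z); last by lia.
  exact: fin.
- rewrite (_ : pder _ _ _ = fun u => x * mono a.+1 b c (k - 1) u + b%:R * mono a b.-1 c k u); last first.
    by apply/funext => u; rewrite pder_mono.
  rewrite E1 /Kint; case: b => [|b] /=; first by rewrite mul0r mulr0 addr0.
  rewrite eqSS; case: eqP => [->|_] /=; last by rewrite !mulr0 addr0.
  rewrite (_ : (b.+1 + b.+1 + c + e + 3)%:Z + 2 * (k - 1) = (b + b + c + e + 3)%:Z + 2 * k); last by lia.
  case: eqP => [h|_]; last by rewrite !mulr0 addr0.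
  rewrite (xE (2 * b + c + 3)%:Z); last by lia.
  exact: fin.
rewrite (_ : pder _ _ _ = fun u => (- (2 * i) * x) * mono a b c.+1 (k - 1) u
    + (c%:R * i) * mono a b c.-1 k u); last first.
  by apply/funext => u; rewrite pder_mono /= -/x; ring.
rewrite E1 /Kint; case: eqP => [<-|_] /=; last by rewrite !mulr0 addr0.
(* For c = 0 the second monomial has coefficient 0, and the first contains a single cosine, whose
   integral is [Ssc1]. *)
case: c => [|c] /=.
  by rewrite Ssc1 !(mulr0, mul0r) if_same mulr0 addr0.
rewrite (_ : (a + a + c.+2 + e + 3)%:Z + 2 * (k - 1) = (a + a + c + e + 3)%:Z + 2 * k); last by lia.
case: eqP => [h|_]; last by rewrite !mulr0 addr0.
rewrite (xE (2 * a + c + 3)%:Z); last by lia.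
transitivity (K c * i * ((c%:R + 1) * (Ssc a.+1 c)%:C%C - (2 * a%:R + 2) * (Ssc a c.+2)%:C%C)).
  by rewrite (split1 a c) cast3 -[c.+1%:R]natr1 !exprS /K; field: ii.
by rewrite rec1 subrr mulr0.
Qed.

Lemma stokes e j (h : Fn) : P h -> int_Gamma e (pder e j h) = 0.
Proof.
move=> /[dup] hP; move: h hP; suff : @P R `<=` [set h | P h /\ int_Gamma e (pder e j h) = 0].
  by move=> H h _ /H[].
apply: lspan_min.
  split=> [|y g h [hg Ig] [hh Ih]]; first by split; [exact: (P_subsp R).1|rewrite pder_0 int_Gamma0].
  split; first exact: (P_subsp R).2.
  rewrite (pder_linf e j y (P_dif hg) (P_dif hh)) int_Gamma_lin; try exact: P_pder.
  by rewrite Ig Ih mulr0 addr0.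
by move=> _ [a [b [c [k ->]]]]; split; [exact: P_mono|exact: stokes_mono].
Qed.

(** The hypothesis is the weight condition of [Kint]. The integral equals - 8 i pi^2, which the
    normalizing factor of [tau] turns into 1. *)
Lemma int_Gamma_N e (k : int) : (e%:Z + 3 + 2 * k = 0) -> int_Gamma e (fun u : reg => NV u ^ k) != 0.
Proof.
move=> hk; rewrite (_ : (fun _ => _) = mono 0 0 0 k); last first.
  by apply/funext => u; rewrite /laurent_monomial !expr0 !mul1r.
rewrite int_Gamma_mono /Kint eqxx /= (_ : (0 + 0 + 0 + e + 3)%:Z + 2 * k = 0) ?eqxx; last by rewrite !add0n PoszD.
rewrite Ssc00 expr0 mulr1 !mulf_neq0 //.
- by rewrite oppr_eq0; apply/eqP => /(congr1 (@complex.Im R)) /= /eqP; rewrite oner_eq0.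
- by rewrite fmorph_eq0 expf_neq0 // mulf_neq0 ?pnatr_eq0 // gt_eqF // pi_gt0.
- by rewrite fmorph_eq0 pnatr_eq0.
Qed.

End Integrals.

(** * Solid harmonics *)

Section SolidHarmonics.
Variable R : realType.
Local Notation C := R[i].
Local Notation i := ('i%C : C).
Local Notation pt := (pt R).

(** The ratio of R_l^m to the n-th coefficient of Q^l, for n = l + m. The sign and 2^l l! are those
    of the Legendre function; n! arises when its n-th derivative is read as a Taylor coefficient. *)
Definition solid_cst (l n : nat) : C :=
  (-1) ^+ (n + l) * n`!%:R / (2 ^+ l * l`!%:R).

Lemma solid_cst_neq0 l n : solid_cst l n != 0.
Proof.
rewrite /solid_cst mulf_neq0 ?invr_eq0 ?mulf_neq0 ?expf_neq0 ?oppr_eq0 ?oner_eq0 //;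
  by rewrite ?pnatr_eq0 -?lt0n ?fact_gt0.
Qed.

Lemma lspan_coord (l : nat) (f : pt -> C) (h : pt -> C^o) :
  (forall a b c, (a + b + c = l)%N ->
    homogeneous_poly l.+1 (fun u => f u * (z11 u ^+ a * z22 u ^+ b * ct u ^+ c) : C^o)) ->
  homogeneous_poly l h -> homogeneous_poly l.+1 (fun u => f u * h u : C^o).
Proof.
move=> hf hh.
suff : [set h : pt -> C^o | homogeneous_poly l.+1 (fun u => f u * h u : C^o)] h by [].
have hS : subsp (homogeneous_poly l.+1 : set (pt -> C^o)) by exact: lspan_subsp.
move: h hh; apply: lspan_min.
  split=> [|x u v hu hv].
    have E : (fun u => f u * (0 : pt -> C^o) u : C^o) = 0.
      by apply/funext => u; rewrite mulr0.
    by rewrite /mkset E; exact: hS.1.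
  have E : (fun y => f y * (x *: u + v) y : C^o) =
      x *: ((fun y => f y * u y) : pt -> C^o) + ((fun y => f y * v y) : pt -> C^o).
    by apply/funext => y; exact/esym/(linear_mul x (f y)).
  by rewrite /mkset E; exact: hS.2.
by move=> _ [a [b [c [e ->]]]]; exact: hf.
Qed.

Lemma homogeneous_Q l n : homogeneous_poly l (fun u : pt => (Qp u ^+ l)`_n : C^o).
Proof.
have hS k : subsp (homogeneous_poly k : set (pt -> C^o)) by exact: lspan_subsp.
have mono k a b c : (a + b + c = k)%N ->
    homogeneous_poly k (fun u : pt => z11 u ^+ a * z22 u ^+ b * ct u ^+ c : C^o).
  by move=> e; apply: lspan_gen; exists a, b, c.
elim: l n => [|l IH] n.
  case: n => [|n].
    suff -> : (fun u : pt => (Qp u ^+ 0)`_0 : C^o) = (fun u => z11 u ^+ 0 * z22 u ^+ 0 * ct u ^+ 0).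
      exact: mono.
    by apply/funext => u; rewrite !expr0 coef1 !mulr1.
  suff -> : (fun u : pt => (Qp u ^+ 0)`_n.+1 : C^o) = 0 by exact: (hS 0%N).1.
  by apply/funext => u; rewrite expr0 coef1.
have m1 (h : pt -> C^o) : homogeneous_poly l h -> homogeneous_poly l.+1 (fun u => z11 u * h u : C^o).
  apply: lspan_coord => a b c e.
  have -> : (fun u : pt => z11 u * (z11 u ^+ a * z22 u ^+ b * ct u ^+ c) : C^o) =
      (fun u => z11 u ^+ a.+1 * z22 u ^+ b * ct u ^+ c).
    by apply/funext => u; rewrite exprS; ring.
  by apply: mono; rewrite !addSn e.
have m2 (h : pt -> C^o) : homogeneous_poly l h -> homogeneous_poly l.+1 (fun u => z22 u * h u : C^o).
  apply: lspan_coord => a b c e.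
  have -> : (fun u : pt => z22 u * (z11 u ^+ a * z22 u ^+ b * ct u ^+ c) : C^o) =
      (fun u => z11 u ^+ a * z22 u ^+ b.+1 * ct u ^+ c).
    by apply/funext => u; rewrite exprS; ring.
  by apply: mono; rewrite !addnS !addSn e.
have m3 (h : pt -> C^o) : homogeneous_poly l h -> homogeneous_poly l.+1 (fun u => ct u * h u : C^o).
  apply: lspan_coord => a b c e.
  have -> : (fun u : pt => ct u * (z11 u ^+ a * z22 u ^+ b * ct u ^+ c) : C^o) =
      (fun u => z11 u ^+ a * z22 u ^+ b * ct u ^+ c.+1).
    by apply/funext => u; rewrite exprS; ring.
  by apply: mono; rewrite !addnS e.
have z0 : homogeneous_poly l ((fun=> 0) : pt -> C^o) by exact: (hS l).1.
pose q k (u : pt) : C^o := if (n < k)%N then 0 else (Qp u ^+ l)`_(n - k).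
have hq k : homogeneous_poly l (q k).
  by rewrite /q; case: ltnP => _; [exact: z0|exact: IH].
suff -> : (fun u : pt => (Qp u ^+ l.+1)`_n : C^o) =
    (-1) *: ((fun u => z22 u * q 0%N u) : pt -> C^o)
    + (2 *: ((fun u => ct u * q 1%N u) : pt -> C^o) + ((fun u => z11 u * q 2%N u) : pt -> C^o)).
  by apply: (hS l.+1).2; [exact: m2|apply: (hS l.+1).2; [exact: m3|exact: m1]].
apply/funext => u.
have E (a b c x y z : C) : - a * x + (2 * b * y + c * z) =
    -1 * (a * x) + (2 * (b * y) + c * z) by ring.
rewrite -[RHS]/(-1 * _ + (2 * _ + _)) -[RHS]E.
have -> : Qp u ^+ l.+1 = (- z22 u) *: Qp u ^+ l + ((2 * ct u) *: ('X * Qp u ^+ l) + z11 u *: ('X^2 * Qp u ^+ l)).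
  by rewrite exprS {1}/Qp -!mul_polyC; ring.
rewrite !coefD !coefZ coefXM coefXnM /q ltn0 subn0.
by case: n {q hq} => [|[|n]] /=; rewrite ?subSS ?subn0.
Qed.

(** The n-th derivative at x is n! times the n-th Taylor coefficient there, that is, a coefficient
    of the translated polynomial. *)
Lemma legendre_coef (l n : nat) (x : R) :
  (derivn n (('X^2 - 1) ^+ l)).[x] = n`!%:R * ((('X + x%:P) ^+ 2 - 1) ^+ l)`_n.
Proof.
set p : {poly R} := ('X^2 - 1) ^+ l.
rewrite nderivn_def hornerMn -mulr_natl; congr (_ * _).
have c : GRing.comm x%:P ('X : {poly R}) by exact: mulrC.
(* The expansion is taken long enough to contain the index n even beyond the degree. *)
pose m := maxn n.+1 (size p^:P).
have := nderiv_taylor_wide c (leq_maxr n.+1 (size p^:P)); rewrite -/m.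
have -> : p^:P.[x%:P + 'X] = (('X + x%:P) ^+ 2 - 1) ^+ l.
  rewrite /p !(rmorphXn, rmorphB) /= map_polyX !rmorph1 horner_exp hornerD hornerN.
    by rewrite horner_exp hornerX hornerC addrC [_ + x%:P]addrC addrC.
move=> ->; rewrite coef_sum (bigD1 (Ordinal (leq_maxl n.+1 (size p^:P)))) //=.
rewrite nderivn_map horner_map /= coefCM coefXn eqxx mulr1 big1 ?addr0 // => j jn.
rewrite nderivn_map horner_map /= coefCM coefXn.
case: eqP => [e|_]; last by rewrite mulr0.
by case/eqP: jn; apply: val_inj; exact: esym e.
Qed.

Lemma coef_comp_scale (p : {poly C}) c n : (p \Po (c *: 'X))`_n = c ^+ n * p`_n.
Proof.
have -> : p \Po (c *: 'X) = \sum_(k < size p) (c ^+ k * p`_k) *: 'X^k.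
  by rewrite comp_polyE; apply: eq_bigr => k _; rewrite exprZn scalerA mulrC.
have -> : \sum_(k < size p) (c ^+ k * p`_k) *: 'X^k = \poly_(k < size p) (c ^+ k * p`_k).
  by rewrite poly_def.
rewrite coef_poly; case: ltnP => // h.
by rewrite nth_default // mulr0.
Qed.

(** After [legendre_coef] both sides are coefficients of l-th powers of quadratic polynomials in X,
    and these differ by rescaling X. *)
Lemma is_solid_harmonic_Q (l n : nat) :
  is_solid_harmonic l (n%:Z - l%:Z) (fun u : pt => solid_cst l n * (Qp u ^+ l)`_n : C^o).
Proof.
split.
  have hS : subsp (homogeneous_poly l : set (pt -> C^o)) by exact: lspan_subsp.
  exact: (subspZ (solid_cst l n) hS (homogeneous_Q l n)).
move=> z t z0 r.
case: z z0 @r => a b z0 r.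
pose z : C := (a +i* b)%C; pose rho := Num.sqrt (a ^+ 2 + b ^+ 2).
have rho2 : rho ^+ 2 = a ^+ 2 + b ^+ 2 by rewrite sqr_sqrtr // addr_ge0 ?sqr_ge0.
have nz : `|z| = rho%:C%C by rewrite normc_def.
have zne : z != 0 by [].
have rho0 : 0 < rho.
  rewrite lt_neqAle sqrtr_ge0 andbT eq_sym; apply: contra zne => /eqP h.
  by rewrite -normr_eq0 nz h.
have rE : r = Num.sqrt (rho ^+ 2 + t ^+ 2) by rewrite /r -/z nz -rmorphXn.
have r2 : r ^+ 2 = rho ^+ 2 + t ^+ 2 by rewrite rE sqr_sqrtr // addr_ge0 ?sqr_ge0.
have r0 : 0 < r by rewrite rE sqrtr_gt0 ltr_wpDr ?sqr_ge0 // exprn_gt0.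
have rn0 : r != 0 by rewrite gt_eqF.
have rhon0 : rho != 0 by rewrite gt_eqF.
have sE : Num.sqrt (1 - (t / r) ^+ 2) = rho / r.
  have -> : 1 - (t / r) ^+ 2 = (rho / r) ^+ 2.
    by rewrite !expr_div_n; apply: (mulIf (_ : r ^+ 2 != 0)); rewrite ?expf_neq0 // mulrBl !divfK ?expf_neq0 // mul1r r2 addrK.
  by rewrite sqrtr_sqr ger0_norm // divr_ge0 // ltW.
have rC0 : r%:C%C != 0 :> C by rewrite fmorph_eq0.
have rhoC0 : rho%:C%C != 0 :> C by rewrite fmorph_eq0.
rewrite /legendreP sE -/z nz.
have -> : absz (l%:Z + (n%:Z - l%:Z)) = n by rewrite addrC subrK.
rewrite legendre_coef.
set alpha : R := ((('X + (t / r)%:P) ^+ 2 - 1) ^+ l)`_n.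
(* Substituting (z / r) X for X turns (X + t / r)^2 - 1 into (z / r^2) Q, because t^2 - r^2 is minus
   z times its conjugate. *)
have key : (z / r%:C%C) ^+ n * alpha%:C%C = (z / r%:C%C ^+ 2) ^+ l * (Qp (z, z^*%C, t%:C%C) ^+ l)`_n.
  have -> : alpha%:C%C = (map_poly (real_complex R) ((('X + (t / r)%:P) ^+ 2 - 1) ^+ l))`_n by rewrite coef_map.
  rewrite -coef_comp_scale -coefZ; congr (nth _ _ _); congr polyseq.
  rewrite !(rmorphXn, rmorphB, rmorphD) /= map_polyX map_polyC /= !rmorph1.
  rewrite -exprZn; congr (_ ^+ l).
  rewrite comp_polyC comp_polyX rmorphM fmorphV /=.
  have zz : z * z^*%C = r%:C%C ^+ 2 - t%:C%C ^+ 2.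
    rewrite -!rmorphXn -rmorphB r2 addrK rho2 /z /=.
    by apply/eqP; rewrite eq_complex /=; apply/andP; split; apply/eqP; ring.
  rewrite /Qp /z11 /z22 /ct /= -!mul_polyC.
  have rV : r%:C%C * r%:C%C^-1 = 1 :> C by rewrite mulfV.
  pose w : C := r%:C%C^-1.
  have e1 : (z / r%:C%C ^+ 2)%:P * (- z^*%C)%:P = (t%:C%C ^+ 2 * w ^+ 2)%:P - 1.
    rewrite -polyCM -polyC1 -polyCB; congr (_%:P).
    have -> : z / r%:C%C ^+ 2 * - z^*%C = - (z * z^*%C) * w ^+ 2 by rewrite /w -exprVn; ring.
    rewrite zz mulNr mulrBl -exprMn rV expr1n; ring.
  rewrite 2!mulrDr e1 -exprVn -/w; clearbody w.
  by rewrite !(polyCM, polyC_exp, polyC_natr); ring.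
have zn0 : z / r%:C%C != 0 by rewrite mulf_neq0 // invr_eq0.
have zr2 : z / r%:C%C ^+ 2 != 0 by rewrite mulf_neq0 // invr_eq0 expf_neq0.
have qE : (Qp (z, z^*%C, t%:C%C) ^+ l)`_n = (z / r%:C%C) ^ (n%:Z - l%:Z) * r%:C%C ^+ l * alpha%:C%C.
  apply: (mulfI (expf_neq0 l zr2)); rewrite -key expfzDr // -exprnP -exprnN.
  have -> : (z / r%:C%C ^+ 2) ^+ l = (z / r%:C%C) ^+ l / r%:C%C ^+ l.
    by rewrite !expr_div_n -exprM mul2n -addnn exprD invfM mulrA.
  have x1 : (z / r%:C%C) ^+ l != 0 by rewrite expf_neq0.
  have x2 : r%:C%C ^+ l != 0 :> C by rewrite expf_neq0.
  move: x1 x2; move: ((z / r%:C%C) ^+ l) ((z / r%:C%C) ^+ n) (r%:C%C ^+ l) => x p y x1 x2.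
  by field; apply/andP.
rewrite qE !rmorphM /= fmorphV rmorphM /= !rmorphXn /= !rmorph_nat.
have xz (x : R) (m : int) : (x ^ m)%:C%C = x%:C%C ^ m :> C by rewrite fmorphXz.
rewrite !xz rmorphN1 rmorphM fmorphV /=.
have -> : (-1) ^ (n%:Z - l%:Z) = (-1) ^+ (n + l) :> C.
  by rewrite expfzDr ?oppr_eq0 ?oner_eq0 // -exprnP -exprnN -exprVn invrN invr1 exprD.
have -> : z / r%:C%C = (z / rho%:C%C) * (rho%:C%C / r%:C%C) by rewrite mulrA divfK.
rewrite expfzMl /solid_cst.
move: (_ ^ (_ - _)) (_ ^ (_ - _)) => p q.
by ring.
Qed.

(** All that is retained of polynomiality: restricted to a polynomial curve, [h] is a polynomial in
    one variable. This lets the identity theorem be applied one variable at a time. *)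
Definition polyline (h : pt -> C) : Prop := forall a b c : {poly C},
  exists p : {poly C}, forall w, h (a.[w], b.[w], c.[w]) = p.[w].

Lemma homogeneous_polyline l (h : pt -> C^o) : homogeneous_poly l h -> polyline h.
Proof.
move: h; apply: lspan_min.
  split=> [a b c|x u v hu hv a b c]; first by exists 0 => w; rewrite horner0.
  have [p hp] := hu a b c; have [q hq] := hv a b c.
  by exists (x *: p + q) => w; rewrite hornerD hornerZ -hp -hq.
move=> _ [a [b [c [_ ->]]]] a' b' c'; exists (a' ^+ a * b' ^+ b * c' ^+ c) => w.
by rewrite !hornerM !horner_exp.
Qed.

Lemma poly0_real (p : {poly C}) : (forall x : R, x != 0 -> p.[x%:C%C] = 0) -> p = 0.
Proof.
move=> hp; apply/eqP; apply: contraT => p0.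
pose rs : seq C := [seq k.+1%:R | k <- iota 0 (size p)].
have := @max_poly_roots _ p rs p0; rewrite /rs size_map size_iota ltnn => H; apply: H.
  apply/allP => _ /mapP[k _ ->]; rewrite /root -(rmorph_nat (real_complex R)) hp //.
rewrite map_inj_uniq ?iota_uniq // => k k' /eqP.
by rewrite eqr_nat => /eqP[].
Qed.

(** In the variables x, y, t with z11 = x + i y and z22 = x - i y the hypothesis concerns real
    values, here with x nonzero. Then t, y and x are freed to complex values one after the other,
    each time by [poly0_real]. *)
Lemma homogeneous_eq0 l (h : pt -> C^o) : homogeneous_poly l h ->
  (forall (z : C) (t : R), z != 0 -> h (z, (z^*)%C, t%:C%C) = 0) -> forall u, h u = 0.
Proof.
move=> /homogeneous_polyline hp h0.
pose g (x y t : C) := h (x + i * y, x - i * y, t).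
have ii : i * i = -1 by rewrite -expr2 sqr_i.
have g0 (x y t : R) : x != 0 -> g x%:C%C y%:C%C t%:C%C = 0.
  move=> x0; have := h0 (x +i* y)%C t; rewrite /g.
  have -> : x%:C%C + i * y%:C%C = (x +i* y)%C by simpc.
  have -> : x%:C%C - i * y%:C%C = ((x +i* y)^*)%C by simpc.
  by apply; apply/eqP => -[] /eqP; rewrite (negbTE x0).
have g1 (x y : R) (t : C) : x != 0 -> g x%:C%C y%:C%C t = 0.
  move=> x0; have [p pE] := hp (x%:C%C + i * y%:C%C)%:P (x%:C%C - i * y%:C%C)%:P 'X.
  have e w : g x%:C%C y%:C%C w = p.[w] by rewrite -pE !hornerC hornerX.
  by rewrite e (poly0_real (p := p)) ?horner0 // => w _; rewrite -e g0.
have g2 (x : R) (y t : C) : x != 0 -> g x%:C%C y t = 0.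
  move=> x0; have [p pE] := hp (x%:C%C%:P + i *: 'X) (x%:C%C%:P - i *: 'X) t%:P.
  have e w : g x%:C%C w t = p.[w] by rewrite -pE hornerD hornerD hornerN !hornerZ !hornerC hornerX.
  by rewrite e (poly0_real (p := p)) ?horner0 // => w _; rewrite -e g1.
have g3 (x y t : C) : g x y t = 0.
  have [p pE] := hp ('X + (i * y)%:P) ('X - (i * y)%:P) t%:P.
  have e w : g w y t = p.[w] by rewrite -pE hornerD hornerD hornerN !hornerC hornerX.
  by rewrite e (poly0_real (p := p)) ?horner0 // => w w0; rewrite -e g2.
move=> [[a b] c]; have := g3 ((a + b) / 2) (- i * (a - b) / 2) c; rewrite /g.
have -> : (a + b) / 2 + i * (- i * (a - b) / 2) = a by field: ii.
have -> : (a + b) / 2 - i * (- i * (a - b) / 2) = b by field: ii.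
by [].
Qed.

(** The polynomial picked by [xget] is unique by [homogeneous_eq0]. For n > 2 l the left side is 0
    by convention, and the right side because Q^l has degree at most 2 l. *)
Lemma solidRE (l n : nat) (u : pt) :
  solidR l%:Z (n%:Z - l%:Z) u = solid_cst l n * (Qp u ^+ l)`_n.
Proof.
rewrite /solidR lez_nat leq0n /=; case: ifP => hn.
  have hS : subsp (homogeneous_poly l : set (pt -> C^o)) by exact: lspan_subsp.
  have hQ := is_solid_harmonic_Q l n.
  rewrite (xget_unique _ hQ) // => y hy; apply/funext => v; apply/eqP; rewrite -subr_eq0; apply/eqP.
  have hd := subspB hS hy.1 hQ.1.
  apply: (homogeneous_eq0 hd) => z t z0.
  have := hy.2 z t z0; have := hQ.2 z t z0 => /= <- e.
  by apply/eqP; rewrite subr_eq0 e.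
suff -> : (Qp u ^+ l)`_n = 0 by rewrite mulr0.
apply: nth_default; have sQ : (size (Qp u) <= 3)%N.
  rewrite /Qp; apply: (leq_trans (size_polyD _ _)); rewrite geq_max; apply/andP; split.
    apply: (leq_trans (size_polyD _ _)); rewrite geq_max (leq_trans (size_polyC_leq1 _)) //=.
    by rewrite mul_polyC (leq_trans (size_scale_leq _ _)) // size_polyX.
  by rewrite mul_polyC (leq_trans (size_scale_leq _ _)) // size_polyXn.
have sl : (size (Qp u ^+ l) <= (2 * l).+1)%N.
  apply: (leq_trans (size_poly_exp_leq _ _)); rewrite ltnS leq_mul2r; apply/orP; right.
  by move: sQ; case: (size (Qp u)) => // s; rewrite ltnS.
apply: (leq_trans sl); move: hn; lia.
Qed.

Lemma solidR_N1 (m : int) (u : pt) : solidR (-1) m u = 0.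
Proof. by rewrite /solidR. Qed.

End SolidHarmonics.

(** * The generators of E_+ and E_- *)

Section TensorFields.
Variable R : realType.
Local Notation C := R[i].
Local Notation i := ('i%C : C).
Local Notation reg := (reg R).
Local Notation Fn := (reg -> C^o).
Local Notation MF := (reg -> 'M[C]_2).

Let ii : i * i = -1. Proof. by rewrite -expr2 sqr_i. Qed.

Lemma symmxD (a b d a' b' d' : C) :
  symmx a b d + symmx a' b' d' = symmx (a + a') (b + b') (d + d').
Proof. by apply/matrixP => -[[|[|//]] ?] [[|[|//]] ?]; rewrite !mxE. Qed.

Lemma symmxZ (x a b d : C) : x *: symmx a b d = symmx (x * a) (x * b) (x * d).
Proof. by apply/matrixP => -[[|[|//]] ?] [[|[|//]] ?]; rewrite !mxE. Qed.

Lemma symmx0 : symmx 0 0 0 = 0 :> 'M[C]_2.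
Proof. by apply/matrixP => -[[|[|//]] ?] [[|[|//]] ?]; rewrite !mxE. Qed.

Lemma symmx_tr (a b d : C) : (symmx a b d)^T = symmx a b d.
Proof. by apply/matrixP => p q; rewrite !mxE addnC. Qed.

Lemma symmx_of (M : 'M[C]_2) : M^T = M -> M = symmx (M 0 0) (M 0 1) (M 1 1).
Proof.
move=> h; apply/matrixP => -[[|[|//]] p] [[|[|//]] q]; rewrite mxE /=.
- by congr (M _ _); apply: val_inj.
- by congr (M _ _); apply: val_inj.
- by rewrite -[in LHS]h mxE; congr (M _ _); apply: val_inj.
- by congr (M _ _); apply: val_inj.
Qed.

Lemma symmx_sand (p q r a b d : C) :
  symmx p q r *m symmx a b d *m symmx p q r =
  symmx (p ^+ 2 * a + 2 * p * q * b + q ^+ 2 * d)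
        (p * q * a + (p * r + q ^+ 2) * b + q * r * d)
        (q ^+ 2 * a + 2 * q * r * b + r ^+ 2 * d).
Proof.
by apply/matrixP => -[[|[|//]] ?] [[|[|//]] ?]; rewrite !mxE !big_ord_recl !big_ord0 !mxE
   !big_ord_recl !big_ord0 !mxE /=; ring.
Qed.

Section Closure.
Variable E : set MF.
Hypothesis hE : subsp E.

Lemma msub_eq (F G : MF) : E F -> F =1 G -> E G.
Proof. by move=> hF /funext <-. Qed.

Lemma msubD (F G : MF) : E F -> E G -> E (fun u => F u + G u).
Proof. by move=> hF hG; exact: (@subspD _ _ E F G hE hF hG). Qed.

Lemma msubZ c (F : MF) : E F -> E (fun u => c *: F u).
Proof. by move=> hF; exact: (@subspZ _ _ E c F hE hF). Qed.

Lemma msub0 : E (fun=> 0). Proof. exact: hE.1. Qed.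

(** The analogue of [cS] for symmetric matrices, given by their three independent entries. *)
Definition cm (a b d : reg -> {poly C}) : Prop :=
  forall n, E (fun u => symmx ((a u)`_n) ((b u)`_n) ((d u)`_n)).

Implicit Types a b d : reg -> {poly C}.

Lemma cm_eq a b d a' b' d' : cm a b d -> a =1 a' -> b =1 b' -> d =1 d' -> cm a' b' d'.
Proof. by move=> h /funext <- /funext <- /funext <-. Qed.

Lemma cmD a b d a' b' d' : cm a b d -> cm a' b' d' ->
  cm (fun u => a u + a' u) (fun u => b u + b' u) (fun u => d u + d' u).
Proof.
move=> h h' n; apply: msub_eq (msubD (h n) (h' n)) _ => u.
by rewrite symmxD !coefD.
Qed.

Lemma cmZ c a b d : cm a b d ->
  cm (fun u => c *: a u) (fun u => c *: b u) (fun u => c *: d u).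
Proof.
move=> h n; apply: msub_eq (msubZ c (h n)) _ => u.
by rewrite symmxZ !coefZ.
Qed.

Definition Qn (l n : nat) (u : reg) : C := (Qp (val u) ^+ l)`_n.

(** The rank-one form N^k w w^T Q^l with w = (1, - i X)^T; its coefficients are multiples of the
    N^(k+1/2) T of degree l. *)
Definition hasT k l := cm (fun u => NV u ^ k *: Qp (val u) ^+ l)
  (fun u => NV u ^ k *: (- i *: ('X * Qp (val u) ^+ l)))
  (fun u => NV u ^ k *: (- 1 *: ('X^2 * Qp (val u) ^+ l))).

(** Up to a factor - 2 the first transvectant in X of w w^T and Q^l. The forms [hasT] and [hasB]
    are, up to factors, those of order 0 and 2, the latter with Q^(l+1): the three Clebsch-Gordan
    components of a symmetric matrix of harmonics. *)
Definition hasM k l := cm (fun u => NV u ^ k *: (Qp (val u) ^+ l)^`())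
  (fun u => NV u ^ k *: (- i *: ('X * (Qp (val u) ^+ l)^`() - l%:R *: Qp (val u) ^+ l)))
  (fun u => NV u ^ k *: ('X * ((2 * l%:R) *: Qp (val u) ^+ l - 'X * (Qp (val u) ^+ l)^`()))).

(* (2 k + 1) N^(k-1) Z Q^l - 2 l N^k w w^T Q^(l-1), where w = (1, - i X)^T. *)
Definition hasC k l := cm
  (fun u => ((2 * k%:~R + 1) * NV u ^ (k - 1) * z11 (val u)) *: Qp (val u) ^+ l
     - (2 * l%:R * NV u ^ k) *: Qp (val u) ^+ l.-1)
  (fun u => ((2 * k%:~R + 1) * NV u ^ (k - 1) * z12 (val u)) *: Qp (val u) ^+ l
     - (2 * l%:R * NV u ^ k) *: (- i *: ('X * Qp (val u) ^+ l.-1)))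
  (fun u => ((2 * k%:~R + 1) * NV u ^ (k - 1) * z22 (val u)) *: Qp (val u) ^+ l
     - (2 * l%:R * NV u ^ k) *: (- 1 *: ('X^2 * Qp (val u) ^+ l.-1))).

Definition hasB k l := cm
  (fun u => NV u ^ k *: Vp l (Qp (val u) ^+ l.+1) j1)
  (fun u => NV u ^ k *: ((i / 2) *: Vp l (Qp (val u) ^+ l.+1) j2))
  (fun u => NV u ^ k *: Vp l (Qp (val u) ^+ l.+1) j0).

Definition hasE k l := [/\
  cm (fun u => NV u ^ k *: Qp (val u) ^+ l) (fun=> 0) (fun=> 0),
  cm (fun=> 0) (fun u => NV u ^ k *: Qp (val u) ^+ l) (fun=> 0) &
  cm (fun=> 0) (fun=> 0) (fun u => NV u ^ k *: Qp (val u) ^+ l)].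

Lemma coef_XX (p : {poly C}) n : ('X^2 * p)`_n.+1 = ('X * p)`_n.
Proof. by rewrite expr2 -mulrA coefXM. Qed.

Lemma coef_X' (p : {poly C}) n : (p^`())`_n = (n%:R + 1) * p`_n.+1.
Proof. by rewrite natr1 mulr_natl coef_deriv. Qed.

Lemma coef_XX' (p : {poly C}) n : ('X * p^`())`_n = n%:R * p`_n.
Proof. by rewrite coefXM; case: n => [|n] /=; rewrite ?mul0r // coef_X' natr1. Qed.

Lemma coef_XXX' (p : {poly C}) n : ('X * ('X * p^`()))`_n = (n%:R - 1) * ('X * p)`_n.
Proof.
rewrite !(coefXM _ n); case: n => [|n] /=; first by rewrite mulr0.
by rewrite coef_XX' -natr1 addrK.
Qed.

(* The vectors of [hasT], [hasM] and [hasB] of a common weight have entries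
   proportional to the coefficients [n + 1], [n], [n - 1] of [Q^l], and the
   determinant of the proportionality factors is [l (2 l + 1) (2 l + 2)]. *)
Lemma hasE_of k l : hasT k l -> hasM k l -> ((0 < l)%N -> hasB k l.-1) -> hasE k l.
Proof.
move=> hT hM hB.
case: l hT hM hB => [|l] hT hM hB.
  have h1 u n : (Qp u ^+ 0 : {poly C})`_n = (n == 0)%:R by rewrite expr0 coef1.
  have hX u n : ('X * Qp u ^+ 0 : {poly C})`_n = (n == 1)%:R by rewrite expr0 mulr1 coefX.
  have hX2 u n : ('X^2 * Qp u ^+ 0 : {poly C})`_n = (n == 2)%:R by rewrite expr0 mulr1 coefXn.
  split=> -[|n].
  - apply: msub_eq (hT 0%N) _ => u.
    by rewrite !coefZ h1 hX hX2 coef0 /= !mulr0.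
  - by apply: msub_eq msub0 _ => u; rewrite coefZ h1 coef0 /= mulr0 symmx0.
  - apply: msub_eq (msubZ i (hT 1%N)) _ => u.
    rewrite symmxZ; congr symmx.
    + by rewrite coef0 coefZ h1 !mulr0.
    + by rewrite coefZ [RHS]coefZ h1 coefZ hX /=; ring: ii.
    + by rewrite coef0 2!coefZ hX2 !mulr0.
  - by apply: msub_eq msub0 _ => u; rewrite coefZ h1 coef0 /= mulr0 symmx0.
  - apply: msub_eq (msubZ (-1) (hT 2%N)) _ => u.
    rewrite symmxZ; congr symmx.
    + by rewrite coef0 coefZ h1 !mulr0.
    + by rewrite coef0 2!coefZ hX !mulr0.
    + by rewrite coefZ [RHS]coefZ h1 coefZ hX2 /=; ring.
  by apply: msub_eq msub0 _ => u; rewrite coefZ h1 coef0 /= mulr0 symmx0.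
pose L : C := l.+1%:R.
have L0 : L != 0 by rewrite pnatr_eq0.
have L1 : 2 * L + 1 != 0 := odd_neq0 R l.+1.
have L2 : L + 1 != 0 := natS_neq0 R l.+1.
pose qm n (u : reg) : C := ('X * Qp (val u) ^+ l.+1)`_n.
have HT n : E (fun u => NV u ^ k *: symmx (Qn l.+1 n.+1 u) (- i * Qn l.+1 n u) (- qm n u)).
  apply: msub_eq (hT n.+1) _ => u.
  rewrite symmxZ; congr symmx.
  - by rewrite coefZ.
  - by rewrite 2!coefZ coefXM.
  - by rewrite 2!coefZ coef_XX mulN1r.
have HM n : E (fun u => NV u ^ k *: symmx ((n%:R + 1) * Qn l.+1 n.+1 u)
    (- i * ((n%:R - L) * Qn l.+1 n u)) ((2 * L - n%:R + 1) * qm n u)).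
  apply: msub_eq (hM n) _ => u; rewrite symmxZ; congr symmx.
  - by rewrite coefZ coef_X'.
  - by rewrite 2!coefZ coefB coef_XX' coefZ -mulrBl.
  - rewrite coefZ mulrBr coefB coef_XXX' -scalerAr coefZ -mulrBl.
    by congr (_ * (_ * _)); rewrite opprB addrA addrAC.
have HB n : E (fun u => NV u ^ k *: symmx (n%:R * (n%:R + 1) * Qn l.+1 n.+1 u)
    (i * (n%:R * (2 * L - n%:R)) * Qn l.+1 n u)
    (- ((2 * L - n%:R) * (2 * L - n%:R + 1)) * qm n u)).
  case: n => [|n].
    apply: msub_eq msub0 _ => u; rewrite /qm coefXM /= symmxZ -symmx0.
    by congr symmx; ring.
  have hl := natS_neq0 R l.
  apply: msub_eq (msubZ (2 * L) (hB isT n)) _ => u.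
  rewrite !symmxZ /Vp !inordK //; cbn [nth]; congr symmx.
  - rewrite 2!coefZ coef_X' coef_X' -[n.+1%:R]natr1 /L -[l.+1%:R]natr1 /Qn.
    by field.
  - rewrite 2!coefZ coefB !coefZ coef_XX' coef_X' -[n.+1%:R]natr1 /L -[l.+1%:R]natr1 /Qn.
    by field.
  rewrite coefZ coefB coefD !coefZ coef_XXX' !coef_XX' -[n.+1%:R]natr1 /L -[l.+1%:R]natr1 /qm coefXM /=.
  by field.
(* The weights in the three combinations come from Cramer's rule, with s = 2 L - n and determinant
   D. *)
clearbody L; have H11 n : E (fun u => symmx (NV u ^ k * Qn l.+1 n.+1 u) 0 0).
  pose s : C := 2 * L - n%:R; pose D := L * (2 * L + 1) * (2 * (L + 1)).
  have := msubD (msubD (msubZ (L * s * (s + 1) / D) (HT n)) (msubZ (s * (2 * L + 1) / D) (HM n)))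
    (msubZ ((L + 1) / D) (HB n)).
  move=> H; apply: msub_eq H _ => u; rewrite !symmxZ !symmxD; congr symmx;
   by rewrite /D /s; field; rewrite L0 L1 L2.
have H12 n : E (fun u => symmx 0 (NV u ^ k * Qn l.+1 n u) 0).
  pose s : C := 2 * L - n%:R; pose D := L * (2 * L + 1) * (2 * (L + 1)).
  have := msubZ i (msubD (msubD (msubZ (2 * L * (n%:R + 1) * (s + 1) / D) (HT n)) (msubZ ((n%:R - s) * (2 * L + 1) / D) (HM n)))
    (msubZ (- (2 * (L + 1)) / D) (HB n))).
  move=> H; apply: msub_eq H _ => u; rewrite !symmxZ !symmxD !symmxZ; congr symmx;
   by rewrite /D /s; field: ii; rewrite L0 L1 L2.
have H22 n : E (fun u => symmx 0 0 (NV u ^ k * qm n u)).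
  pose s : C := 2 * L - n%:R; pose D := L * (2 * L + 1) * (2 * (L + 1)).
  have := msubD (msubD (msubZ (- (n%:R * (n%:R + 1) * L) / D) (HT n)) (msubZ (n%:R * (2 * L + 1) / D) (HM n)))
    (msubZ (- (L + 1) / D) (HB n)).
  move=> H; apply: msub_eq H _ => u; rewrite !symmxZ !symmxD; congr symmx;
   by rewrite /D /s; field; rewrite L0 L1 L2.
split=> n.
- case: n => [|n]; last by apply: msub_eq (H11 n) _ => u; rewrite !coefZ coef0.
  apply: msub_eq (hT 0%N) _ => u.
  by rewrite !coefZ coef0 coefXnM coefXM /= !mulr0.
- by apply: msub_eq (H12 n) _ => u; rewrite !coefZ coef0.
by apply: msub_eq (H22 n.+1) _ => u; rewrite !coefZ coef0 /qm coefXM.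
Qed.

Definition symS (S : set Fn) : set MF :=
  [set F | (forall p q, S (entry F p q)) /\ forall u, (F u)^T = F u].

(** A symmetric matrix is the sum of its three entries placed in otherwise zero matrices, and [hasE]
    provides each of them on the spanning functions. *)
Lemma symS_sub c : (forall k l, c k l -> hasE k l) -> symS (HS c) `<=` E.
Proof.
move=> h F [hF sF].
have h11 (f : Fn) : HS c f -> E (fun u => symmx (f u) 0 0).
  move=> hf; suff : [set f : Fn | E (fun u => symmx (f u) 0 0)] f by [].
  move: f hf; apply: HS_ind.
    split=> [|a u v hu hv]; first by apply: msub_eq msub0 _ => u; rewrite symmx0.
    by apply: msub_eq (msubD (msubZ a hu) hv) _ => x; rewrite symmxZ symmxD !mulr0 !addr0.
  by move=> k l /h[h1 _ _] n; apply: msub_eq (h1 n) _ => u; rewrite coef0.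
have h12 (f : Fn) : HS c f -> E (fun u => symmx 0 (f u) 0).
  move=> hf; suff : [set f : Fn | E (fun u => symmx 0 (f u) 0)] f by [].
  move: f hf; apply: HS_ind.
    split=> [|a u v hu hv]; first by apply: msub_eq msub0 _ => u; rewrite symmx0.
    by apply: msub_eq (msubD (msubZ a hu) hv) _ => x; rewrite symmxZ symmxD !mulr0 !addr0.
  by move=> k l /h[_ h1 _] n; apply: msub_eq (h1 n) _ => u; rewrite coef0.
have h22 (f : Fn) : HS c f -> E (fun u => symmx 0 0 (f u)).
  move=> hf; suff : [set f : Fn | E (fun u => symmx 0 0 (f u))] f by [].
  move: f hf; apply: HS_ind.
    split=> [|a u v hu hv]; first by apply: msub_eq msub0 _ => u; rewrite symmx0.
    by apply: msub_eq (msubD (msubZ a hu) hv) _ => x; rewrite symmxZ symmxD !mulr0 !addr0.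
  by move=> k l /h[_ _ h1] n; apply: msub_eq (h1 n) _ => u; rewrite coef0.
have := msubD (msubD (h11 _ (hF 0 0)) (h12 _ (hF 0 1))) (h22 _ (hF 1 1)).
move=> H; apply: msub_eq H _ => u.
by rewrite !symmxD !(addr0, add0r) -(symmx_of (sF u)).
Qed.

End Closure.

End TensorFields.

(** * The given tensor fields as coefficients of generating forms *)

Section Generators.
Variable R : realType.
Local Notation C := R[i].
Local Notation i := ('i%C : C).
Local Notation reg := (reg R).
Local Notation MF := (reg -> 'M[C]_2).

Lemma solid_cstS l n : solid_cst R l n.+1 = - (n%:R + 1) * solid_cst R l n.
Proof.
have h1 : 2 ^+ l != 0 :> C by rewrite expf_neq0 // pnatr_eq0.
have h2 : l`!%:R != 0 :> C by rewrite pnatr_eq0 -lt0n fact_gt0.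
by rewrite /solid_cst factS natrM -natr1 addSn exprS; field; rewrite h1 h2.
Qed.

Lemma solid_cst_l2 l n : solid_cst R l n = solid_cst R l.+2 n * (4 * (l%:R + 1) * (l%:R + 2)).
Proof.
have h1 : 2 ^+ l != 0 :> C by rewrite expf_neq0 // pnatr_eq0.
have h2 : l`!%:R != 0 :> C by rewrite pnatr_eq0 -lt0n fact_gt0.
have h3 := natS_neq0 R l.
have h4 : l%:R + 1 + 1 != 0 :> C by rewrite !natr1 pnatr_eq0.
rewrite /solid_cst !factS !natrM -[l.+2%:R]natr1 -[l.+1%:R]natr1 !addnS !exprS.
by field; rewrite h1 h2 h3 h4.
Qed.

Lemma coefQ0 l n (u : pt R) : (2 * l < n)%N -> (Qp u ^+ l)`_n = 0.
Proof.
move=> h; have := solidRE l n u; rewrite /solidR lez_nat leq0n /=.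
case: ifP => [|_ /esym/eqP]; first by lia.
by rewrite mulf_eq0 (negbTE (solid_cst_neq0 R l n)) => /eqP.
Qed.

(** With m = n - l - 1 the entries R^(m+1), R^m, R^(m-1) are the coefficients n, n - 1, n - 2 of
    Q^l; the prefactors l + m + 1 and l + m absorb the quotients of the [solid_cst]. *)
Lemma matT_coef (l n : nat) (u : pt R) : matT l%:Z (n%:Z - l%:Z - 1) u =
  solid_cst R l n *: symmx (Qp u ^+ l)`_n (- i * ('X * Qp u ^+ l)`_n) (- 1 * ('X^2 * Qp u ^+ l)`_n).
Proof.
rewrite /matT symmxZ; congr symmx.
- by rewrite subrK solidRE.
- rewrite (_ : l%:Z + (n%:Z - l%:Z - 1) + 1 = n%:Z); last by lia.
  case: n => [|n]; first by rewrite coefXM /= !(mulr0, mul0r).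
  rewrite (_ : n.+1%:Z - l%:Z - 1 = n%:Z - l%:Z); last by lia.
  by rewrite solidRE coefXM /= solid_cstS -pmulrn -natr1; ring.
rewrite (_ : l%:Z + (n%:Z - l%:Z - 1) + 1 = n%:Z); last by lia.
rewrite (_ : l%:Z + (n%:Z - l%:Z - 1) = n%:Z - 1); last by lia.
case: n => [|[|n]].
- by rewrite mulr0 oppr0 mul0r coefXnM /= !mulr0.
- by rewrite subrr mul0r oppr0 mul0r coefXnM /= !mulr0.
rewrite (_ : n.+2%:Z - l%:Z - 1 - 1 = n%:Z - l%:Z); last by lia.
rewrite solidRE coefXnM /= subn2 /= !solid_cstS -[n.+1%:R]natr1.
rewrite (_ : (n.+2%:Z - 1) * n.+2%:Z = (n.+1 * n.+2)%N%:Z); last by lia.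
by rewrite -pmulrn natrM -[n.+2%:R]natr1 -[n.+1%:R]natr1; ring.
Qed.

Lemma matM_coef (l n : nat) (u : pt R) : matM l%:Z (n%:Z - l%:Z) u =
  (- solid_cst R l n) *: symmx ((Qp u ^+ l)^`()`_n)
     (- i * ('X * (Qp u ^+ l)^`() - l%:R *: Qp u ^+ l)`_n)
     ('X * ((2 * l%:R) *: Qp u ^+ l - 'X * (Qp u ^+ l)^`()))`_n.
Proof.
rewrite /matM symmxZ; congr symmx.
- rewrite (_ : n%:Z - l%:Z + 1 = n.+1%:Z - l%:Z); last by lia.
  by rewrite solidRE coef_X' solid_cstS; ring.
- rewrite solidRE coefB coefZ coef_XX' rmorphB /= -!pmulrn; ring.
rewrite mulrBr coefB coef_XXX' -scalerAr coefZ.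
rewrite (_ : l%:Z + (n%:Z - l%:Z) = n%:Z); last by lia.
case: n => [|n]; first by rewrite !coefXM /= mul0r mul0r !mulr0 subrr mulr0.
rewrite (_ : n.+1%:Z - l%:Z - 1 = n%:Z - l%:Z); last by lia.
rewrite solidRE coefXM /= solid_cstS rmorphM /= rmorphD rmorphB rmorphB rmorph1 /= -!pmulrn -natr1.
by ring.
Qed.

Lemma matB_coef (l n : nat) (u : pt R) : matB (l%:Z + 1) (n%:Z - l%:Z) u =
  (solid_cst R l.+1 n * (2 * (l%:R + 1))) *: symmx (Vp l (Qp u ^+ l.+1) j1)`_n
     (i / 2 * (Vp l (Qp u ^+ l.+1) j2)`_n) (Vp l (Qp u ^+ l.+1) j0)`_n.
Proof.
have hl := natS_neq0 R l.
rewrite /matB symmxZ /Vp !inordK //; cbn [nth].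
rewrite (_ : l%:Z + 1 = l.+1%:Z); last by lia.
congr symmx.
- rewrite (_ : n%:Z - l%:Z + 1 = n.+2%:Z - l.+1%:Z); last by lia.
  rewrite solidRE coefZ coef_X' coef_X' !solid_cstS -[n.+1%:R]natr1.
  by field.
- rewrite (_ : n%:Z - l%:Z = n.+1%:Z - l.+1%:Z); last by lia.
  rewrite solidRE coefB !coefZ coef_XX' coef_X' !solid_cstS.
  rewrite (_ : l.+1%:Z - (n.+1%:Z - l.+1%:Z) = 2 * l%:Z + 1 - n%:Z); last by lia.
  rewrite rmorphB rmorphD rmorphM rmorph1 /= -!pmulrn.
  by field.
rewrite (_ : n%:Z - l%:Z - 1 = n%:Z - l.+1%:Z); last by lia.
rewrite solidRE coefB coefD !coefZ coef_XXX' !coef_XX'.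
rewrite (_ : l.+1%:Z - (n%:Z - l%:Z) = 2 * l%:Z + 1 - n%:Z); last by lia.
rewrite !(rmorphM, rmorphD, rmorphN, rmorph1) /= -!pmulrn.
by field.
Qed.

Lemma NT_coef k (l n : nat) (u : reg) : NT k l%:Z (n%:Z - l%:Z - 1) u =
  solid_cst R l n *: symmx (NV u ^ k *: Qp (val u) ^+ l)`_n
    (NV u ^ k *: (- i *: ('X * Qp (val u) ^+ l)))`_n
    (NV u ^ k *: (- 1 *: ('X^2 * Qp (val u) ^+ l)))`_n.
Proof.
rewrite /NT matT_coef !symmxZ; congr symmx; rewrite !coefZ; ring.
Qed.

Lemma NM_coef k (l n : nat) (u : reg) : NM k l%:Z (n%:Z - l%:Z) u =
  (- solid_cst R l n) *: symmx (NV u ^ k *: (Qp (val u) ^+ l)^`())`_n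
  (NV u ^ k *: (- i *: ('X * (Qp (val u) ^+ l)^`() - l%:R *: Qp (val u) ^+ l)))`_n
  (NV u ^ k *: ('X * ((2 * l%:R) *: Qp (val u) ^+ l - 'X * (Qp (val u) ^+ l)^`())))`_n.
Proof.
rewrite /NM matM_coef !symmxZ; congr symmx; rewrite ?[in RHS]coefZ ?[in RHS](coefZ (- i)); ring.
Qed.

Lemma VpE l (u : pt R) j : Vp l (Qp u ^+ l.+1) j =
  (2 * l%:R + 1) *: (nN j u *: Qp u ^+ l) - (2 * l%:R * NZ u) *: (dQ R j * Qp u ^+ l.-1).
Proof. by rewrite nQ addrK. Qed.

Lemma symmxN (a b d : C) : - symmx a b d = symmx (- a) (- b) (- d).
Proof. by rewrite -scaleN1r symmxZ !mulN1r. Qed.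

(** Writing B by [VpE] produces Z Q^l and a further multiple of w w^T Q^(l-1). The latter merges
    with the T-term: 2 l (2 k + 1) - 4 l (k + l + 1) = - 2 l (2 l + 1), and the common factor 2 l +
    1 goes into the constant. *)
Lemma NC_coef k (l n : nat) (u : reg) : NC k l%:Z (n%:Z - l%:Z) u =
  (solid_cst R l.+1 n * (2 * (l%:R + 1) * (2 * l%:R + 1))) *: symmx
  (((2 * k%:~R + 1) * NV u ^ (k - 1) * z11 (val u)) *: Qp (val u) ^+ l
     - (2 * l%:R * NV u ^ k) *: Qp (val u) ^+ l.-1)`_n
  (((2 * k%:~R + 1) * NV u ^ (k - 1) * z12 (val u)) *: Qp (val u) ^+ l
     - (2 * l%:R * NV u ^ k) *: (- i *: ('X * Qp (val u) ^+ l.-1)))`_n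
  (((2 * k%:~R + 1) * NV u ^ (k - 1) * z22 (val u)) *: Qp (val u) ^+ l
     - (2 * l%:R * NV u ^ k) *: (- 1 *: ('X^2 * Qp (val u) ^+ l.-1)))`_n.
Proof.
have hT : (2 * (k + l%:Z + 1))%:~R * NV u ^ k *: matT (l%:Z - 1) (n%:Z - l%:Z) (val u) =
   (solid_cst R l.+1 n * (2 * (k%:~R + l%:R + 1)) * (4 * (l%:R * (l%:R + 1))) * NV u ^ k) *:
   symmx (Qp (val u) ^+ l.-1)`_n (- i * ('X * Qp (val u) ^+ l.-1)`_n) (- 1 * ('X^2 * Qp (val u) ^+ l.-1)`_n).
  case: l => [|l].
    rewrite mul0r !mulr0 mul0r scale0r /matT sub0r !solidR_N1 !mulr0.
    by rewrite symmx0 scaler0.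
  rewrite (_ : l.+1%:Z - 1 = l%:Z); last by lia.
  rewrite (_ : n%:Z - l.+1%:Z = n%:Z - l%:Z - 1); last by lia.
  rewrite matT_coef scalerA; congr (_ *: _).
  rewrite (solid_cst_l2 l n) rmorphM !rmorphD rmorph1 /= -!pmulrn -[l.+1%:R]natr1.
  by ring.
rewrite /NC hT matB_coef !VpE nN0 nN1 nN2 dQ0 dQ1 dQ2.
rewrite rmorphD rmorphM rmorph1 /= -[2%:~R]pmulrn.
rewrite !symmxZ symmxN symmxD; congr symmx.
- rewrite !(coefB, coefZ) mulN1r coefN NexpP.
  by field; exact: Nneq0.
- rewrite -[(2 *: 'X) * _]scalerAl !(coefB, coefZ) NexpP /z12.
  by field; exact: Nneq0.
rewrite !(coefB, coefZ) NexpP.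
by field; exact: Nneq0.
Qed.

(** The common shape of E_+ and E_-; [s] shifts the index of the C-fields, by 0 for E_+ and by 1 for
    E_-. *)
Definition Egen (c : int -> int -> Prop) (s : int -> int) : set MF :=
  lspan [set F | exists k l m : int, [/\ 0 <= l, c k l &
    [\/ - l - 1 <= m <= l + 1 /\ F = NT k l m,
        - l <= m <= l /\ F = NM k l m
      | - l <= m <= l /\ F = NC (s k) l m]]].

Lemma Egen_subsp c s : subsp (Egen c s). Proof. exact: lspan_subsp. Qed.

(** The admissible m correspond to the X-coefficients within the degree of the form; all remaining
    coefficients vanish, so the whole generating form is available. *)
Lemma Egen_has c s k (l : nat) : c k l%:Z ->
  [/\ hasT (Egen c s) k l, hasM (Egen c s) k l & hasC (Egen c s) (s k) l].
Proof.
move=> hc; have hE := Egen_subsp c s; split=> n.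
- have [hn|hn] := leqP n (2 * l + 2).
    have g : Egen c s (NT k l%:Z (n%:Z - l%:Z - 1)).
      by apply: lspan_gen; exists k, l%:Z, (n%:Z - l%:Z - 1); split=> //; apply: Or31; split=> //; lia.
    apply: msub_eq (msubZ hE (solid_cst R l n)^-1 g) _ => u.
    by rewrite NT_coef scalerA mulVf ?scale1r // solid_cst_neq0.
  apply: msub_eq (msub0 hE) _ => u; rewrite !coefZ coefXM coefXnM !coefQ0; try lia.
  by rewrite !if_same !mulr0 symmx0.
- have [hn|hn] := leqP n (2 * l).
    have g : Egen c s (NM k l%:Z (n%:Z - l%:Z)).
      by apply: lspan_gen; exists k, l%:Z, (n%:Z - l%:Z); split=> //; apply: Or32; split=> //; lia.
    apply: msub_eq (msubZ hE (- solid_cst R l n)^-1 g) _ => u.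
    by rewrite NM_coef scalerA mulVf ?scale1r // oppr_eq0 solid_cst_neq0.
  apply: msub_eq (msub0 hE) _ => u.
  rewrite mulrBr -scalerAr !(coefB, coefZ) coef_X' coef_XX' coef_XXX' !coefQ0; try lia.
  rewrite !(mulr0, subr0) -mulrBl coefXM.
  (* At n = 2 l + 1 the last entry still involves the top coefficient of Q^l, but its factor 2 l - n
     + 1 is 0. *)
  have [e|h] := eqVneq n (2 * l).+1.
    rewrite e /= -[(2 * l).+1%:R]natr1 natrM addrK subrr mul0r mulr0; exact/esym/symmx0.
  by rewrite coefQ0 ?if_same ?mulr0 ?symmx0 //; lia.
have [hn|hn] := leqP n (2 * l).
  have g : Egen c s (NC (s k) l%:Z (n%:Z - l%:Z)).
    by apply: lspan_gen; exists k, l%:Z, (n%:Z - l%:Z); split=> //; apply: Or33; split=> //; lia.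
  pose x := solid_cst R l.+1 n * (2 * (l%:R + 1) * (2 * l%:R + 1)).
  have x0 : x != 0.
    apply: mulf_neq0; first exact: solid_cst_neq0.
    by apply: mulf_neq0 (odd_neq0 R l); apply: mulf_neq0 (natS_neq0 R l); rewrite pnatr_eq0.
  apply: msub_eq (msubZ hE x^-1 g) _ => u.
  by rewrite NC_coef -/x scalerA mulVf ?scale1r.
apply: msub_eq (msub0 hE) _ => u.
rewrite !(coefB, coefZ) coefXM coefXnM (coefQ0 _ hn).
case: l hc hn => [|l] hc hn; first by rewrite !(mulr0, mul0r, subr0) symmx0.
rewrite /= !coefQ0; try lia.
by rewrite !if_same !(mulr0, subr0) symmx0.
Qed.

Lemma Egen_min c s (E : set MF) : subsp E ->
  (forall k (l : nat), c k l%:Z -> [/\ hasT E k l, hasM E k l & hasC E (s k) l]) ->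
  Egen c s `<=` E.
Proof.
move=> hE h; apply: lspan_min => // F [k [l [m [l0 hc]]]].
case: l l0 hc => // l _ /h[hT hM hC].
have Z (x : C) (G : MF) : E G -> E (fun u => x *: G u) by exact: msubZ.
case=> -[hm ->].
- have -> : m = (absz (m + l%:Z + 1))%:Z - l%:Z - 1 by lia.
  set n := absz _.
  by apply: msub_eq (Z (solid_cst R l n) _ (hT n)) _ => u; rewrite NT_coef.
- have -> : m = (absz (m + l%:Z))%:Z - l%:Z by lia.
  set n := absz _.
  by apply: msub_eq (Z (- solid_cst R l n) _ (hM n)) _ => u; rewrite NM_coef.
have -> : m = (absz (m + l%:Z))%:Z - l%:Z by lia.
set n := absz _.
by apply: msub_eq (Z (solid_cst R l.+1 n * (2 * (l%:R + 1) * (2 * l%:R + 1))) _ (hC n)) _ => u; rewrite NC_coef.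
Qed.

End Generators.

(** * Description of E_+ and E_- *)

Section Characterization.
Variable R : realType.
Local Notation C := R[i].
Local Notation i := ('i%C : C).
Local Notation reg := (reg R).
Local Notation Fn := (reg -> C^o).
Local Notation MF := (reg -> 'M[C]_2).

Let ii : i * i = -1. Proof. by rewrite -expr2 sqr_i. Qed.

Lemma odd_int_neq0 (k : int) : 2 * k%:~R + 1 != 0 :> C.
Proof.
rewrite (_ : 2 * k%:~R + 1 = (2 * k + 1)%:~R :> C); last by rewrite rmorphD rmorphM rmorph1.
by rewrite intr_eq0; lia.
Qed.

Section ScaledCoefficients.
Variables (S : set Fn) (hS : subsp S) (f : reg -> C).
Implicit Type A : reg -> {poly C}.

Lemma cSfZ c A : cS S (fun u => f u *: A u) -> cS S (fun u => f u *: (c *: A u)).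
Proof. by move=> h; apply: cS_eq (cSZ hS c h) _ => u; rewrite !scalerA mulrC. Qed.

Lemma cSfX A : cS S (fun u => f u *: A u) -> cS S (fun u => f u *: ('X * A u)).
Proof. by move=> h; apply: cS_eq (cSX hS h) _ => u; rewrite scalerAr. Qed.

Lemma cSfd A : cS S (fun u => f u *: A u) -> cS S (fun u => f u *: (A u)^`()).
Proof. by move=> h; apply: cS_eq (cSderiv hS h) _ => u; rewrite derivZ. Qed.

Lemma cSfD A B : cS S (fun u => f u *: A u) -> cS S (fun u => f u *: B u) ->
  cS S (fun u => f u *: (A u + B u)).
Proof. by move=> h h'; apply: cS_eq (cSD hS h h') _ => u; rewrite scalerDr. Qed.

Lemma cSfN A : cS S (fun u => f u *: A u) -> cS S (fun u => f u *: (- A u)).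
Proof. by move=> h; apply: cS_eq (cSfZ (-1) h) _ => u; rewrite scaleN1r. Qed.

End ScaledCoefficients.

Lemma symS_subsp (S : set Fn) : subsp S -> subsp (symS S).
Proof.
move=> hS; split=> [|a F G [hF sF] [hG sG]]; split=> [p q|u].
- by apply: sub_eq hS.1 _ => u; rewrite /entry mxE.
- by rewrite trmx0.
- by apply: sub_eq (hS.2 a _ _ (hF p q) (hG p q)) _ => u; rewrite /entry !mxE.
by rewrite -[(a *: F + G) u]/(a *: F u + G u) linearD linearZ /= sF sG.
Qed.

Lemma cm_symS (S : set Fn) a b d : cS S a -> cS S b -> cS S d -> cm (symS S) a b d.
Proof.
move=> ha hb hd n; split=> [p q|u]; last exact: symmx_tr.
case: p q => [] [|[|//]] ? [] [|[|//]] ?; rewrite /entry.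
- by apply: sub_eq (ha n) _ => u; rewrite mxE.
- by apply: sub_eq (hb n) _ => u; rewrite mxE.
- by apply: sub_eq (hb n) _ => u; rewrite mxE.
by apply: sub_eq (hd n) _ => u; rewrite mxE.
Qed.

Lemma hasT_symS (c : int -> nat -> Prop) k l : c k l -> hasT (symS (@HS R c)) k l.
Proof.
move=> hc; have hS := @HS_subsp R c; have hQ := @HS_gen R c k l hc.
apply: cm_symS => //; apply: cSfZ => //; first exact: cSfX.
by apply: cS_eq (cSfX hS (cSfX hS hQ)) _ => u; rewrite expr2 mulrA.
Qed.

Lemma hasM_symS (c : int -> nat -> Prop) k l : c k l -> hasM (symS (@HS R c)) k l.
Proof.
move=> hc; have hS := @HS_subsp R c; have hQ := @HS_gen R c k l hc.
have hd := cSfd hS hQ.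
apply: cm_symS => //.
  by apply: cSfZ => //; apply: cSfD => //; [exact: cSfX|apply: cSfN => //; exact: cSfZ].
apply: cSfX => //; apply: cSfD => //; first exact: cSfZ.
by apply: cSfN => //; exact: cSfX.
Qed.

(** In [HS_nQdQ] with x = 2 k + 1 and y = 2 the critical factor is 4 (k + l + 1), a multiple of the
    factor k + l + 1 in front of T in the definition of C. *)
Lemma hasC_symS (c : int -> nat -> Prop) k l : c (k - 1) l.+1 ->
  ((0 < l)%N -> c k l.-1 \/ 2 * k + 2 * l%:Z + 2 = 0) -> hasC (symS (@HS R c)) k l.
Proof.
move=> h1 h2; have hS := @HS_subsp R c.
have H j : cS (HS c) (fun u : reg => ((2 * k%:~R + 1) * NV u ^ (k - 1) * nN j (val u)) *: Qp (val u) ^+ l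
    + (l%:R * 2 * NV u ^ k) *: (dQ R j * Qp (val u) ^+ l.-1)).
  have := @HS_nQdQ R c (2 * k%:~R + 1) 2 (k - 1) l j h1; rewrite subrK; apply.
  move=> /h2[h|h]; [by left|right].
  have := congr1 (fun z : int => z%:~R : C) h; rewrite !(rmorphD, rmorphM) rmorph0 /= -!pmulrn => e.
  by rewrite -[RHS](mulr0 2) -e; ring.
apply: cm_symS.
- apply: cS_eq (H j1) _ => u; rewrite nN1 dQ1 mulN1r.
  by apply/polyP => m; rewrite !(coefD, coefN, coefZ); ring.
- apply: cS_eq (cSZ hS (i / 2) (H j2)) _ => u; rewrite nN2 dQ2 /z12 -[(2 *: 'X) * _]scalerAl.
  by apply/polyP => m; rewrite !(coefD, coefN, coefZ); field.
apply: cS_eq (H j0) _ => u; rewrite nN0 dQ0.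
by apply/polyP => m; rewrite !(coefD, coefN, coefZ); ring.
Qed.

(** Subtracting x / (2 k + 1) times the form of C removes Z Q^l and leaves w w^T Q^(l-1) with a
    factor proportional to (2 k + 1) y + 2 x. The odd number 2 k + 1 is never 0. *)
Lemma hasZ_of (E : set MF) k l (x y : C) : subsp E -> hasC E k l ->
  ((0 < l)%N -> hasT E k l.-1 \/ (2 * k%:~R + 1) * y + 2 * x = 0) ->
  cm E (fun u => (x * NV u ^ (k - 1) * z11 (val u)) *: Qp (val u) ^+ l
     + (l%:R * y * NV u ^ k) *: Qp (val u) ^+ l.-1)
  (fun u => (x * NV u ^ (k - 1) * z12 (val u)) *: Qp (val u) ^+ l
     + (l%:R * y * NV u ^ k) *: (- i *: ('X * Qp (val u) ^+ l.-1)))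
  (fun u => (x * NV u ^ (k - 1) * z22 (val u)) *: Qp (val u) ^+ l
     + (l%:R * y * NV u ^ k) *: (- 1 *: ('X^2 * Qp (val u) ^+ l.-1))).
Proof.
move=> hE hC hT; pose w := 2 * k%:~R + 1 : C; have w0 : w != 0 := odd_int_neq0 k.
have hT' : cm E (fun u => (l%:R * ((w * y + 2 * x) / w) * NV u ^ k) *: Qp (val u) ^+ l.-1)
   (fun u => (l%:R * ((w * y + 2 * x) / w) * NV u ^ k) *: (- i *: ('X * Qp (val u) ^+ l.-1)))
   (fun u => (l%:R * ((w * y + 2 * x) / w) * NV u ^ k) *: (- 1 *: ('X^2 * Qp (val u) ^+ l.-1))).
  have Z0 : l%:R * ((w * y + 2 * x) / w) = 0 \/ hasT E k l.-1.
    case: l hT {hC} => [|l] hT; first by left; rewrite mul0r.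
    by have [//|h|h] := hT; [right|left; rewrite /w h mul0r mulr0].
  case: Z0 => [->|h].
    by move=> n; apply: msub_eq (msub0 hE) _ => u; rewrite mul0r !scale0r coef0 symmx0.
  by apply: cm_eq (cmZ hE (l%:R * ((w * y + 2 * x) / w)) h) _ _ _ => u; rewrite !scalerA.
apply: cm_eq (cmD hE (cmZ hE (x / w) hC) hT') _ _ _ => u; clear hC hT hT';
 apply/polyP => m; rewrite !(coefD, coefN, coefZ) -/w; field; exact: w0.
Qed.

(** By [VpE] this is the case x = 2 l + 1, y = 2 of [hasZ_of]; the critical factor is then 4 (k + l
    + 2). *)
Lemma hasB_of (E : set MF) k l : subsp E -> hasC E (k + 1) l ->
  ((0 < l)%N -> hasT E (k + 1) l.-1 \/ k + l%:Z + 2 = 0) -> hasB E k l.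
Proof.
move=> hE hC hT; have := @hasZ_of E (k + 1) l (2 * l%:R + 1) 2 hE hC; rewrite addrK => H.
apply: cm_eq (H _) _ _ _ => [/hT[h|h]|u|u|u]; first by left.
- right; have := congr1 (fun z : int => z%:~R : C) h.
  rewrite !rmorphD rmorph0 rmorph1 /= -!pmulrn => e.
  by rewrite -[RHS](mulr0 4) -e; ring.
- rewrite VpE nN1 dQ1 NexpS.
  by apply/polyP => m; rewrite !(coefD, coefN, coefZ) mulN1r coefN; ring.
- rewrite VpE nN2 dQ2 NexpS /z12 -[(2 *: 'X) * _]scalerAl.
  by apply/polyP => m; rewrite !(coefD, coefN, coefZ); field.
rewrite VpE nN0 dQ0 NexpS.
by apply/polyP => m; rewrite !(coefD, coefN, coefZ); ring.
Qed.

Definition cplus (k : int) (l : nat) : Prop := - (l%:Z + 1) <= k.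

Lemma EplusE : @Eplus R = symS (HS cplus).
Proof.
rewrite -[LHS]/(Egen (fun k l => - (l + 1) <= k) id).
apply/seteqP; split.
  apply: Egen_min; first exact: symS_subsp (@HS_subsp R cplus).
  move=> k l hkl; split; [exact: hasT_symS|exact: hasM_symS|apply: hasC_symS].
    by rewrite /cplus; lia.
  by move=> l0; rewrite /cplus; lia.
have hE := @Egen_subsp R (fun k l => - (l + 1) <= k) id.
apply: symS_sub => // k l hkl.
have [hT hM _] := @Egen_has R (fun k l => - (l + 1) <= k) id k l hkl.
apply: hasE_of => // l0; apply: hasB_of => //.
  by have [|//] := @Egen_has R (fun k l => - (l + 1) <= k) id (k + 1) l.-1; rewrite /cplus in hkl; lia.
move=> l1; have [e|ne] := eqVneq (k + l.-1%:Z + 2) 0; [by right|left].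
by have [|//] := @Egen_has R (fun k l => - (l + 1) <= k) id (k + 1) l.-1.-1; rewrite /cplus in hkl; lia.
Qed.

Definition cminus (k : int) (l : nat) : Prop := k <= - 2.

Definition Zplus (u : pt R) : 'M[C]_2 := symmx (z22 u) (- z12 u) (z11 u).

Lemma NZ12 (u : pt R) : NZ u = z11 u * z22 u - z12 u ^+ 2.
Proof. by rewrite NZE /z12; ring: ii. Qed.

Lemma mulmx2E m n (A : 'M[C]_(m, 2)) (B : 'M[C]_(2, n)) p q :
  (A *m B) p q = A p 0 * B 0 q + A p 1 * B 1 q.
Proof.
rewrite mxE !big_ord_recl big_ord0 addr0.
by congr (_ * _ + A _ _ * B _ _); apply: val_inj.
Qed.

Lemma ZZplus (u : pt R) : Zmx u *m Zplus u = (NZ u)%:M.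
Proof.
by apply/matrixP => -[[|[|//]] ?] [[|[|//]] ?]; rewrite mulmx2E !mxE /= NZ12; ring.
Qed.

Lemma ZplusZ (u : pt R) : Zplus u *m Zmx u = (NZ u)%:M.
Proof.
by apply/matrixP => -[[|[|//]] ?] [[|[|//]] ?]; rewrite mulmx2E !mxE /= NZ12; ring.
Qed.

Lemma NexpN2 (u : reg) : NV u ^ (- 2) = (NV u * NV u)^-1.
Proof. by rewrite -expr2. Qed.

(** The field Z^(-1) F Z^(-1), with Z^(-1) written as N^(-1) times the adjugate. *)
Definition desand (F : MF) : MF :=
  fun u => NV u ^ (-2) *: (Zplus (val u) *m F u *m Zplus (val u)).

Lemma desandK (F : MF) u : Zmx (val u) *m desand F u *m Zmx (val u) = F u.
Proof.
rewrite /desand -scalemxAr -scalemxAl !mulmxA ZZplus -!mulmxA ZplusZ.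
rewrite mul_scalar_mx mul_mx_scalar !scalerA.
by rewrite -[RHS]scale1r NexpN2; congr (_ *: _); field; exact: Nneq0.
Qed.

Lemma sandK (F : MF) u : desand (fun u => Zmx (val u) *m F u *m Zmx (val u)) u = F u.
Proof.
rewrite /desand !mulmxA ZplusZ -!mulmxA ZZplus.
rewrite mul_scalar_mx mul_mx_scalar !scalerA.
by rewrite -[RHS]scale1r NexpN2; congr (_ *: _); field; exact: Nneq0.
Qed.

Lemma desand_lin a (F G : MF) u : desand (a *: F + G) u = a *: desand F u + desand G u.
Proof.
rewrite /desand -[(a *: F + G) u]/(a *: F u + G u) mulmxDr mulmxDl scalerDr.
by rewrite -scalemxAr -scalemxAl !scalerA mulrC.
Qed.

Definition desandS (S : set MF) : set MF := [set F | S (desand F)].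

Lemma desandS_subsp (S : set MF) : subsp S -> subsp (desandS S).
Proof.
move=> hS; split=> [|a F G hF hG].
  by apply: msub_eq hS.1 _ => u; rewrite /desand mulmx0 mul0mx scaler0.
by apply: msub_eq (hS.2 a _ _ hF hG) _ => u; rewrite desand_lin.
Qed.

Lemma cm_desand (S : set Fn) k (A B D A' B' D' : reg -> {poly C}) : subsp S ->
  (forall u, A' u = (z22 (val u) ^+ 2) *: A u - (2 * z22 (val u) * z12 (val u)) *: B u + (z12 (val u) ^+ 2) *: D u) ->
  (forall u, B' u = - (z12 (val u) * z22 (val u)) *: A u + (z11 (val u) * z22 (val u) + z12 (val u) ^+ 2) *: B u - (z12 (val u) * z11 (val u)) *: D u) ->
  (forall u, D' u = (z12 (val u) ^+ 2) *: A u - (2 * z11 (val u) * z12 (val u)) *: B u + (z11 (val u) ^+ 2) *: D u) ->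
  cS S (fun u => NV u ^ (k - 2) *: A' u) -> cS S (fun u => NV u ^ (k - 2) *: B' u) ->
  cS S (fun u => NV u ^ (k - 2) *: D' u) ->
  cm (desandS (symS S)) (fun u => NV u ^ k *: A u) (fun u => NV u ^ k *: B u) (fun u => NV u ^ k *: D u).
Proof.
move=> hS eA eB eD hA hB hD n; apply: msub_eq (cm_symS hA hB hD n) _ => u.
rewrite /desand symmx_sand symmxZ expfzDr ?Nneq0 //.
congr symmx; rewrite ?eA ?eB ?eD !(coefD, coefN, coefZ); ring.
Qed.

Let iiP : (i%:P : {poly C}) * i%:P = -1.
Proof. by rewrite -polyCM ii polyCN. Qed.

Let QpE (u : pt R) : Qp u = - (z22 u)%:P + 2 * (ct u)%:P * 'X + (z11 u)%:P * 'X ^+ 2.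
Proof. by rewrite /Qp polyCN polyCM polyC_natr. Qed.

(** Multiplying w w^T by the adjugate on both sides gives, up to signs and a factor i/2 off the
    diagonal, the entries n_j Q - N d_j Q, to which [HS_nQdQ] applies. *)
Lemma desand_T (u : pt R) (p : {poly C}) :
  [/\ (z22 u ^+ 2) *: p - (2 * z22 u * z12 u) *: (- i *: ('X * p)) + (z12 u ^+ 2) *: (-1 *: ('X^2 * p))
      = - (z22 u *: (Qp u * p) - NZ u *: ('X^2 * p)),
   - (z12 u * z22 u) *: p + (z11 u * z22 u + z12 u ^+ 2) *: (- i *: ('X * p)) - (z12 u * z11 u) *: (-1 *: ('X^2 * p))
      = i *: (ct u *: (Qp u * p) - NZ u *: ('X * p)) &
   (z12 u ^+ 2) *: p - (2 * z11 u * z12 u) *: (- i *: ('X * p)) + (z11 u ^+ 2) *: (-1 *: ('X^2 * p))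
      = - (z11 u *: (Qp u * p) - NZ u *: (-1 * p))].
Proof.
by split; rewrite NZE /z12 QpE -!mul_polyC !(polyCM, polyCD, polyCN, polyC_exp, polyC1); ring: iiP.
Qed.

Lemma desand_M (u : pt R) l (A := (Qp u ^+ l)^`()) (B := - i *: ('X * A - l%:R *: Qp u ^+ l))
   (D := 'X * ((2 * l%:R) *: Qp u ^+ l - 'X * A)) :
  [/\ (z22 u ^+ 2) *: A - (2 * z22 u * z12 u) *: B + (z12 u ^+ 2) *: D = NZ u *: (- D),
   - (z12 u * z22 u) *: A + (z11 u * z22 u + z12 u ^+ 2) *: B - (z12 u * z11 u) *: D = NZ u *: B &
   (z12 u ^+ 2) *: A - (2 * z11 u * z12 u) *: B + (z11 u ^+ 2) *: D = NZ u *: (- A)].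
Proof.
rewrite /D /B /A; case: l {A B D} => [|l].
  have -> : (Qp u ^+ 0)^`() = 0 by rewrite expr0 -polyC1 derivC.
  by split; rewrite !(mulr0n, mulr0, scale0r, subr0, scaler0, oppr0, addr0).
rewrite deriv_Qpl [Qp u ^+ l.+1]exprS deriv_Qp; move: (l.+1%:R : C) => x; move: (Qp u ^+ l) => p.
by split; rewrite NZE /z12 QpE -!mul_polyC !(polyCM, polyCD, polyCN, polyC_exp, polyC1, polyC_natr); ring: iiP.
Qed.

Lemma desand_C (u : pt R) l (y : C) (p := Qp u ^+ l) (q := Qp u ^+ l.-1)
  (A := y *: (z11 u *: p) - (2 * l%:R * NZ u) *: q)
  (B := y *: (z12 u *: p) - (2 * l%:R * NZ u) *: (- i *: ('X * q)))
  (D := y *: (z22 u *: p) - (2 * l%:R * NZ u) *: (-1 *: ('X^2 * q))) :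
  [/\ (z22 u ^+ 2) *: A - (2 * z22 u * z12 u) *: B + (z12 u ^+ 2) *: D
       = NZ u *: ((y + 2 * l%:R) *: (z22 u *: p) - (2 * l%:R * NZ u) *: ('X^2 * q)),
   - (z12 u * z22 u) *: A + (z11 u * z22 u + z12 u ^+ 2) *: B - (z12 u * z11 u) *: D
       = - i *: (NZ u *: ((y + 2 * l%:R) *: (ct u *: p) - (2 * l%:R * NZ u) *: ('X * q))) &
   (z12 u ^+ 2) *: A - (2 * z11 u * z12 u) *: B + (z11 u ^+ 2) *: D
       = NZ u *: ((y + 2 * l%:R) *: (z11 u *: p) - (2 * l%:R * NZ u) *: (-1 * q))].
Proof.
rewrite /D /B /A /p /q; case: l {A B D p q} => [|l].
  by split; rewrite mulr0n !(mulr0, mul0r, scale0r, subr0, addr0) NZE /z12 -!mul_polyC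
    !(polyCM, polyCD, polyCN, polyC_exp, polyC1, polyC_natr); ring: iiP.
rewrite [Qp u ^+ l.+1]exprS /=; move: (l.+1%:R : C) => x; move: (Qp u ^+ l) => p.
by split; rewrite NZE /z12 QpE -!mul_polyC !(polyCM, polyCD, polyCN, polyC_exp, polyC1, polyC_natr); ring: iiP.
Qed.

Lemma EminusP (F : MF) : @Eminus R F -> symS (HS cminus) (desand F).
Proof.
move: F; rewrite -[X in forall F, X F -> _]/(Egen (fun k _ => k <= -1) (fun k => k + 1)).
have hS := @HS_subsp R cminus.
rewrite -/(Egen _ _ `<=` desandS (symS (HS cminus))).
apply: Egen_min; first exact/desandS_subsp/symS_subsp.
move=> k l hk; split.
- have hZ j : cS (HS cminus) (fun u : reg => NV u ^ (k - 2) *: (nN j (val u) *: Qp (val u) ^+ l.+1 - NV u *: (dQ R j * Qp (val u) ^+ l))).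
    have := @HS_nQdQ R cminus 1 (- (l.+1%:R)^-1) (k - 2) l.+1 j.
    rewrite /cminus => /(_ ltac:(lia))/(_ ltac:(by left; lia)) h; apply: cS_eq h _ => u.
    rewrite NexpS scalerBr -scaleNr !scalerA; congr (_ *: _ + _ *: _); first by ring.
    by rewrite mulrN mulfV ?pnatr_eq0 //; ring.
  have hZ2 : cS (HS cminus) (fun u : reg => NV u ^ (k - 2) *: (ct (val u) *: Qp (val u) ^+ l.+1 - NV u *: ('X * Qp (val u) ^+ l))).
    apply: cS_eq (cSZ hS (2^-1) (hZ j2)) _ => u; rewrite nN2 dQ2 -[(2 *: 'X) * _]scalerAl.
    by apply/polyP => m; rewrite !(coefD, coefN, coefZ); field.
  have hZ0 := hZ j0; have hZ1 := hZ j1; move: hZ0 hZ1; under eq_fun do rewrite nN0 dQ0.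
  move=> hZ0; under eq_fun do rewrite nN1 dQ1; move=> hZ1.
  apply: cm_desand hS _ _ _ (cSfN hS hZ0) (cSfZ hS i hZ2) (cSfN hS hZ1) => u;
    rewrite exprS; have [h1 h2 h3] := desand_T (val u) (Qp (val u) ^+ l); exact/esym.
- have [_ _] : [/\ True, True & cminus (k - 1) l] by rewrite /cminus; split=> //; lia.
  move=> hc; have hQ := @HS_gen R cminus (k - 1) l hc; have hd := cSfd hS hQ.
  have hB := cSfZ hS (- i) (cSfD hS (cSfX hS hd) (cSfN hS (cSfZ hS l%:R hQ))).
  have hD := cSfX hS (cSfD hS (cSfZ hS (2 * l%:R) hQ) (cSfN hS (cSfX hS hd))).
  have hN A : cS (HS cminus) (fun u : reg => NV u ^ (k - 1) *: A u) ->
     cS (HS cminus) (fun u : reg => NV u ^ (k - 2) *: (NV u *: A u)).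
    move=> h; apply: cS_eq h _ => u; rewrite scalerA -NexpS; congr (_ ^ _ *: _); lia.
  apply: cm_desand hS _ _ _ (hN _ (cSfN hS hD)) (hN _ hB) (hN _ (cSfN hS hd)) => u;
    have [h1 h2 h3] := desand_M (val u) l; exact/esym.
(* The coefficient [y + 2 * l%:R] of [desand_C] for the shifted index k + 1 of C. *)
pose x : C := 2 * k%:~R + 2 * l%:R + 3.
pose y : C := 2 * (k + 1)%:~R + 1.
have hx : x = y + 2 * l%:R by rewrite /x /y rmorphD rmorph1; ring.
have hy : 2 * (k + 1)%:~R + 1 = y by [].
have hZ j : cS (HS cminus) (fun u : reg => NV u ^ (k - 2) *: (NV u *: (x *: (nN j (val u) *: Qp (val u) ^+ l)
     - (2 * l%:R * NV u) *: (dQ R j * Qp (val u) ^+ l.-1)))).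
  have eN (u : reg) : NV u ^ (k - 1 + 1) = NV u ^ (k - 2) * (NV u * NV u).
    by rewrite mulrA -!NexpS; congr (_ ^ _); lia.
  have := @HS_nQdQ R cminus x (- 2) (k - 1) l j.
  rewrite {1}/cminus => /(_ ltac:(lia)) h.
  apply: cS_eq (h _) _ => [l0|u].
    have [e|ne] := eqVneq k (- 1); last by left; rewrite /cminus; lia.
    by right; rewrite /x e; ring.
  rewrite eN (_ : NV u ^ (k - 1) = NV u ^ (k - 2) * NV u); last by rewrite -NexpS; congr (_ ^ _); lia.
  by apply/polyP => m; rewrite !(coefD, coefN, coefZ); ring.
clearbody x y.
have hZ2 : cS (HS cminus) (fun u : reg => NV u ^ (k - 2) *: (NV u *: (x *: (ct (val u) *: Qp (val u) ^+ l)
     - (2 * l%:R * NV u) *: ('X * Qp (val u) ^+ l.-1)))).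
  apply: cS_eq (cSZ hS (2^-1) (hZ j2)) _ => u; rewrite nN2 dQ2 -[(2 *: 'X) * _]scalerAl.
  by apply/polyP => m; rewrite !(coefD, coefN, coefZ); field.
have hZ0 := hZ j0; have hZ1 := hZ j1; move: hZ0 hZ1; under eq_fun do rewrite nN0 dQ0.
move=> hZ0; under eq_fun do rewrite nN1 dQ1; move=> hZ1.

have H := @cm_desand (HS cminus) k
  (fun u => y *: (z11 (val u) *: Qp (val u) ^+ l) - (2 * l%:R * NV u) *: Qp (val u) ^+ l.-1)
  (fun u => y *: (z12 (val u) *: Qp (val u) ^+ l) - (2 * l%:R * NV u) *: (- i *: ('X * Qp (val u) ^+ l.-1)))
  (fun u => y *: (z22 (val u) *: Qp (val u) ^+ l) - (2 * l%:R * NV u) *: (-1 *: ('X^2 * Qp (val u) ^+ l.-1)))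
  _ _ _ hS _ _ _ hZ0 (cSfZ hS (- i) hZ2) hZ1.
apply: cm_eq (H _ _ _) _ _ _ => u;
  try by rewrite addrK NexpS hy; apply/polyP => m; rewrite !(coefD, coefN, coefZ); ring.
all: by have [h1 h2 h3] := desand_C (val u) l y; rewrite hx; exact/esym.
Qed.

(** The sandwich Z adj(H) Z. With the adjugate inserted, the image of w w^T Q^l is again written
    with the same w: it is - (Z Q + N w w^T) Q^l. Taking adjugates preserves symmetric matrices with
    entries in a given subspace, so nothing is lost. *)
Definition jsand (H : MF) : MF :=
  fun u => Zmx (val u) *m symmx (H u 1 1) (- H u 0 1) (H u 0 0) *m Zmx (val u).

Definition jsandS (E : set MF) : set MF := [set H | E (jsand H)].

Lemma jsandS_subsp (E : set MF) : subsp E -> subsp (jsandS E).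
Proof.
move=> hE; split=> [|a F G hF hG].
  apply: msub_eq hE.1 _ => u; rewrite /jsand !mxE oppr0 symmx0.
  by rewrite mulmx0 mul0mx.
apply: msub_eq (hE.2 a _ _ hF hG) _ => u; rewrite /jsand.
rewrite -[LHS]/(a *: _ + _) scalemxAl scalemxAr -mulmxDl -mulmxDr symmxZ symmxD.
by congr (_ *m symmx _ _ _ *m _); rewrite !mxE; ring.
Qed.

Lemma cm_jsand (E : set MF) k (A B D : reg -> {poly C}) :
  cm E
   (fun u => NV u ^ k *: ((z11 (val u) ^+ 2) *: D u - (2 * z11 (val u) * z12 (val u)) *: B u + (z12 (val u) ^+ 2) *: A u))
   (fun u => NV u ^ k *: ((z11 (val u) * z12 (val u)) *: D u - (z11 (val u) * z22 (val u) + z12 (val u) ^+ 2) *: B u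
      + (z12 (val u) * z22 (val u)) *: A u))
   (fun u => NV u ^ k *: ((z12 (val u) ^+ 2) *: D u - (2 * z12 (val u) * z22 (val u)) *: B u + (z22 (val u) ^+ 2) *: A u)) ->
  cm (jsandS E) (fun u => NV u ^ k *: A u) (fun u => NV u ^ k *: B u) (fun u => NV u ^ k *: D u).
Proof.
move=> h n; apply: msub_eq (h n) _ => u.
rewrite /jsand /Zmx symmx_sand !mxE /=.
congr symmx; rewrite !(coefD, coefN, coefZ); ring.
Qed.

Lemma jsand_T (u : pt R) (p : {poly C}) :
  [/\ (z11 u ^+ 2) *: (-1 *: ('X^2 * p)) - (2 * z11 u * z12 u) *: (- i *: ('X * p)) + (z12 u ^+ 2) *: p
      = - (z11 u *: (Qp u * p) + NZ u *: p),
   (z11 u * z12 u) *: (-1 *: ('X^2 * p)) - (z11 u * z22 u + z12 u ^+ 2) *: (- i *: ('X * p)) + (z12 u * z22 u) *: p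
      = - (z12 u *: (Qp u * p) + NZ u *: (- i *: ('X * p))) &
   (z12 u ^+ 2) *: (-1 *: ('X^2 * p)) - (2 * z12 u * z22 u) *: (- i *: ('X * p)) + (z22 u ^+ 2) *: p
      = - (z22 u *: (Qp u * p) + NZ u *: (-1 *: ('X^2 * p)))].
Proof.
by split; rewrite NZE /z12 QpE -!mul_polyC !(polyCM, polyCD, polyCN, polyC_exp, polyC1); ring: iiP.
Qed.

Lemma jsand_M (u : pt R) l (A := (Qp u ^+ l)^`()) (B := - i *: ('X * A - l%:R *: Qp u ^+ l))
   (D := 'X * ((2 * l%:R) *: Qp u ^+ l - 'X * A)) :
  [/\ (z11 u ^+ 2) *: D - (2 * z11 u * z12 u) *: B + (z12 u ^+ 2) *: A = - (NZ u *: A),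
   (z11 u * z12 u) *: D - (z11 u * z22 u + z12 u ^+ 2) *: B + (z12 u * z22 u) *: A = - (NZ u *: B) &
   (z12 u ^+ 2) *: D - (2 * z12 u * z22 u) *: B + (z22 u ^+ 2) *: A = - (NZ u *: D)].
Proof.
rewrite /D /B /A; case: l {A B D} => [|l].
  have -> : (Qp u ^+ 0)^`() = 0 by rewrite expr0 -polyC1 derivC.
  by split; rewrite !(mulr0n, mulr0, scale0r, subr0, scaler0, oppr0, addr0).
rewrite deriv_Qpl [Qp u ^+ l.+1]exprS deriv_Qp; move: (l.+1%:R : C) => x; move: (Qp u ^+ l) => p.
by split; rewrite NZE /z12 QpE -!mul_polyC !(polyCM, polyCD, polyCN, polyC_exp, polyC1, polyC_natr); ring: iiP.
Qed.

Lemma jsand_B (u : pt R) l (p := Qp u ^+ l) (q := Qp u ^+ l.-1)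
  (A := Vp l (Qp u ^+ l.+1) j1) (B := (i / 2) *: Vp l (Qp u ^+ l.+1) j2) (D := Vp l (Qp u ^+ l.+1) j0) :
  [/\ (z11 u ^+ 2) *: D - (2 * z11 u * z12 u) *: B + (z12 u ^+ 2) *: A
       = NZ u *: (z11 u *: p - (2 * l%:R * NZ u) *: q),
   (z11 u * z12 u) *: D - (z11 u * z22 u + z12 u ^+ 2) *: B + (z12 u * z22 u) *: A
       = NZ u *: (z12 u *: p - (2 * l%:R * NZ u) *: (- i *: ('X * q))) &
   (z12 u ^+ 2) *: D - (2 * z12 u * z22 u) *: B + (z22 u ^+ 2) *: A
       = NZ u *: (z22 u *: p - (2 * l%:R * NZ u) *: (-1 *: ('X^2 * q)))].
Proof.
rewrite /D /B /A /p /q; clear A B D p q; rewrite !VpE nN0 nN1 nN2 dQ0 dQ1 dQ2.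
have -> : (i / 2) *: ((2 * l%:R + 1) *: ((2 * ct u) *: Qp u ^+ l) - (2 * l%:R * NZ u) *: ((2 *: 'X) * Qp u ^+ l.-1))
   = (i * (2 * l%:R + 1) * ct u) *: Qp u ^+ l - (i * (2 * l%:R * NZ u)) *: ('X * Qp u ^+ l.-1).
  by rewrite -[(2 *: 'X) * _]scalerAl; apply/polyP => m; rewrite !(coefD, coefN, coefZ); field.
case: l => [|l].
  by split; rewrite mulr0n !(mulr0, mul0r, scale0r, subr0, addr0, add0r) NZE /z12 -!mul_polyC
    !(polyCM, polyCD, polyCN, polyC_exp, polyC1, polyC_natr); ring: iiP.
rewrite [Qp u ^+ l.+1]exprS /=; move: (l.+1%:R : C) => x; move: (Qp u ^+ l) => p.
by split; rewrite NZE /z12 QpE -!mul_polyC !(polyCM, polyCD, polyCN, polyC_exp, polyC1, polyC_natr); ring: iiP.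
Qed.

(** By [hasE_of] it is enough to find the images under [jsand] of the three generating forms in E_-:
    that of T comes from C and T by [hasZ_of], that of M is a multiple of M, and that of B comes
    from C and T again. *)
Lemma Eminus_sand (H : MF) : symS (HS cminus) H ->
  @Eminus R (fun u => Zmx (val u) *m H u *m Zmx (val u)).
Proof.
pose E := Egen (fun k _ => k <= -1) (fun k => k + 1) : set MF.
rewrite -[@Eminus R]/E => -[hH sH].
have hE : subsp E by exact: Egen_subsp.
have hJ := jsandS_subsp hE.
have has k (l : nat) : k <= -1 -> [/\ hasT E k l, hasM E k l & hasC E (k + 1) l].
  by move=> hk; exact: (@Egen_has R (fun k _ => k <= -1) (fun k => k + 1)).
suff : jsandS E (fun u => symmx (H u 1 1) (- H u 0 1) (H u 0 0)).
  rewrite /jsandS /= => h; apply: msub_eq h _ => u; rewrite /jsand !mxE /= opprK.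
  by rewrite -(symmx_of (sH u)).
have : symS (HS cminus) (fun u => symmx (H u 1 1) (- H u 0 1) (H u 0 0)).
  have hS := @HS_subsp R cminus.
  split=> [p q|u]; last exact: symmx_tr.
  case: p q => [] [|[|//]] ? [] [|[|//]] ?; rewrite /entry.
  - by apply: sub_eq (hH 1 1) _ => u; rewrite mxE.
  - by apply: sub_eq (subspZ (-1) hS (hH 0 1)) _ => u; rewrite mxE scl_fct mulN1r.
  - by apply: sub_eq (subspZ (-1) hS (hH 0 1)) _ => u; rewrite mxE scl_fct mulN1r.
  by apply: sub_eq (hH 0 0) _ => u; rewrite mxE.
apply: (symS_sub hJ) => k l hk.
have [hT1 hM1 _] := has (k + 1) l ltac:(rewrite /cminus in hk; lia).
apply: hasE_of => //.
- have [_ _ hC] := has k l.+1 ltac:(rewrite /cminus in hk; lia).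
  have := @hasZ_of E (k + 1) l.+1 (-1) (- (l.+1%:R)^-1) hE hC; rewrite addrK => /(_ ltac:(by left)) hZ.
  apply: cm_jsand.
  have l0 : l.+1%:R != 0 :> C by rewrite pnatr_eq0.
  apply: cm_eq hZ _ _ _ => u; have [h1 h2 h3] := jsand_T (val u) (Qp (val u) ^+ l);
   rewrite ?h1 ?h2 ?h3 mulrN mulfV // NexpS [l.+1.-1]/= [Qp _ ^+ l.+1]exprS;
   apply/polyP => m; rewrite !(coefD, coefN, coefZ); ring.
- apply: cm_jsand.
  apply: cm_eq (cmZ hE (-1) hM1) _ _ _ => u; have [h1 h2 h3] := jsand_M (val u) l;
   rewrite ?h1 ?h2 ?h3 NexpS;
   apply/polyP => m; rewrite !(coefN, coefZ); ring.
move=> l0; set l' := l.-1.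
have [_ _] := has (k + 1) l' ltac:(rewrite /cminus in hk; lia); rewrite -addrA => hC.
have := @hasZ_of E (k + 2) l' 1 (-2) hE hC.
rewrite (_ : k + 2 - 1 = k + 1); last by lia.
move=> hZ.
apply: cm_jsand.
apply: cm_eq (hZ _) _ _ _ => [l1|u|u|u].
(* For k = - 2 the form T with exponent k + 2 is not in E_-, but its factor (2 (k + 2) + 1) (- 2) +
   2 is 0. *)
- have [e|ne] := eqVneq k (- 2).
    by right; rewrite e; ring.
  left; have [|//] := has (k + 2) l'.-1; rewrite /cminus in hk; lia.
all: have [h1 h2 h3] := jsand_B (val u) l'; rewrite ?h1 ?h2 ?h3.
all: rewrite (_ : NV u ^ (k + 2) = NV u ^ k * NV u * NV u) ?NexpS; last by rewrite -!NexpS -addrA.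
all: apply/polyP => m; rewrite !(coefD, coefN, coefZ); ring.
Qed.

End Characterization.

(** * Invariance of the trilinear forms *)

Section Invariance.
Variable R : realType.
Local Notation C := R[i].
Local Notation i := ('i%C : C).
Local Notation reg := (reg R).
Local Notation Fn := (reg -> C^o).
Local Notation MF := (reg -> 'M[C]_2).
Local Notation Z u := (Zmx (val u)).

Let ii : i * i = -1. Proof. by rewrite -expr2 sqr_i. Qed.

Lemma pderD e j (g h : Fn) u : dif g -> dif h ->
  pder e j (fun v => g v + h v) u = pder e j g u + pder e j h u.
Proof.
move=> hg hh; have := pder_lin e j 1 u hg hh; rewrite mul1r => <-.
by congr (pder e j _ u); apply/funext => v; rewrite lin_fct mul1r.
Qed.

Definition dmx e j m n (F : reg -> 'M[C]_(m, n)) (u : reg) : 'M[C]_(m, n) :=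
  \matrix_(a, b) pder e j (entry F a b) u.

Lemma dmxE e j m n (F : reg -> 'M[C]_(m, n)) u a b : dmx e j F u a b = pder e j (entry F a b) u.
Proof. by rewrite mxE. Qed.

Lemma mxDE m n (A B : 'M[C]_(m, n)) a b : (A + B) a b = A a b + B a b.
Proof. by rewrite mxE. Qed.

Lemma mxZE m n x (A : 'M[C]_(m, n)) a b : (x *: A) a b = x * A a b.
Proof. by rewrite mxE. Qed.

Lemma mxtrace2 (A : 'M[C]_2) : \tr A = A 0 0 + A 1 1.
Proof.
rewrite /mxtrace !big_ord_recl big_ord0 addr0.
by congr (A _ _ + A _ _); apply: val_inj.
Qed.

Lemma sum2 (f : 'I_2 -> C) : \sum_(p < 2) f p = f 0 + f 1.
Proof.
by rewrite !big_ord_recl big_ord0 addr0; congr (f _ + f _); apply: val_inj.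
Qed.

Definition mxS (S : set Fn) m n (F : reg -> 'M[C]_(m, n)) : Prop :=
  forall a b, S (entry F a b).

Local Notation mxdif := (mxS (@dif R)).

Lemma mxS_M (S : set Fn) m n (F : reg -> 'M[C]_(m, 2)) (G : reg -> 'M[C]_(2, n)) :
  subsp S -> (forall a b, S (fun u => F u a 0 * G u 0 b) /\ S (fun u => F u a 1 * G u 1 b)) ->
  mxS S (fun u => F u *m G u).
Proof.
move=> hS h a b; have [h1 h2] := h a b.
by apply: sub_eq (subspD hS h1 h2) _ => u; rewrite /entry mulmx2E.
Qed.

Lemma mxS_mull (S : set Fn) n (F : MF) (G : reg -> 'M[C]_(2, n)) :
  subsp S -> (forall a b, mulcl S (entry F a b)) -> mxS S G -> mxS S (fun u => F u *m G u).
Proof. by move=> hS hF hG; apply: mxS_M => // a b; split; apply: hF; exact: hG. Qed.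

Lemma mxS_mulr (S : set Fn) m (F : reg -> 'M[C]_(m, 2)) (G : MF) :
  subsp S -> (forall a b, mulcl S (entry G a b)) -> mxS S F -> mxS S (fun u => F u *m G u).
Proof.
move=> hS hG hF; apply: mxS_M => // a b; split.
  by apply: sub_eq (hG 0 b _ (hF a 0)) _ => u; rewrite mulrC.
by apply: sub_eq (hG 1 b _ (hF a 1)) _ => u; rewrite mulrC.
Qed.

Lemma mxSD (S : set Fn) m n (F G : reg -> 'M[C]_(m, n)) : subsp S -> mxS S F -> mxS S G ->
  mxS S (fun u => F u + G u).
Proof.
move=> hS hF hG a b; apply: sub_eq (subspD hS (hF a b) (hG a b)) _ => u.
by rewrite /entry mxE.
Qed.

Lemma mxSN (S : set Fn) m n (F : reg -> 'M[C]_(m, n)) : subsp S -> mxS S F ->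
  mxS S (fun u => - F u).
Proof.
move=> hS hF a b; apply: sub_eq (subspZ (-1) hS (hF a b)) _ => u.
by rewrite /entry mxE scl_fct mulN1r.
Qed.

Lemma mxSZ (S : set Fn) m n (f : reg -> C) (F : reg -> 'M[C]_(m, n)) : mulcl S f -> mxS S F ->
  mxS S (fun u => f u *: F u).
Proof.
move=> hf hF a b; apply: sub_eq (hf _ (hF a b)) _ => u.
by rewrite /entry mxE.
Qed.

Lemma mxdifM m n (F : reg -> 'M[C]_(m, 2)) (G : reg -> 'M[C]_(2, n)) :
  mxdif F -> mxdif G -> mxdif (fun u => F u *m G u).
Proof. by move=> hF hG; apply: mxS_M => [|a b]; [exact: dif_subsp|split; apply: difM; [exact: hF|exact: hG|exact: hF|exact: hG]]. Qed.

Lemma mxdif_cst m n (M : 'M[C]_(m, n)) : mxdif (fun=> M).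
Proof. by move=> a b; exact: dif_cst. Qed.

Lemma mxdif_Z : mxdif (fun u => Z u).
Proof.
have [hz12 hz] : (forall j, exists d, pd0 j (fun u : reg => z12 (val u)) d) /\
   dif (fun u : reg => z11 (val u)) /\ dif (fun u : reg => z22 (val u)).
  split=> [j|]; last by split=> j; have [h1 h2 h3] := pd0_coord R j; eexists; [exact: h1|exact: h2].
  by have [h1 h2 h3] := pd0_coord R j; eexists; exact: pd0Z h3.
move=> [[|[|//]] ?] [[|[|//]] ?].
- by apply: sub_eq hz.1 _ => u; rewrite /entry mxE.
- by apply: sub_eq (hz12 : dif _) _ => u; rewrite /entry mxE.
- by apply: sub_eq (hz12 : dif _) _ => u; rewrite /entry mxE.
by apply: sub_eq hz.2 _ => u; rewrite /entry mxE.
Qed.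

Lemma dmxM e e' j m n (F : reg -> 'M[C]_(m, 2)) (G : reg -> 'M[C]_(2, n)) u :
  mxdif F -> mxdif G ->
  dmx (e + e') j (fun u => F u *m G u) u = dmx e j F u *m G u + F u *m dmx e' j G u.
Proof.
move=> hF hG; apply/matrixP => a b; rewrite dmxE mxDE !mulmx2E !dmxE.
rewrite (_ : entry _ a b = fun u => entry F a 0 u * entry G 0 b u + entry F a 1 u * entry G 1 b u); last first.
  by apply/funext => v; rewrite /entry mulmx2E.
rewrite pderD; try by apply: difM; [exact: hF|exact: hG].
rewrite !(pderM e e' j u (hF _ _) (hG _ _)) /entry.
set p := pder e j _ u; set q := pder e' j _ u; set r := pder e j _ u; set s := pder e' j _ u.
by rewrite !addrA; congr (_ + _); rewrite addrAC.
Qed.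

Lemma dmxD e j m n (F G : reg -> 'M[C]_(m, n)) u : mxdif F -> mxdif G ->
  dmx e j (fun u => F u + G u) u = dmx e j F u + dmx e j G u.
Proof.
move=> hF hG; apply/matrixP => a b; rewrite !mxE -(pderD e j u (hF a b) (hG a b)).
by congr (pder e j _ u); apply/funext => v; rewrite /entry mxE.
Qed.

Lemma dmx_cst j m n (M : 'M[C]_(m, n)) u : dmx 0 j (fun=> M) u = 0.
Proof. by apply/matrixP => a b; rewrite !mxE pder0_cst. Qed.

Definition dZj (j : 'I_3) : 'M[C]_2 :=
  symmx (nth 0 [:: 1; 0; 0] j) (nth 0 [:: 0; 0; i] j) (nth 0 [:: 0; 1; 0] j).

Lemma dmx_Z j u : dmx 0 j (fun u => Z u) u = dZj j.
Proof.
have [h1 h2 h3] := pd0_coord R j.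
have E (h d : Fn) : pd0 j h d -> forall F : Fn, F =1 h -> pder 0 j F u = d u.
  by move=> hd F /funext ->; rewrite (pderE 0 u hd) !mul0r addr0.
have e12 (F : Fn) : F =1 (fun u => z12 (val u)) -> pder 0 j F u = nth 0 [:: 0; 0; i] j.
  move=> hF; rewrite (E _ _ (pd0Z i h3) F hF).
  by case: j {h1 h2 h3 E hF} => [] [|[|[|//]]] ? /=; rewrite ?mulr0 ?mulr1.
apply/matrixP => -[[|[|//]] ?] [[|[|//]] ?]; rewrite !mxE /=.
- by rewrite (E _ _ h1) // => v; rewrite /entry mxE.
- by rewrite e12 // => v; rewrite /entry mxE.
- by rewrite e12 // => v; rewrite /entry mxE.
by rewrite (E _ _ h2) // => v; rewrite /entry mxE.
Qed.

(** The operator Tr(M d) in coordinates, applied to a triple of derivatives with values in any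
    module: scalars, matrices and polynomials in X all occur. *)
Definition contr (M : 'M[C]_2) (V : lmodType C) (x : 'I_3 -> V) : V :=
  M 0 0 *: x j0 + (- (i / 2) * (M 0 1 + M 1 0)) *: x j2 + M 1 1 *: x j1.

Lemma contr_eq M (V : lmodType C) (x y : 'I_3 -> V) : x =1 y -> contr M x = contr M y.
Proof. by move=> e; rewrite /contr !e. Qed.

Lemma contrD M (V : lmodType C) (x y : 'I_3 -> V) :
  contr M (fun j => x j + y j) = contr M x + contr M y.
Proof.
rewrite /contr !scalerDr.
by rewrite [X in X + _]addrACA [LHS]addrACA.
Qed.

Lemma contr_linear M (V V' : lmodType C) (f : {linear V -> V'}) (x : 'I_3 -> V) :
  contr M (fun j => f (x j)) = f (contr M x).
Proof. by rewrite /contr !linearD !linearZ. Qed.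

Lemma contr_mx M m n (D : 'I_3 -> 'M[C]_(m, n)) a b :
  contr M D a b = contr M (fun j => D j a b : C^o).
Proof. by rewrite /contr; move: (D j0) (D j1) (D j2) => x y z; rewrite !mxE. Qed.

Lemma tr_dZE e (M : MF) m n (F : reg -> 'M[C]_(m, n)) u :
  tr_dZ e M F u = contr (M u) (fun j => dmx e j F u).
Proof.
apply/matrixP => a b; rewrite contr_mx (contr_eq (M u) (fun j => dmxE e j F u a b)) [LHS]mxE !sum2.
rewrite /contr /dZ /d_z11 /d_z22 /d_t /=.
move: (pder e j0 _ u) (pder e j1 _ u) (pder e j2 _ u) => x y z.
rewrite /GRing.scale /=.
ring.
Qed.

Lemma tr_dZM e e' (M : MF) m n (F : reg -> 'M[C]_(m, 2)) (G : reg -> 'M[C]_(2, n)) u :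
  mxdif F -> mxdif G ->
  tr_dZ (e + e') M (fun u => F u *m G u) u = tr_dZ e M F u *m G u + F u *m tr_dZ e' M G u.
Proof.
move=> hF hG; rewrite !tr_dZE (contr_eq _ (fun j => dmxM e e' j u hF hG)) contrD.
by rewrite (contr_linear _ (mulmxr (G u))) (contr_linear _ (mulmx (F u))).
Qed.

(** A symmetric M is the velocity with which the vector field Tr(M d) moves Z. *)
Lemma tr_dZ_Z (M : MF) u : (M u)^T = M u -> tr_dZ 0 M (fun u => Z u) u = M u.
Proof.
move=> sM; rewrite tr_dZE (contr_eq _ (fun j => dmx_Z j u)) [RHS](symmx_of sM).
have m10 : M u 1 0 = M u 0 1 by rewrite -[in LHS]sM mxE.
rewrite /contr m10 /dZj !inordK //= !symmxZ !symmxD; congr symmx; try by ring.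
by field: ii.
Qed.

Lemma tr_dZ_sand (M H : MF) u : (M u)^T = M u -> mxdif H ->
  tr_dZ 1 M (fun u => Z u *m H u *m Z u) u =
  M u *m H u *m Z u + Z u *m tr_dZ 1 M H u *m Z u + Z u *m H u *m M u.
Proof.
move=> sM hH; have hZ := mxdif_Z.
rewrite (@tr_dZM 1 0 M 2 2 (fun u => Z u *m H u) (fun u => Z u)) //; last exact: mxdifM.
by rewrite (@tr_dZM 0 1 M 2 2 (fun u => Z u) H) // tr_dZ_Z // mulmxDl.
Qed.

Lemma Z_tr (u : pt R) : (Zmx u)^T = Zmx u. Proof. exact: symmx_tr. Qed.

Lemma vecA_tr A (u : reg) : (vecA A u)^T = vecA A u.
Proof. by rewrite /vecA linearD /= !trmx_mul trmxK Z_tr addrC. Qed.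

Lemma vecC_tr K (u : reg) : K^T = K -> (vecC K u)^T = vecC K u.
Proof. by move=> sK; rewrite /vecC !trmx_mul Z_tr sK mulmxA. Qed.

Lemma dmx_vecA A j u : dmx 0 j (vecA A) u = A *m dZj j + dZj j *m A^T.
Proof.
have hZ := mxdif_Z; have hA := mxdif_cst A; have hA' := mxdif_cst A^T.
rewrite (@dmxD 0 j 2 2 (fun u => A *m Z u) (fun u => Z u *m A^T)); [|exact: mxdifM..].
rewrite (@dmxM 0 0 j 2 2 (fun=> A) (fun u => Z u)) // (@dmxM 0 0 j 2 2 (fun u => Z u) (fun=> A^T)) //.
by rewrite !dmx_cst !dmx_Z mul0mx mulmx0 add0r addr0.
Qed.

Lemma dmx_vecC K j u : dmx 0 j (vecC K) u = dZj j *m K *m Z u + Z u *m K *m dZj j.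
Proof.
have hZ := mxdif_Z; have hK := mxdif_cst K.
rewrite (@dmxM 0 0 j 2 2 (fun u => Z u *m K) (fun u => Z u)) //; last exact: mxdifM.
rewrite (@dmxM 0 0 j 2 2 (fun u => Z u) (fun=> K)) //.
by rewrite !dmx_cst !dmx_Z mulmx0 addr0.
Qed.

(** The divergence of the vector field Tr(M d), [D j] being the j-th partial derivative of M. *)
Definition divg (D : 'I_3 -> 'M[C]_2) : C :=
  D j0 0 0 - i / 2 * (D j2 0 1 + D j2 1 0) + D j1 1 1.

Lemma div_vecA A u : divg (fun j => dmx 0 j (vecA A) u) = 3 * \tr A.
Proof.
rewrite /divg !dmx_vecA /dZj !inordK //= mxtrace2.
by rewrite !mxDE !mulmx2E !mxE /=; field: ii.
Qed.

Lemma div_vecC K u : K^T = K -> divg (fun j => dmx 0 j (vecC K) u) = 3 * \tr (Z u *m K).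
Proof.
move=> sK; have k10 : K 1 0 = K 0 1 by rewrite -[in LHS]sK mxE.
rewrite /divg !dmx_vecC /dZj !inordK //= mxtrace2.
by rewrite !mxDE !mulmx2E !mxE /= k10; field: ii.
Qed.

Section Totals.
Variables (e : nat) (h : Fn).
Hypothesis Ph : P h.

Definition tdZ e (M : MF) (h : Fn) : Fn := fun u => contr (M u) (fun j => pder e j h u : C^o).

Let total_ring (x y z a b c d m00 m01 m10 m11 t : C) :
  m00 * x + - (i / 2) * (m01 + m10) * z + m11 * y + (a - i / 2 * (c + d) + b) * t =
  a * t + m00 * x + - (i / 2) * (c * t + m01 * z + (d * t + m10 * z)) + (b * t + m11 * y).
Proof. by ring. Qed.

(** The integrand Tr(M d) h + (div M) h is a combination of derivatives of products of an entry of M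
    with h, each of which integrates to 0. *)
Lemma int_total (M : MF) (w : Fn) : (forall a b, P (entry M a b)) ->
  (forall u, divg (fun j => dmx 0 j M u) = w u) ->
  int_Gamma e (fun u => tdZ e M h u + w u * h u) = 0.
Proof.
move=> hM hw; have hS := P_subsp R.
have hd a b := P_dif (hM a b); have dh := P_dif Ph.
pose G j a b : Fn := pder e j (fun u => entry M a b u * h u).
have PG j a b : P (G j a b) by apply: P_pder; exact: PM.
have IG j a b : int_Gamma e (G j a b) = 0 by apply: stokes; exact: PM.
have PG' x j a b : P (fun u => x * G j a b u : C^o) := mulcl_cst x hS (PG j a b).
have P1 : P (fun u => G j2 0 1 u + G j2 1 0 u : C^o) := subspD hS (PG j2 0 1) (PG j2 1 0).
have P2 : P (fun u => - (i / 2) * (G j2 0 1 u + G j2 1 0 u) : C^o) := mulcl_cst _ hS P1.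
have P3 : P (fun u => G j0 0 0 u + - (i / 2) * (G j2 0 1 u + G j2 1 0 u) : C^o) := subspD hS (PG j0 0 0) P2.
rewrite (_ : (fun _ => _) = (fun u => (G j0 0 0 u + - (i / 2) * (G j2 0 1 u + G j2 1 0 u)) + G j1 1 1 u)).
  by rewrite (int_GammaD e P3 (PG j1 1 1)) (int_GammaD e (PG j0 0 0) P2) (int_GammaZ e _ P1)
    (int_GammaD e (PG j2 0 1) (PG j2 1 0)) !IG !(addr0, mulr0).
apply/funext => u.
have EG j a b : G j a b u = dmx 0 j M u a b * h u + M u a b * pder e j h u.
  by rewrite dmxE; exact: (@pderM R 0 e j _ _ u (hd a b) dh).
clearbody G; rewrite -hw !EG /tdZ /contr /divg.
exact: total_ring.
Qed.

End Totals.

Lemma trE m n (A : 'M[C]_(m, n)) a b : A^T a b = A b a.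
Proof. by rewrite mxE. Qed.

Lemma mxNE m n (A : 'M[C]_(m, n)) a b : (- A) a b = - A a b.
Proof. by rewrite mxE. Qed.

Lemma tr_dZ_entry e (M : MF) m n (F : reg -> 'M[C]_(m, n)) u a b :
  tr_dZ e M F u a b = tdZ e M (entry F a b) u.
Proof. by rewrite tr_dZE contr_mx (contr_eq (M u) (fun j => dmxE e j F u a b)). Qed.

Section Modules.
Variables (S : set Fn) (e : nat).
Hypotheses (hS : subsp S) (hn : forall j, mulcl S (fun u => nN j (val u))).
Hypothesis hp : forall j h, S h -> S (pder e j h).

Let hZ a b : mulcl S (entry (fun u => Z u) a b). Proof. exact: mulcl_Z. Qed.

Lemma S_tdZ (M : MF) h : (forall a b, mulcl S (entry M a b)) -> S h -> S (tdZ e M h).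
Proof.
move=> hM hh; have h1 j a b : S (fun u => entry M a b u * pder e j h u) by exact/hM/hp.
apply: sub_eq (subspD hS (subspD hS (h1 j0 0 0) (subspZ (- (i / 2)) hS (subspD hS (h1 j2 0 1) (h1 j2 1 0)))) (h1 j1 1 1)) _ => u.
have E (c x y p : C) : c * (x * p + y * p) = c * (x + y) * p by ring.
by rewrite /tdZ /contr; congr (_ + _ + _); exact: E.
Qed.

Lemma mxS_tr_dZ (M : MF) m n (F : reg -> 'M[C]_(m, n)) :
  (forall a b, mulcl S (entry M a b)) -> mxS S F -> mxS S (tr_dZ e M F).
Proof.
by move=> hM hF a b; apply: sub_eq (S_tdZ hM (hF a b)) _ => u; rewrite /entry tr_dZ_entry.
Qed.

Lemma mulcl_mxM (M M' : MF) : (forall a b, mulcl S (entry M a b)) ->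
  (forall a b, mulcl S (entry M' a b)) -> forall a b, mulcl S (entry (fun u => M u *m M' u) a b).
Proof.
move=> h h' a b; apply: mulcl_eq (mulclD hS (mulclM (h a 0) (h' 0 b)) (mulclM (h a 1) (h' 1 b))) _ => u.
by rewrite /entry mulmx2E.
Qed.

Lemma mulcl_mxcst (A : 'M[C]_2) a b : mulcl S (entry (fun=> A) a b).
Proof. exact: mulcl_cst. Qed.

Lemma mulcl_vecA A a b : mulcl S (entry (vecA A) a b).
Proof.
apply: mulcl_eq (mulclD hS (mulcl_mxM (mulcl_mxcst A) hZ a b) (mulcl_mxM hZ (mulcl_mxcst A^T) a b)) _ => u.
by rewrite /entry mxDE.
Qed.

Lemma mulcl_vecC K a b : mulcl S (entry (vecC K) a b).
Proof. exact: mulcl_mxM (mulcl_mxM hZ (mulcl_mxcst K)) hZ _ _. Qed.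

Lemma mulcl_tr (M : MF) c : (forall a b, mulcl S (entry M a b)) -> mulcl S (fun u => \tr (c *: M u)).
Proof.
move=> hM; apply: mulcl_eq (mulclM (mulcl_cst c hS) (mulclD hS (hM 0 0) (hM 1 1))) _ => u.
by rewrite mxtraceZ mxtrace2.
Qed.

Lemma mxS_actV' X (g : reg -> 'rV[C]_2) : mxS S g -> mxS S (actV' e X g).
Proof.
move=> hg; have hA := mulcl_mxcst (ulsubmx X); have hK := mulcl_mxcst (dlsubmx X).
apply: (mxSD hS (mxSD hS (mxSD hS (mxSN hS (mxSD hS (mxS_tr_dZ _ hg) (mxSZ _ hg))) (mxSN hS (mxS_mulr hS _ hg))) (mxSN hS (mxS_tr_dZ _ hg)))
  (mxSD hS (mxSD hS (mxS_tr_dZ _ hg) (mxSZ _ hg)) (mxS_mulr hS _ (mxS_mulr hS _ hg)))) => //; try exact: mulcl_mxcst.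
- exact: mulcl_vecA.
- exact: mulcl_cst.
- exact: mulcl_vecC.
by apply: mulcl_tr; exact: mulcl_mxM.
Qed.

Lemma mxS_actV X (f : reg -> 'cV[C]_2) : mxS S f -> mxS S (actV e X f).
Proof.
move=> hf; have hK := mulcl_mxcst (dlsubmx X).
have hKZ := mulcl_mxM hK hZ.
apply: (mxSD hS (mxSD hS (mxSD hS (mxSN hS (mxSD hS (mxS_tr_dZ _ hf) (mxSZ _ hf))) (mxSN hS (mxS_mull hS _ hf))) (mxSN hS (mxS_tr_dZ _ hf)))
  (mxSD hS (mxSD hS (mxS_tr_dZ _ hf) (mxSZ _ hf)) (mxS_mull hS hKZ hf))) => //; try exact: mulcl_mxcst.
- exact: mulcl_vecA.
- exact: mulcl_cst.
- exact: mulcl_vecC.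
by apply: mulcl_tr.
Qed.

End Modules.

(** Stated for an arbitrary S: it is applied to P in the invariance of tau and to [HS cplus] in the
    stability of E_+. *)
Lemma mxS_actW (S : set Fn) X (F : MF) : subsp S ->
  (forall j, mulcl S (fun u => nN j (val u))) -> (forall j h, S h -> S (pder 1 j h)) ->
  mxS S F -> mxS S (actW X F).
Proof.
move=> hS hn hp hF; have hZ a b : mulcl S (entry (fun u => Z u) a b) by exact: mulcl_Z.
have mxS_tr_dZ := fun M n F => @mxS_tr_dZ S 1 hS hp M 2 n F.
have hA := mulcl_mxcst hS (ulsubmx X); have hA' := mulcl_mxcst hS (ulsubmx X)^T.
have hK := mulcl_mxcst hS (dlsubmx X); have hZK := mulcl_mxM hS hZ hK.
apply: (mxSD hS (mxSD hS (mxSD hS (mxSD hS (mxSN hS (mxSD hS (mxS_tr_dZ _ _ _ _ hF) (mxSZ _ hF))) (mxS_mull hS hA hF)) (mxS_mulr hS hA' hF))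
   (mxSN hS (mxS_tr_dZ _ _ _ _ hF)))
  (mxSD hS (mxSD hS (mxSD hS (mxS_tr_dZ _ _ _ _ hF) (mxSZ _ hF)) (mxSN hS (mxS_mull hS hZK hF)))
     (mxSN hS (mxS_mulr hS hZ (mxS_mulr hS hK hF))))) => //; try exact: mulcl_mxcst.
- exact: mulcl_vecA.
- exact: mulcl_cst.
- exact: mulcl_vecC.
by apply: mulcl_tr.
Qed.

(** The matrix terms cancel between adjacent factors: - g A against A F, F A^T against - A^T f, and
    similarly for C. The scalar weights 1/2, 2 and 1/2 add up to 3, the constant in [div_vecA] and
    [div_vecC]. *)
Lemma invariance_algebra (g gA gB gC : 'rV[C]_2) (F FA FB FC : 'M[C]_2) (f fA fB fC : 'cV[C]_2)
   (A K Y : 'M[C]_2) (x y : C) :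
  ((- (gA + (2^-1 * x) *: g) - g *m A + - gB + (gC + (2^-1 * y) *: g + g *m Y *m K)) *m F *m f) 0 0
  + (g *m (- (FA + (2 * x) *: F) + A *m F + F *m A^T + - FB
       + (FC + (2 * y) *: F - Y *m K *m F - F *m K *m Y)) *m f) 0 0
  + (g *m F *m (- (fA + (2^-1 * x) *: f) - A^T *m f + - fB + (fC + (2^-1 * y) *: f + K *m Y *m f))) 0 0
  = - ((gA *m F + g *m FA) *m f + g *m F *m fA) 0 0 - 3 * x * (g *m F *m f) 0 0
    - ((gB *m F + g *m FB) *m f + g *m F *m fB) 0 0
    + (((gC *m F + g *m FC) *m f + g *m F *m fC) 0 0 + 3 * y * (g *m F *m f) 0 0).
Proof.
rewrite !(mxDE, mulmx2E, mxNE, mxZE, trE).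
by field.
Qed.

Lemma P_mx_dif m n (F : reg -> 'M[C]_(m, n)) : mxP F -> mxdif F.
Proof. by move=> hF a b; exact/P_dif/hF. Qed.

Lemma mxPM m n (F : reg -> 'M[C]_(m, 2)) (G : reg -> 'M[C]_(2, n)) : mxP F -> mxP G ->
  mxP (fun u => F u *m G u).
Proof.
by move=> hF hG; apply: mxS_M => [|a b]; [exact: P_subsp|split; apply: PM; [exact: hF|exact: hG|exact: hF|exact: hG]].
Qed.

Lemma tau_invariant e : tau_sp4_invariant R e.
Proof.
move=> X g F f [XA XB XK] [hg _] [hF sF] [hf _].
have hS := P_subsp R; have hn := @P_nN R.
pose A := ulsubmx X; pose B := ursubmx X; pose K := dlsubmx X.
pose E := (e + 1 + e)%N; pose phi : Fn := fun u => (g u *m F u *m f u) 0 0.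
have P3 (g' : reg -> 'rV[C]_2) F' (f' : reg -> 'cV[C]_2) : mxP g' -> mxP F' -> mxP f' ->
    P (fun u => (g' u *m F' u *m f' u) 0 0 : C^o).
  by move=> h1 h2 h3; exact: (mxPM (mxPM h1 h2) h3 0 0).
have Pphi : P phi by exact: P3.
have hpd e' j (h : Fn) : P h -> P (pder e' j h) by exact: P_pder.
have Pg' : mxP (actV' e X g) := mxS_actV' hS hn (hpd e) X hg.
have Pf' : mxP (actV e X f) := mxS_actV hS hn (hpd e) X hf.
have PF' : mxP (actW X F) := mxS_actW X hS hn (hpd 1%N) hF.
have Pcl (M : MF) : (forall a b, mulcl (@P R) (entry M a b)) -> forall a b, P (entry M a b).
  move=> h a b; have := h a b _ (@P_cst R 1).
  by rewrite (_ : (fun _ => _) = entry M a b) //; apply/funext => u; exact: mulr1.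
pose tot (M : MF) (w : Fn) : Fn := fun u => tdZ E M phi u + w u * phi u.
have Ptot M (w : Fn) : (forall a b, mulcl (@P R) (entry M a b)) -> P w -> P (tot M w).
  move=> hM hw; apply: (subspD hS); last exact: PM.
  exact: (S_tdZ hS (hpd E)).
pose wK : Fn := fun u => 3 * \tr (Z u *m K).
have PwK : P wK.
  have hZ a b : mulcl (@P R) (entry (fun u => Z u) a b) by exact: mulcl_Z.
  have := mulcl_tr hS 3 (mulcl_mxM hS hZ (mulcl_mxcst hS K)) (@P_cst R 1).
  by move=> h; apply: sub_eq h _ => u; rewrite mxtraceZ mulr1.
have clA := mulcl_vecA hS hn A; have clB := mulcl_mxcst hS B; have clK := mulcl_vecC hS hn K.
have PA := Ptot _ _ clA (@P_cst R (3 * \tr A)).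
have PB := Ptot _ _ clB (@P_cst R 0); have PK := Ptot _ _ clK PwK.
have iA : int_Gamma E (tot (vecA A) (fun=> 3 * \tr A)) = 0.
  by apply: int_total => // [|u]; [exact: Pcl|exact: div_vecA].
have iB : int_Gamma E (tot (fun=> B) (fun=> 0)) = 0.
  apply: int_total => // [|u]; first exact: Pcl.
  by rewrite /divg !dmx_cst !mxE; ring.
have iK : int_Gamma E (tot (vecC K) wK) = 0.
  by apply: int_total => // [|u]; [exact: Pcl|exact: div_vecC].
rewrite /tau -!mulrDr -(int_GammaD _ (P3 _ _ _ Pg' hF hf) (P3 _ _ _ hg PF' hf)).
rewrite -int_GammaD; [|exact: subspD hS (P3 _ _ _ Pg' hF hf) (P3 _ _ _ hg PF' hf)|exact: P3].
have PN h : P h -> P (fun u => - 1 * h u : C^o) by move=> hh; exact: (mulcl_cst (-1) hS hh).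
(* By the product rule and the previous algebra the sum of the three integrands is a combination of
   three total divergences, one for each block of X. *)
rewrite (_ : (fun _ => _) = (fun u => (- 1 * tot (vecA A) (fun=> 3 * \tr A) u + - 1 * tot (fun=> B) (fun=> 0) u) + tot (vecC K) wK u)).
  rewrite (int_GammaD _ (subspD hS (PN _ PA) (PN _ PB)) PK) (int_GammaD _ (PN _ PA) (PN _ PB)).
  by rewrite (int_GammaZ _ _ PA) (int_GammaZ _ _ PB) iA iB iK !mulr0 !addr0 mulr0.
apply/funext => u.
have EM M : tdZ E M phi u = ((tr_dZ e M g u *m F u + g u *m tr_dZ 1 M F u) *m f u + g u *m F u *m tr_dZ e M f u) 0 0.
  have -> : phi = entry (fun u => g u *m F u *m f u) 0 0 by [].
  rewrite -tr_dZ_entry (@tr_dZM (e + 1) e M 1 1 (fun u => g u *m F u) f); try exact: P_mx_dif; last exact/P_mx_dif/mxPM.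
  by rewrite (@tr_dZM e 1 M 1 2 g F) //; exact: P_mx_dif.
rewrite /tot !EM /wK /phi /actV' /actV /actW /actB -/A -/B -/K.
rewrite !mxtraceZ (mxtrace_mulC K) (invariance_algebra (g u) _ _ _ (F u) _ _ _ (f u)).
by ring.
Qed.

End Invariance.

(** * Invariance of E_+ and E_- *)

Section Stability.
Variable R : realType.
Local Notation C := R[i].
Local Notation i := ('i%C : C).
Local Notation reg := (reg R).
Local Notation Fn := (reg -> C^o).
Local Notation MF := (reg -> 'M[C]_2).
Local Notation Z u := (Zmx (val u)).

Let ii : i * i = -1. Proof. by rewrite -expr2 sqr_i. Qed.

Let iiP : (i%:P : {poly C}) * i%:P = -1.
Proof. by rewrite -polyCM ii polyCN. Qed.

Let QpE (u : pt R) : Qp u = - (z22 u)%:P + 2 * (ct u)%:P * 'X + (z11 u)%:P * 'X ^+ 2.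
Proof. by rewrite /Qp polyCN polyCM polyC_natr. Qed.

Lemma tr_dZ_tr e (M F : MF) u : (forall u, (F u)^T = F u) ->
  (tr_dZ e M F u)^T = tr_dZ e M F u.
Proof.
move=> sF; apply/matrixP => a b; rewrite trE !tr_dZ_entry; congr (tdZ e M _ u).
by apply/funext => v; rewrite /entry -[in LHS]sF trE.
Qed.

Lemma sym2 (M : 'M[C]_2) : M 0 1 = M 1 0 -> M^T = M.
Proof.
move=> h; have e0 (p : (0 < 2)%N) : Ordinal p = 0 by exact: val_inj.
have e1 (p : (1 < 2)%N) : Ordinal p = 1 by exact: val_inj.
by apply/matrixP => -[[|[|//]] p] [[|[|//]] q]; rewrite trE ?e0 ?e1.
Qed.

Lemma sym10 (M : 'M[C]_2) : M^T = M -> M 1 0 = M 0 1.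
Proof. by move=> h; rewrite -[in LHS]h trE. Qed.

Lemma actW_sym_algebra (tA tB tC F A K Y : 'M[C]_2) (x y : C) :
  tA^T = tA -> tB^T = tB -> tC^T = tC -> F^T = F -> K^T = K -> Y^T = Y ->
  (- (tA + x *: F) + A *m F + F *m A^T + - tB + (tC + y *: F - Y *m K *m F - F *m K *m Y))^T =
  - (tA + x *: F) + A *m F + F *m A^T + - tB + (tC + y *: F - Y *m K *m F - F *m K *m Y).
Proof.
move=> /sym10 a /sym10 b /sym10 c /sym10 f /sym10 k /sym10 w; apply: sym2.
by rewrite !(mxDE, mulmx2E, mxNE, mxZE, trE) a b c f k w; ring.
Qed.

Lemma actW_tr X (F : MF) u : sp4 X -> (forall u, (F u)^T = F u) ->
  (actW X F u)^T = actW X F u.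
Proof.
move=> [_ _ hK] sF; apply: actW_sym_algebra => //; try exact: tr_dZ_tr.
exact: Z_tr.
Qed.

(** The pairs of [cplus] are stable under the moves for coordinates and for derivatives. A
    derivative would leave the set only from k = - l - 1, where 2 k + 1 + 2 l + 1 = 0 at level 1. *)
Lemma Eplus_stable : sp4_stable (@Eplus R).
Proof.
move=> X F hX; rewrite EplusE => -[hF sF]; split=> [p q|u]; last exact: actW_tr.
apply: (mxS_actW X (@HS_subsp R cplus)) => // [j|j h].
  by apply: HS_mulnN => k l; rewrite /cplus; lia.
by apply: HS_pder => k l; rewrite /cplus; lia.
Qed.

Let sand_sum (a1 a2 a3 a4 a5 s p b q k1 k2 d t : 'M[C]_2) :
  - (a1 + a2 + a3 + (a4 + a5) + s) + a1 + a5 - (p + b + q) + (k1 + d + k2 + t - k1 - k2) =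
  - a3 - s - a2 - a4 - p - q - b + (d + t).
Proof. by apply/matrixP => m n; rewrite !mxE; ring. Qed.

(** Conjugation by Y = Z: differentiating the outer factors cancels all matrix terms of C, turns
    those of A into - A^T H - H A, and gives B the terms - P H - H Q, where P and Q stand for Z^(-1)
    B and B Z^(-1). *)
Lemma sand_algebra (Y H A B K P Q tA tB tC : 'M[C]_2) (x y : C) :
  B = Y *m P -> B = Q *m Y ->
  - ((A *m Y + Y *m A^T) *m H *m Y + Y *m tA *m Y + Y *m H *m (A *m Y + Y *m A^T) + x *: (Y *m H *m Y))
    + A *m (Y *m H *m Y) + Y *m H *m Y *m A^T
  + - (B *m H *m Y + Y *m tB *m Y + Y *m H *m B)
  + (Y *m K *m Y *m H *m Y + Y *m tC *m Y + Y *m H *m (Y *m K *m Y) + y *: (Y *m H *m Y)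
     - Y *m K *m (Y *m H *m Y) - Y *m H *m Y *m K *m Y)
  = Y *m (- tA - x *: H - A^T *m H - H *m A - P *m H - H *m Q - tB + (tC + y *: H)) *m Y.
Proof.
move=> eP eQ.
have -> : B *m H = Y *m P *m H by rewrite -eP.
have -> : Y *m H *m B = Y *m H *m (Q *m Y) by rewrite -eQ.
clear eP eQ; rewrite !(mulmxDl, mulmxDr, mulmxN, mulNmx) -?scalemxAr -?scalemxAl !mulmxA.
exact: sand_sum.
Qed.

Let lin_ring (m p q a x y z x' y' z' w h h' : C) :
  m * (a * x + x') + p * (a * z + z') + q * (a * y + y') + w * (a * h + h') =
  a * (m * x + p * z + q * y + w * h) + (m * x' + p * z' + q * y' + w * h').
Proof. by ring. Qed.

Lemma contr_coef M (p : 'I_3 -> {poly C}) n :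
  (contr M p)`_n = contr M (fun j => (p j)`_n : C^o).
Proof. by rewrite /contr !coefD !coefZ. Qed.

Lemma HS_vec (c : int -> nat -> Prop) (T : set Fn) (M : MF) (w : reg -> C) : subsp T ->
  (forall k l, c k l -> cS T (fun u => contr (M u) (fun j =>
     ((k%:~R + 1%:R / 2) * NV u ^ (k - 1) * nN j (val u)) *: Qp (val u) ^+ l
     + (l%:R * NV u ^ k) *: (dQ R j * Qp (val u) ^+ l.-1)) + (w u * NV u ^ k) *: Qp (val u) ^+ l)) ->
  forall h, HS c h -> T (fun u => tdZ 1 M h u + w u * h u).
Proof.
move=> hT H h hh; suff : [set h | dif h /\ T (fun u => tdZ 1 M h u + w u * h u)] h by case.
move: h hh; apply: HS_ind.
  split=> [|a g h [hg hg'] [hh hh']].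
    split; first exact: (dif_subsp R).1.
    apply: sub_eq hT.1 _ => u; rewrite /tdZ.
    rewrite (@contr_eq R (M u) _ (fun j => pder 1 j 0 u : C^o) (fun=> 0) (fun j => congr1 (fun f => f u) (@pder_0 R 1 j))).
    by rewrite /contr !scaler0 mulr0 !addr0.
  split; first exact: (dif_subsp R).2.
  apply: sub_eq (hT.2 a _ _ hg' hh') _ => u; rewrite /tdZ.
  rewrite (contr_eq (M u) (fun j => pder_lin 1 j a u hg hh)).
  exact/esym/lin_ring.
move=> k l hc n; split; first exact: dif_NQ.
apply: sub_eq (H k l hc n) _ => u; rewrite coefD contr_coef /tdZ.
by rewrite (contr_eq (M u) (fun j => pder_NQ 1 j k l n u)) !coefZ mulrA.
Qed.

Lemma contr_sym (M : 'M[C]_2) (p : 'I_3 -> {poly C}) (q : {poly C}) : M^T = M -> p j2 = 2 *: q ->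
  contr M p = M 0 0 *: p j0 + (- (2 * i) * M 0 1) *: q + M 1 1 *: p j1.
Proof.
move=> /sym10 h e; rewrite /contr h e !scalerA; congr (_ + _ *: _ + _).
by field.
Qed.

Lemma contr_arg (x y t L N : C) (P0 q : {poly C}) :
  (x * y * (2 * t)) *: P0 + (L * N) *: ((2 *: 'X) * q) = 2 *: ((x * y * t) *: P0 + (L * N) *: ('X * q)).
Proof.
by rewrite -[(2 *: 'X) * _]scalerAl scalerDr !scalerA; congr (_ *: _ + _ *: _); ring.
Qed.

(** The linear field of A preserves every bidegree, so [c] is arbitrary: on N^k Q^l it acts as a
    first-order differential operator in X. *)
Lemma HS_vecA (c : int -> nat -> Prop) (A : 'M[C]_2) h : HS c h -> HS c (tdZ 1 (vecA A) h).
Proof.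
have hS := @HS_subsp R c.
move=> hh; suff : HS c (fun u => tdZ 1 (vecA A) h u + 0 * h u).
  by move=> H; apply: sub_eq H _ => u; rewrite mul0r addr0.
apply: HS_vec hh => // k l hc; have hQ := @HS_gen R c k l hc; have hD := cSfd hS hQ.
have hE := cSfD hS (cSfZ hS (2 * l%:R) hQ) (cSfN hS (cSfX hS hD)).
pose x : C := k%:~R + 1%:R / 2.
have H := cSfD hS (cSfD hS (cSfZ hS (2 * x * (A 0 0 + A 1 1)) hQ)
   (cSfD hS (cSfZ hS (A 0 0) (cSfX hS hD)) (cSfZ hS (- (i * A 1 0)) hD)))
   (cSfD hS (cSfZ hS (i * A 0 1) (cSfX hS hE)) (cSfZ hS (A 1 1) hE)).
apply: cS_eq H _ => u; rewrite -/x; clearbody x.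
rewrite (contr_sym (vecA_tr A u) (q := (x * NV u ^ (k - 1) * ct (val u)) *: Qp (val u) ^+ l
    + (l%:R * NV u ^ k) *: ('X * Qp (val u) ^+ l.-1))); last by rewrite nN2 dQ2; exact: contr_arg.
rewrite /vecA nN0 nN1 dQ0 dQ1 !(mxDE, mulmx2E, trE) !mxE /=.
have -> : NV u ^ k = NV u ^ (k - 1) * NV u by rewrite -NexpS subrK.
clear hQ hD hE hc; move: (NV u ^ (k - 1)) (A 0 0) (A 0 1) (A 1 0) (A 1 1) => y a00 a01 a10 a11.
case: l => [|l].
  have -> : (Qp (val u) ^+ 0)^`() = 0 by rewrite expr0 -polyC1 derivC.
  rewrite mulr0n NZE /z12 -!mul_polyC !(polyCM, polyCD, polyCN, polyC_exp, polyC0, polyC1, polyC_natr) /=.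
  ring: iiP.
rewrite deriv_Qpl [Qp (val u) ^+ l.+1]exprS deriv_Qp /=.
move: (l.+1%:R : C) => L; move: (Qp (val u) ^+ l) => p.
by rewrite NZE /z12 QpE -!mul_polyC !(polyCM, polyCD, polyCN, polyC_exp, polyC1, polyC_natr); ring: iiP.
Qed.

(** The quadratic field of C leads to (k, l + 1) and (k + 1, l - 1). With the weight 2 Tr(Z K)
    included, the second coefficient is proportional to 2 k + 4 and vanishes on the boundary k = -
    2, so the two terms have to be kept together. *)
Lemma HS_vecC (K : 'M[C]_2) h : K^T = K -> HS cminus h ->
  HS cminus (fun u => tdZ 1 (vecC K) h u + \tr (2 *: (Z u *m K)) * h u).
Proof.
have hS := @HS_subsp R cminus.
move=> /symmx_of; set a := K 0 0; set b := K 0 1; set d := K 1 1; clearbody a b d => ->.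
apply: HS_vec => // k l hc.
pose x : C := k%:~R + 1%:R / 2.
have hT j := @HS_nQdQ R cminus (x + l%:R + 2) (- 1) k l j.
have {}hT j : cS (HS cminus) (fun u : reg => ((x + l%:R + 2) * NV u ^ k * nN j (val u)) *: Qp (val u) ^+ l +
     (l%:R * -1 * NV u ^ (k + 1)) *: (dQ R j * Qp (val u) ^+ l.-1)).
  apply: hT => // l0; have [e|ne] := eqVneq k (- 2).
    by right; rewrite /x e; field.
  by left; rewrite /cminus in hc *; lia.
have H := cSD hS (cSD hS (cSZ hS a (hT j1)) (cSZ hS (i * b) (hT j2))) (cSZ hS d (hT j0)).
apply: cS_eq H _ => u; rewrite -/x; clearbody x.
rewrite (contr_sym (vecC_tr u (symmx_tr a b d)) (q := (x * NV u ^ (k - 1) * ct (val u)) *: Qp (val u) ^+ l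
    + (l%:R * NV u ^ k) *: ('X * Qp (val u) ^+ l.-1))); last by rewrite nN2 dQ2; exact: contr_arg.
rewrite /vecC /Zmx symmx_sand nN0 nN1 nN2 dQ0 dQ1 dQ2 mxtraceZ mxtrace2 !mulmx2E !mxE /=.
have -> : NV u ^ (k + 1) = NV u ^ (k - 1) * NV u * NV u by rewrite -!NexpS subrK.
have -> : NV u ^ k = NV u ^ (k - 1) * NV u by rewrite -NexpS subrK.
clear hT hc; move: (NV u ^ (k - 1)) => y.
case: l => [|l].
  rewrite mulr0n NZE /z12 -!mul_polyC !(polyCM, polyCD, polyCN, polyC_exp, polyC0, polyC1, polyC_natr) /=.
  ring: iiP.
rewrite [Qp (val u) ^+ l.+1]exprS /=.
move: (l.+1%:R : C) => L; move: (Qp (val u) ^+ l) => p.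
by rewrite NZE /z12 QpE -!mul_polyC !(polyCM, polyCD, polyCN, polyC_exp, polyC1, polyC_natr); ring: iiP.
Qed.

Definition Zinv (u : reg) : 'M[C]_2 := (NV u)^-1 *: Zplus (val u).

(** The entries of Z^(-1) are multiples of the N^(-1) n_j, which send (k, l) to (k - 1, l + 1) and
    (k, l - 1). *)
Lemma mulcl_Zinv a b : mulcl (@HS R cminus) (entry Zinv a b).
Proof.
have hS := @HS_subsp R cminus.
have hn j : mulcl (HS cminus) (fun u : reg => NV u ^ (- 1) * nN j (val u)).
  by apply: mulcl_NnN => k l; rewrite /cminus; lia.
have h2 : mulcl (HS cminus) (fun u : reg => (NV u)^-1 * - z12 (val u)).
  apply: mulcl_eq (mulclM (mulcl_cst (- (i / 2)) hS) (hn j2)) _ => u.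
  by rewrite exprN1 nN2 /z12; field; exact: Nneq0.
case: a b => [[|[|//]] ?] [[|[|//]] ?].
- by apply: mulcl_eq (hn j0) _ => u; rewrite exprN1 nN0 /entry !mxE.
- by apply: mulcl_eq h2 _ => u; rewrite /entry !mxE.
- by apply: mulcl_eq h2 _ => u; rewrite /entry !mxE.
by apply: mulcl_eq (hn j1) _ => u; rewrite exprN1 nN1 /entry !mxE.
Qed.

Lemma ZinvK u (B : 'M[C]_2) : B = Z u *m (Zinv u *m B).
Proof.
by rewrite mulmxA /Zinv -scalemxAr ZZplus scale_scalar_mx mulVf ?Nneq0 // mul1mx.
Qed.

Lemma ZinvKr u (B : 'M[C]_2) : B = (B *m Zinv u) *m Z u.
Proof.
by rewrite -mulmxA /Zinv -scalemxAl ZplusZ scale_scalar_mx mulVf ?Nneq0 // mulmx1.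
Qed.

Lemma desand_sym (F : MF) u : (F u)^T = F u -> (desand F u)^T = desand F u.
Proof.
by move=> sF; rewrite /desand linearZ /= !trmx_mul !symmx_tr sF mulmxA.
Qed.

Lemma Eminus_stable : sp4_stable (@Eminus R).
Proof.
move=> X F [XA XB XK] /EminusP; set H := desand F => -[hH sH].
have hS := @HS_subsp R cminus.
have -> : F = (fun u => Z u *m H u *m Z u) by apply/funext => u; rewrite desandK.
set A := ulsubmx X; set B := ursubmx X; set K := dlsubmx X.
(* The action transported to H by [sand_algebra]. B now enters through Z^(-1), and C has lost its
   matrix terms, so that [cminus] is preserved. *)
pose H' u := - tr_dZ 1 (vecA A) H u - \tr (2 *: A) *: H u - A^T *m H u - H u *m A
   - Zinv u *m B *m H u - H u *m (B *m Zinv u) - tr_dZ 1 (fun=> B) H u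
   + (tr_dZ 1 (vecC K) H u + \tr (2 *: (Z u *m K)) *: H u).
have dH : mxS (@dif R) H by move=> a b; exact: HS_dif (hH a b).
have E : actW X (fun u => Z u *m H u *m Z u) = (fun u => Z u *m H' u *m Z u).
  apply/funext => u; rewrite /actW -/A -/B -/K -[actB 1 _ _ u]/(- tr_dZ 1 _ _ u).
  rewrite !tr_dZ_sand ?vecA_tr ?vecC_tr //.
  exact: sand_algebra (ZinvK u B) (ZinvKr u B).
have sF u : (Z u *m H u *m Z u)^T = Z u *m H u *m Z u.
  by rewrite !trmx_mul Z_tr sH mulmxA.
(* Symmetry is inherited from the action on the symmetric field Z H Z instead of being checked on
   the formula. *)
have sH' u : (H' u)^T = H' u.
  have -> : H' u = desand (actW X (fun u => Z u *m H u *m Z u)) u by rewrite E sandK.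
  by apply: desand_sym; exact: actW_tr.
rewrite E; apply: Eminus_sand; split=> //.
have hp j h : HS cminus h -> HS cminus (pder 1 j h : Fn).
  by apply: HS_pder => k l; rewrite /cminus; lia.
have hA := mulcl_mxcst hS A; have hA' := mulcl_mxcst hS A^T; have hB := mulcl_mxcst hS B.
have hW := mulcl_Zinv.
have mA : mxS (HS cminus) (tr_dZ 1 (vecA A) H).
  by move=> a b; apply: sub_eq (HS_vecA A (hH a b)) _ => u; rewrite /entry tr_dZ_entry.
have mC : mxS (HS cminus) (fun u => tr_dZ 1 (vecC K) H u + \tr (2 *: (Z u *m K)) *: H u).
  move=> a b; apply: sub_eq (HS_vecC XK (hH a b)) _ => u.
  by rewrite [in RHS]/entry mxDE mxZE tr_dZ_entry.
have mB := mxS_tr_dZ hS hp hB hH.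
have mT := mxSZ (mulcl_cst (\tr (2 *: A)) hS) hH.
have m1 := mxS_mull hS hA' hH; have m2 := mxS_mulr hS hA hH.
have m3 := mxS_mull hS (mulcl_mxM hS hW hB) hH; have m4 := mxS_mulr hS (mulcl_mxM hS hB hW) hH.
exact: (mxSD hS (mxSD hS (mxSD hS (mxSD hS (mxSD hS (mxSD hS (mxSD hS (mxSN hS mA) (mxSN hS mT)) (mxSN hS m1)) (mxSN hS m2))
  (mxSN hS m3)) (mxSN hS m4)) (mxSN hS mB)) mC).
Qed.

End Stability.

(** * Vanishing and non-triviality *)

Section Vanishing.
Variable R : realType.
Local Notation C := R[i].
Local Notation i := ('i%C : C).
Local Notation reg := (reg R).
Local Notation Fn := (reg -> C^o).
Local Notation MF := (reg -> 'M[C]_2).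
Local Notation Z u := (Zmx (val u)).

Let ii : i * i = -1. Proof. by rewrite -expr2 sqr_i. Qed.

Let hS : subsp (@P R) := P_subsp R.

(* Otherwise failing conversion tests on integrals unfold down to the integral. *)
Local Opaque int_Gamma pder.

Lemma by_parts e j (g h : Fn) : P g -> P h ->
  int_Gamma e (fun u => pder e j g u * h u) = - int_Gamma e (fun u => g u * pder 0 j h u).
Proof.
move=> Pg Ph; apply/eqP; rewrite -addr_eq0.
rewrite -int_GammaD; [|exact: (PM (P_pder e j Pg) Ph)|exact: (PM Pg (P_pder 0 j Ph))].
apply/eqP; rewrite -[RHS](stokes e j (PM Pg Ph)); congr (int_Gamma e); apply/funext => u.
by have := pderM e 0 j u (P_dif Pg) (P_dif Ph); rewrite addn0.
Qed.

Lemma green_dir e a b c (g h : Fn) : P g -> P h ->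
  int_Gamma e (fun u => (pder e a (pder e b g) u + 4^-1 * pder e c (pder e c g) u) * h u) =
  int_Gamma e (fun u => g u * (pder 0 b (pder 0 a h) u + 4^-1 * pder 0 c (pder 0 c h) u)).
Proof.
move=> Pg Ph.
have two p q : int_Gamma e (fun u => pder e p (pder e q g) u * h u) =
    int_Gamma e (fun u => g u * pder 0 q (pder 0 p h) u).
  by rewrite (by_parts e p (P_pder e q Pg) Ph) (by_parts e q Pg (P_pder 0 p Ph)) opprK.
have PL p q : P (fun u => pder e p (pder e q g) u * h u : C^o).
  exact: PM (P_pder e p (P_pder e q Pg)) Ph.
have PR p q : P (fun u => g u * pder 0 p (pder 0 q h) u : C^o).
  exact: PM Pg (P_pder 0 p (P_pder 0 q Ph)).
have four (x y z : C) : (x + 4^-1 * y) * z = x * z + 4^-1 * (y * z) by ring.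
have four' (x y z : C) : z * (x + 4^-1 * y) = z * x + 4^-1 * (z * y) by ring.
transitivity (int_Gamma e (fun u => pder e a (pder e b g) u * h u) +
    4^-1 * int_Gamma e (fun u => pder e c (pder e c g) u * h u)).
  rewrite -(int_GammaZ e _ (PL c c)) -(int_GammaD e (PL a b) (mulcl_cst 4^-1 hS (PL c c))).
  by congr (int_Gamma e); apply/funext => u; exact: four.
apply: etrans (congr2 +%R (two a b) (congr1 ( *%R 4^-1) (two c c))) _.
apply: etrans (congr1 (+%R _) (esym (int_GammaZ e _ (PR c c)))) _.
apply: etrans (esym (int_GammaD e (PR b a) (mulcl_cst 4^-1 hS (PR c c)))) _.
by congr (int_Gamma e); apply/funext => u; rewrite [RHS]four'.
Qed.

(** Two integrations by parts in each term. The whole level sits on [g], so on the other side the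
    Laplacian is that of level 0. *)
Lemma green e (g h : Fn) : P g -> P h ->
  int_Gamma e (fun u => lap e g u * h u) = int_Gamma e (fun u => g u * lap 0 h u).
Proof.
move=> Pg Ph; have E : pder 0 j0 (pder 0 j1 h) = pder 0 j1 (pder 0 j0 h).
  by apply/funext => u; exact: (pderC 0 j0 j1 Ph u).
by rewrite /lap E; exact: green_dir.
Qed.

Lemma contrM M (x y : 'I_3 -> C^o) (a b : C) :
  contr M (fun j => x j * b + a * y j : C^o) = contr M x * b + a * contr M y.
Proof. by rewrite /contr /GRing.scale /=; ring. Qed.

Lemma tdZ_M e e' M (g h : Fn) u : dif g -> dif h ->
  tdZ (e + e') M (fun u => g u * h u) u = tdZ e M g u * h u + g u * tdZ e' M h u.
Proof. by move=> hg hh; rewrite /tdZ -contrM; apply: contr_eq => j; exact: pderM. Qed.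

Lemma tdZ_euler e k l n (u : reg) :
  tdZ e (fun u => Z u) (fun u => (NV u ^ k *: Qp (val u) ^+ l)`_n) u =
  (2 * k%:~R + e%:R + l%:R) * (NV u ^ k *: Qp (val u) ^+ l)`_n.
Proof.
rewrite /tdZ (contr_eq _ (fun j => pder_NQ e j k l n u)) -contr_coef -coefZ.
pose x : C := k%:~R + e%:R / 2.
rewrite (contr_sym (Z_tr _) (q := (x * NV u ^ (k - 1) * ct (val u)) *: Qp (val u) ^+ l
    + (l%:R * NV u ^ k) *: ('X * Qp (val u) ^+ l.-1))); last by rewrite nN2 dQ2; exact: contr_arg.
have -> : 2 * k%:~R + e%:R + l%:R = 2 * x + l%:R by rewrite /x; field.
rewrite -/x; clearbody x; rewrite nN0 nN1 dQ0 dQ1 !mxE /=.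
have -> : NV u ^ k = NV u ^ (k - 1) * NV u by rewrite -NexpS subrK.
congr (nth 0 (polyseq _) n); move: (NV u ^ (k - 1)) => y.
have iiP : (i%:P : {poly C}) * i%:P = -1 by rewrite -polyCM ii polyCN.
have QpE : Qp (val u) = - (z22 (val u))%:P + 2 * (ct (val u))%:P * 'X + (z11 (val u))%:P * 'X ^+ 2.
  by rewrite /Qp polyCN polyCM polyC_natr.
case: l => [|l].
  rewrite mulr0n NZE /z12 -!mul_polyC !(polyCM, polyCD, polyCN, polyC_exp, polyC0, polyC1, polyC_natr) /=.
  ring: iiP.
rewrite [Qp (val u) ^+ l.+1]exprS /=.
move: (l.+1%:R : C) => L; move: (Qp (val u) ^+ l) => p.
by rewrite NZE /z12 QpE -!mul_polyC !(polyCM, polyCD, polyCN, polyC_exp, polyC1, polyC_natr); ring: iiP.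
Qed.

Lemma P_NQ k l n : @P R (fun u => (NV u ^ k *: Qp (val u) ^+ l)`_n).
Proof. by rewrite PE; exact: (@HS_gen R cT k l). Qed.

Lemma mxP_Z : @mxP R 2 2 (fun u => Z u).
Proof.
move=> a b; have := mulcl_Z hS (@P_nN R) a b (@P_cst R 1).
by rewrite (_ : (fun _ => _) = entry (fun u => Z u) a b) //; apply/funext => u; exact: mulr1.
Qed.

(** The Euler field Tr(Z d) has divergence 3 and multiplies the integrand by its degree 2 k + L + l
    + e. By [int_total] the nonzero sum of the two annihilates the integral. *)
Lemma orthogonal_degree e k L l n n' : 2 * k + L%:Z + l%:Z + e%:Z + 3 != 0 ->
  int_Gamma e (fun u : reg => (NV u ^ k *: Qp (val u) ^+ L)`_n * (NV u ^ 0 *: Qp (val u) ^+ l)`_n') = 0.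
Proof.
move=> hd; set g : Fn := fun u => (NV u ^ k *: Qp (val u) ^+ L)`_n; set h : Fn := fun u => (NV u ^ 0 *: Qp (val u) ^+ l)`_n'.
have Pg : P g := P_NQ k L n; have Ph : P h := P_NQ 0 l n'; have Pgh := PM Pg Ph.
pose d : int := 2 * k + L%:Z + l%:Z + e%:Z + 3.
have := @int_total R e _ Pgh (fun u => Z u) (fun=> 3) mxP_Z.
rewrite (_ : (fun u => _ + 3 * _) = (fun u => d%:~R * (g u * h u))); last first.
  apply/funext => u; have := @tdZ_M e 0 (fun u => Z u) g h u (P_dif Pg) (P_dif Ph).
  rewrite addn0 => ->; rewrite /g /h !tdZ_euler -/(g u) -/(h u) /d.
  rewrite !rmorphD rmorphM /= -!pmulrn; move: (g u) (h u) => x y; ring.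
rewrite (int_GammaZ e _ Pgh) => H.
have : d%:~R * int_Gamma e (fun u => g u * h u) = 0.
  by apply: H => u; rewrite /divg !dmx_Z /dZj !inordK //= !mxE /=; field: ii.
by move/eqP; rewrite mulf_eq0 intr_eq0 (negbTE hd) => /eqP.
Qed.

(** N^k Q^L is the Laplacian of N^(k+1) Q^L divided by c, and Green's formula moves the Laplacian to
    the harmonic Q^l. Given the degree condition, c is a product of nonzero multiples of L + l + 1
    and L - l. *)
Lemma orthogonal_harmonic e k L l n n' : L != l -> 2 * k + L%:Z + l%:Z + e%:Z + 3 = 0 ->
  int_Gamma e (fun u : reg => (NV u ^ k *: Qp (val u) ^+ L)`_n * (NV u ^ 0 *: Qp (val u) ^+ l)`_n') = 0.
Proof.
move=> hL hd; set h : Fn := fun u => (NV u ^ 0 *: Qp (val u) ^+ l)`_n'.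
pose g : Fn := fun u => (NV u ^ (k + 1) *: Qp (val u) ^+ L)`_n.
have Pg : P g := P_NQ (k + 1) L n; have Ph : P h := P_NQ 0 l n'.
pose x : C := (k + 1)%:~R + e%:R / 2; pose c := x * (x + L%:R + 2^-1).
have e1 : 2 * (2 * x) = (- (2 * (L%:Z + l%:Z + 1)))%:~R.
  have := congr1 (fun z : int => (2 * z)%:~R : C) hd.
  rewrite /x !(rmorphM, rmorphD, rmorphN, rmorph0, rmorph1) /= -!pmulrn => e0.
  by apply/eqP; rewrite -subr_eq0; apply/eqP; rewrite -[RHS](mulr0 (1 + 1)) -e0; field.
have x1 : 2 * x = - (L%:R + l%:R + 1).
  apply: (@mulfI _ 2); first by rewrite pnatr_eq0.
  by rewrite e1 !(rmorphM, rmorphD, rmorphN, rmorph1) /= -!pmulrn; ring.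
have c0 : c != 0.
  apply: mulf_neq0.
    apply/eqP => h0; move/eqP: x1; rewrite h0 mulr0 eq_sym oppr_eq0.
    by rewrite -natrD natr1 pnatr_eq0.
  apply/eqP => h0; have : 2 * (x + L%:R + 2^-1) = 0 by rewrite h0 mulr0.
  have -> : 2 * (x + L%:R + 2^-1) = 2 * x + 2 * L%:R + 1 by field.
  rewrite x1 => h1; have : L%:R - l%:R = 0 :> C by rewrite -h1; ring.
  by move/eqP; rewrite subr_eq0 eqr_nat (negbTE hL).
have E : (fun u : reg => (NV u ^ k *: Qp (val u) ^+ L)`_n * h u) = (fun u => c^-1 * (lap e g u * h u)).
  apply/funext => u; rewrite /g lap_NQ -/x -/c addrK mulrA mulrA mulVf // mul1r //.
have Plap : P (lap e g : Fn).
  have -> : lap e g = (fun u => c * (NV u ^ k *: Qp (val u) ^+ L)`_n).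
    by apply/funext => u; rewrite /g lap_NQ addrK.
  exact: (mulcl_cst c hS (P_NQ k L n)).
rewrite E (int_GammaZ e _ (PM Plap Ph)) (green e Pg Ph).
rewrite (_ : (fun u => _) = (0 : Fn)) ?int_Gamma0 ?mulr0 //.
by apply/funext => u; rewrite /h lap_NQ mulr0n add0r mul0r !mul0r mulr0.
Qed.

Lemma pairing_vanishes e (c d : int -> nat -> Prop) :
  (forall k l k', c k l -> d k' l -> 2 * (k + k') + 2 * l%:Z + e%:Z + 3 <> 0) ->
  forall g h : Fn, HS c g -> HS d h -> int_Gamma e (fun u => g u * h u) = 0.
Proof.
move=> hcd g h hg hh.
suff H : [set g | P g /\ int_Gamma e (fun u => g u * h u) = 0] g by case: H.
have Ph : P h by rewrite PE; apply: HS_sub hh.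
move: g hg; apply: HS_ind.
  split=> [|a g g' [Pg Ig] [Pg' Ig']].
    split; first exact: hS.1.
    by rewrite (_ : (fun u => _) = (0 : Fn)) ?int_Gamma0 //; apply/funext => u; exact: mul0r.
  split; first exact: hS.2.
  rewrite (_ : (fun u => _) = a *: (fun u => g u * h u : C^o) + (fun u => g' u * h u)).
    by rewrite (int_Gamma_lin e a (PM Pg Ph) (PM Pg' Ph)) Ig Ig' mulr0 addr0.
  by apply/funext => u; rewrite !lin_fct mulrDl mulrA.
move=> k L hc n; split; first exact: P_NQ.
suff H : [set h | P h /\ int_Gamma e (fun u => (NV u ^ k *: Qp (val u) ^+ L)`_n * h u) = 0] h by case: H.
have Pg := P_NQ k L n.
move: h hh {Ph}; apply: HS_ind.
  split=> [|a g' g'' [Pg' Ig] [Pg'' Ig']].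
    split; first exact: hS.1.
    by rewrite (_ : (fun u => _) = (0 : Fn)) ?int_Gamma0 //; apply/funext => u; exact: mulr0.
  split; first exact: hS.2.
  rewrite (_ : (fun u => _) = a *: (fun u : reg => (NV u ^ k *: Qp (val u) ^+ L)`_n * g' u : C^o)
     + (fun u => (NV u ^ k *: Qp (val u) ^+ L)`_n * g'' u)).
    by rewrite (int_Gamma_lin e a (PM Pg Pg') (PM Pg Pg'')) Ig Ig' mulr0 addr0.
  by apply/funext => u; rewrite !lin_fct mulrDr mulrCA.
move=> k' l hd n'; split; first exact: P_NQ.
have -> : (fun u : reg => (NV u ^ k *: Qp (val u) ^+ L)`_n * (NV u ^ k' *: Qp (val u) ^+ l)`_n') =
   (fun u => (NV u ^ (k + k') *: Qp (val u) ^+ L)`_n * (NV u ^ 0 *: Qp (val u) ^+ l)`_n').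
  by apply/funext => u; rewrite !coefZ expfzDr ?Nneq0 // expr0z; ring.
have [E|ne] := eqVneq (2 * (k + k') + L%:Z + l%:Z + e%:Z + 3) 0; last exact: orthogonal_degree.
apply: orthogonal_harmonic => //; apply/eqP => eL; rewrite {}eL in hc E.
by apply: (hcd _ _ _ hc hd); rewrite -[RHS]E; ring.
Qed.

(** Q^l is homogeneous of degree l in the coordinates, and each coordinate takes one factor r. The
    cases used are r = 1 and r = N^(-1). *)
Lemma mulcl_Q (S : set Fn) (r : reg -> C) l n : subsp S ->
  (forall j, mulcl S (fun u => r u * nN j (val u))) ->
  mulcl S (fun u => r u ^+ l * (Qp (val u) ^+ l)`_n).
Proof.
move=> sS hr; elim: l n => [|l IH] n.
  by apply: mulcl_eq (mulcl_cst (n == 0)%:R sS) _ => u; rewrite !expr0 mul1r coef1.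
have IHX m : mulcl S (fun u => r u ^+ l * ('X * Qp (val u) ^+ l)`_m).
  case: m => [|m]; last by apply: mulcl_eq (IH m) _ => u; rewrite coefXM.
  by apply: mulcl_eq (mulcl_cst 0 sS) _ => u; rewrite coefXM mulr0.
have IHXX m : mulcl S (fun u => r u ^+ l * ('X^2 * Qp (val u) ^+ l)`_m).
  case: m => [|m]; last by apply: mulcl_eq (IHX m) _ => u; rewrite coef_XX.
  by apply: mulcl_eq (mulcl_cst 0 sS) _ => u; rewrite coefXnM mulr0.
have E (u : reg) (p : {poly C}) : (Qp (val u) * p)`_n =
    - z22 (val u) * p`_n + 2 * ct (val u) * ('X * p)`_n + z11 (val u) * ('X^2 * p)`_n.
  rewrite /Qp [_ * p]mulrDl [(_ + _%:P * 'X) * p]mulrDl !coefD.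
  by rewrite -[(2 * ct _)%:P * _ * _]mulrA -[(z11 _)%:P * _ * _]mulrA !coefCM.
apply: mulcl_eq (mulclD sS (mulclD sS (mulclM (mulcl_cst (-1) sS) (mulclM (hr j0) (IH n)))
   (mulclM (hr j2) (IHX n))) (mulclM (hr j1) (IHXX n))) _ => u.
by rewrite nN0 nN1 nN2 [Qp _ ^+ l.+1]exprS E [r u ^+ l.+1]exprS; ring.
Qed.

Definition cpos (k : int) (l : nat) : Prop := 0 <= k.
Definition cneg (m : int) (k : int) (l : nat) : Prop := k <= - (l%:Z + m).

Lemma HS_cK0_mul (g h : Fn) : HS (cK 0) g -> HS (cK 0) h -> HS cpos (fun u => g u * h u).
Proof.
have hP := @HS_subsp R cpos.
have hn j : mulcl (HS cpos) (fun u : reg => 1 * nN j (val u)).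
  apply: (@mulcl_eq R _ (fun u => nN j (val u))) => [|u]; last by rewrite mul1r.
  by apply: HS_mulnN => k l; rewrite /cpos; lia.
move=> hg hh; have : HS cpos h by apply: HS_sub hh => k l /cK0 ->.
move: h {hh}; rewrite -/(mulcl (HS cpos) g).
suff : [set g : Fn | mulcl (HS cpos) g] g by [].
move: g hg; apply: HS_ind.
  split=> [h _|a g g' hg hg' h hh]; first by apply: sub_eq hP.1 _ => u; rewrite mul0r.
  apply: sub_eq (hP.2 a _ _ (hg h hh) (hg' h hh)) _ => u.
  by rewrite !lin_fct mulrDl mulrA.
move=> k l /cK0 -> n; apply: mulcl_eq (mulcl_Q l n hP hn) _ => u.
by rewrite expr1n mul1r expr0z scale1r.
Qed.

(** N^(-l-1) Q^l is N^(-1) times a polynomial of degree l in the functions N^(-1) n_j, which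
    preserve [cneg 1]; the remaining factor N^(-1) leads to [cneg 2]. *)
Lemma HS_cK1_mul (g h : Fn) : HS (cK 1) g -> HS (cK 1) h -> HS (cneg 2) (fun u => g u * h u).
Proof.
have hP := @HS_subsp R (cneg 2); have hP1 := @HS_subsp R (cneg 1).
have hn j : mulcl (HS (cneg 1)) (fun u : reg => NV u ^ (- 1) * nN j (val u)).
  by apply: mulcl_NnN => k l; rewrite /cneg; lia.
move=> hg hh; have : HS (cneg 1) h by apply: HS_sub hh => k l /cK1 ->; rewrite /cneg.
move: h {hh}; pose T := [set g : Fn | forall h, HS (cneg 1) h -> HS (cneg 2) (fun u => g u * h u)].
suff : T g by [].
move: g hg; apply: HS_ind.
  split=> [h _|a g g' hg hg' h hh]; first by apply: sub_eq hP.1 _ => u; rewrite mul0r.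
  apply: sub_eq (hP.2 a _ _ (hg h hh) (hg' h hh)) _ => u.
  by rewrite !lin_fct mulrDl mulrA.
move=> k l /cK1 -> n h /(mulcl_Q l n hP1 hn) hh.
have H : forall k l, cneg 1 k l -> cneg 2 (k + - 1) l by move=> ? ?; rewrite /cneg; lia.
apply: sub_eq (HS_mulN H hh) _ => u; rewrite !coefZ.
have -> : NV u ^ (- (l%:Z + 1)) = NV u ^ (- 1) * (NV u ^ (- 1)) ^+ l.
  rewrite (_ : - (l%:Z + 1) = - 1 - l%:Z); last by lia.
    by rewrite expfzDr ?Nneq0 // exprN1 exprVn -exprnN.
by rewrite -!mulrA.
Qed.

Lemma HS_P c : @HS R c `<=` @P R. Proof. by rewrite PE; exact: HS_sub. Qed.

Lemma Vrow_harmonic e (g : reg -> 'rV[C]_2) q : Vrow e g -> HS (cK e) (entry g 0 q).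
Proof.
by move=> /Vrow_tr/(@Vcol_harmonic R e _ q) H; apply: sub_eq H _ => u; rewrite /entry trE.
Qed.

Lemma Vrow_harmonicZ e (g : reg -> 'rV[C]_2) q : Vrow e g ->
  HS (cK e) (fun u => (g u *m Z u) 0 q).
Proof.
move=> /Vrow_tr/(@Vcol_harmonicZ R e _ q) H; apply: sub_eq H _ => u.
by rewrite -[in LHS](Z_tr (val u)) -trmx_mul trE.
Qed.

Lemma int_sandwich e (c d : int -> nat -> Prop) (g : reg -> 'rV[C]_2) (H : MF) (f : reg -> 'cV[C]_2) :
  (forall k l k', c k l -> d k' l -> 2 * (k + k') + 2 * l%:Z + e%:Z + 3 <> 0) ->
  (forall p q, HS c (entry H p q)) ->
  (forall p q, HS d (fun u => g u 0 p * f u q 0)) ->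
  int_Gamma e (fun u => (g u *m H u *m f u) 0 0) = 0.
Proof.
move=> hcd hH hgf; pose G p q : Fn := fun u => entry H p q u * (g u 0 p * f u q 0).
have PG p q : P (G p q) by exact: PM (HS_P (hH p q)) (HS_P (hgf p q)).
have IG p q : int_Gamma e (G p q) = 0 by exact: pairing_vanishes (hH p q) (hgf p q).
have PD (a b : Fn) : P a -> P b -> P (fun u => a u + b u : C^o) by exact: subspD.
rewrite (_ : (fun u => _) = (fun u => (G 0 0 u + G 1 0 u) + (G 0 1 u + G 1 1 u))).
  rewrite int_GammaD; [|exact: PD..].
  by rewrite !int_GammaD // !IG !addr0.
by apply/funext => u; rewrite !mulmx2E /G /entry; ring.
Qed.

(** With k >= - l - 1, k' >= 0 and total level 1, the sum 2 (k + k') + 2 l + 4 is at least 2, so no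
    pairing survives. *)
Lemma tau_Eplus : tau_vanishes 0 (@Eplus R).
Proof.
move=> g F f hg; rewrite EplusE => -[hF _] hf; rewrite /tau.
rewrite (@int_sandwich _ cplus cpos) ?mulr0 // => [k l k'|p q].
  by rewrite /cplus /cpos; lia.
exact: HS_cK0_mul (Vrow_harmonic p hg) (Vcol_harmonic q hf).
Qed.

(** With k <= - 2, k' <= - l - 2 and total level 3, the sum 2 (k + k') + 2 l + 6 is at most - 2. *)
Lemma tau_Eminus : tau_vanishes 1 (@Eminus R).
Proof.
move=> g F f hg /EminusP[hH _] hf; rewrite /tau.
rewrite (_ : (fun u => _) = (fun u => ((g u *m Z u) *m desand F u *m (Z u *m f u)) 0 0)).
  rewrite (@int_sandwich _ cminus (cneg 2)) ?mulr0 // => [k l k'|p q].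
    by rewrite /cminus /cneg; lia.
  exact: HS_cK1_mul (Vrow_harmonicZ p hg) (Vcol_harmonicZ q hf).
by apply/funext => u; rewrite -[in LHS](desandK F u) !mulmxA.
Qed.

Lemma tau_lin e a (g g1 g2 : reg -> 'rV[C]_2) (F F1 F2 : MF) (f f1 f2 : reg -> 'cV[C]_2) :
  mxP g1 -> mxP F1 -> mxP f1 -> mxP g2 -> mxP F2 -> mxP f2 ->
  (forall u, g u *m F u *m f u = a *: (g1 u *m F1 u *m f1 u) + g2 u *m F2 u *m f2 u) ->
  tau e g F f = a * tau e g1 F1 f1 + tau e g2 F2 f2.
Proof.
move=> h1 h2 h3 h1' h2' h3' E; rewrite /tau [a * _]mulrCA -mulrDr; congr (_ * _).
have P1 : P (fun u => (g1 u *m F1 u *m f1 u) 0 0 : C^o) by exact: (mxPM (mxPM h1 h2) h3).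
have P2 : P (fun u => (g2 u *m F2 u *m f2 u) 0 0 : C^o) by exact: (mxPM (mxPM h1' h2') h3').
rewrite -(int_Gamma_lin _ a P1 P2); congr (int_Gamma _); apply/funext => u.
by rewrite E mxDE mxZE.
Qed.

Lemma tau_trilinear e : trilinear_on (@Vrow R e) (@W R) (@Vcol R e) (@tau R e).
Proof.
split=> [a g g' F f [hg _] [hg' _] [hF _] [hf _]|a g F F' f [hg _] [hF _] [hF' _] [hf _]
        |a g F f f' [hg _] [hF _] [hf _] [hf' _]]; apply: tau_lin => // u.
- by rewrite -[(a *: g + g') u]/(a *: g u + g' u) !mulmxDl -!scalemxAl.
- by rewrite -[(a *: F + F') u]/(a *: F u + F' u) mulmxDr mulmxDl -scalemxAr -scalemxAl.
by rewrite -[(a *: f + f') u]/(a *: f u + f' u) mulmxDr -scalemxAr.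
Qed.

Lemma Eplus_subspace : lsubspace (@W R) (@Eplus R).
Proof.
have [h0 hlin] : subsp (@Eplus R) by exact: lspan_subsp.
by split=> //; rewrite EplusE => F [hF sF]; split=> // p q; exact: HS_P (hF p q).
Qed.

Lemma Eminus_subspace : lsubspace (@W R) (@Eminus R).
Proof.
have [h0 hlin] : subsp (@Eminus R) by exact: lspan_subsp.
split=> //.
move=> F /EminusP[hH sH]; have -> : F = (fun u => Z u *m desand F u *m Z u).
  by apply/funext => u; rewrite desandK.
split=> [|u]; last by rewrite !trmx_mul Z_tr sH mulmxA.
by apply: mxPM mxP_Z; apply: mxPM mxP_Z _ => p q; exact: HS_P (hH p q).
Qed.

(** The form on cosets is tau at a representative in W picked by [xget]; two representatives differ
    by an element of E, where tau vanishes. *)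
Lemma exists_induced_form e (E : set MF) g0 F0 f0 : lsubspace (@W R) E ->
  @tau_vanishes R e E -> @Vrow R e g0 -> @W R F0 -> @Vcol R e f0 -> tau e g0 F0 f0 != 0 ->
  exists beta, @induced_form R e E beta /\ @nontrivial_form R e E beta.
Proof.
move=> [EW E0 Elin] hE hg0 hF0 hf0 t0.
pose rep Q : MF := xget 0 [set F | W F /\ Q = coset_mod E F].
pose beta g Q f : C := tau e g (rep Q) f.
have H : induced_form e E beta.
  move=> g F f hg hF hf; rewrite /beta.
  have [WF' eF'] : W (rep (coset_mod E F)) /\ coset_mod E F = coset_mod E (rep (coset_mod E F)).
    by rewrite /rep; apply: (@xgetPex _ 0 [set F' | W F' /\ coset_mod E F = coset_mod E F']); exists F.
  set F' := rep _ in WF' eF' *.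
  have EF : E (F - F').
    suff : coset_mod E F' F by [].
    by rewrite -eF' /coset_mod /= subrr.
  have := @tau_lin e 1 g g g F (F - F') F' f f f hg.1 (EW _ EF).1 hf.1 hg.1 WF'.1 hf.1.
  rewrite (hE g _ f hg EF hf) mulr0 add0r => -> // u.
  by rewrite -[(F - F') u]/(F u - F' u) scale1r -mulmxDl -mulmxDr subrK.
exists beta; split; first exact: H.
exists g0, (coset_mod E F0), f0; split; [exact: hg0|by exists F0|exact: hf0|].
by rewrite (H _ _ _ hg0 hF0 hf0).
Qed.

Lemma tau_cst_neq0 : i / (8 * pi ^+ 2 : R)%:C%C != 0 :> C.
Proof.
have p0 : 8 * pi ^+ 2 != 0 :> R by rewrite mulf_neq0 ?pnatr_eq0 // expf_neq0 // gt_eqF // pi_gt0.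
rewrite mulf_neq0 ?invr_eq0 //; last by rewrite -[0]/((0 : R)%:C%C) (inj_eq (@complexI R)).
by apply/eqP => h; have := ii; rewrite h mul0r => /eqP; rewrite eq_sym oppr_eq0 oner_eq0.
Qed.

Lemma nontrivial_plus : exists g F f,
  [/\ @Vrow R 0 g, @W R F, @Vcol R 0 f & tau 0 g F f != 0].
Proof.
pose g : reg -> 'rV[C]_2 := fun=> delta_mx 0 0; pose f : reg -> 'cV[C]_2 := fun=> delta_mx 0 0.
(* N^(-3/2) is represented by N^(-2) at level 1, and k = - 2 solves 1 + 3 + 2 k = 0 in
   [int_Gamma_N]. *)
pose F : MF := fun u => symmx (NV u ^ (- 2)) 0 0.
have dp p q (h : Fn) c u : h = (fun=> c) -> dZplus 0 p q h u = 0.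
  move=> ->; rewrite /dZplus /d_z11 /d_z22 /d_t !pder0_cst mulr0.
  by case: p q => [[|[|//]] ?] [[|[|//]] ?].
exists g, F, f; split.
- split=> [p q|u q]; first by exact: (@P_cst R).
  by apply: big1 => p _; exact: (@dp p q _ (delta_mx 0 0 0 p : C)).
- split=> [p q|u]; last exact: symmx_tr.
  case: p q => [[|[|//]] ?] [[|[|//]] ?]; rewrite /entry.
  + by apply: sub_eq (@P_Nexp R (- 2)) _ => u; rewrite mxE.
  + by apply: sub_eq hS.1 _ => u; rewrite mxE.
  + by apply: sub_eq hS.1 _ => u; rewrite mxE.
  by apply: sub_eq hS.1 _ => u; rewrite mxE.
- split=> [p q|u p]; first by exact: (@P_cst R).
  by apply: big1 => q _; exact: (@dp p q _ (delta_mx 0 0 q 0 : C)).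
rewrite /tau mulf_neq0 ?tau_cst_neq0 //.
rewrite (_ : (fun u => _) = (fun u => NV u ^ (- 2))); first exact: int_Gamma_N.
by apply/funext => u; rewrite !mulmx2E !mxE /= !(mulr0, mul0r, addr0, mulr1, mul1r).
Qed.

Lemma Vcol_tr e (f : reg -> 'cV[C]_2) : Vcol e f -> Vrow e (fun u => (f u)^T).
Proof.
move=> [hf E]; split=> [p q|u q].
  by apply: sub_eq (hf q p) _ => u; rewrite /entry mxE.
rewrite -[RHS](E u q); apply: eq_bigr => p _; rewrite /dZplus addnC.
by rewrite (_ : entry _ 0 p = entry f p 0) //; apply/funext => v; rewrite /entry mxE.
Qed.

Lemma nontrivial_minus : exists g F f,
  [/\ @Vrow R 1 g, @W R F, @Vcol R 1 f & tau 1 g F f != 0].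
Proof.
(* Here too level 1 lowers the displayed exponents by 1/2: N^(-2) stands for N^(-3/2), and in [F]
   the inverse of N for N^(-1/2). *)
pose f0 : Fn := fun u => NV u ^ (- 2) * z22 (val u).
pose f1 : Fn := fun u => NV u ^ (- 2) * (- i * ct (val u)).
pose f : reg -> 'cV[C]_2 := fun u => \col_p nth 0 [:: f0 u; f1 u] p.
pose F : MF := fun u => (NV u)^-1 *: (Z u *m symmx 1 0 0 *m Z u).
have hf : Vcol 1 f.
  have e0 : f0 = entry f 0 0 by apply/funext => u; rewrite /entry mxE.
  have e1 : f1 = entry f 1 0 by apply/funext => u; rewrite /entry mxE.
  have P2 := @P_Nexp R (- 2).
  have P0 : P f0 by apply: sub_eq (mulcl_z22 (@P_nN R) P2) _ => u; rewrite mulrC.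
  have P1 : P f1.
    by apply: sub_eq (subspZ (- i) hS (mulcl_ct hS (@P_nN R) P2)) _ => u; rewrite scl_fct /f1; ring.
  have D0 j : pd0 j f0 _ := pd0M (pd0_Nexp j (- 2)) (let: And3 _ h _ := pd0_coord R j in h).
  have D1 j : pd0 j f1 _ := pd0M (pd0_Nexp j (- 2)) (pd0Z (- i) (let: And3 _ _ h := pd0_coord R j in h)).
  have n3 (u : reg) : NV u ^ (- 2 - 1) = (NV u * NV u * NV u)^-1 by rewrite NexpP NexpN2 -invfM.
  split=> [p q|u p].
    rewrite ord1; case: p => [[|[|//]] hp].
      by rewrite (_ : Ordinal hp = 0) -?e0 //; exact: val_inj.
    by rewrite (_ : Ordinal hp = 1) -?e1 //; exact: val_inj.
  have N0 := Nneq0 u.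
  rewrite sum2 -e0 -e1 /dZplus /d_z11 /d_z22 /d_t.
  case: p => [[|[|//]] hp] /=; rewrite (pderE 1 u (D0 _)) (pderE 1 u (D1 _)) n3 NexpN2 /f0 /f1 NexpN2;
    rewrite ?nN0 ?nN1 ?nN2 !inordK //=; move: N0; rewrite NZE => N0; field: ii; exact: N0.
exists (fun u => (f u)^T), F, f; split=> //; first exact: Vcol_tr.
  split=> [|u]; last by rewrite linearZ /= !trmx_mul Z_tr symmx_tr mulmxA.
  have hN : mulcl (@P R) (fun u => (NV u)^-1) by apply: P_mulcl; exact: (@P_Nexp R (- 1)).
  apply: (mxSZ hN); apply: mxPM mxP_Z; apply: mxPM mxP_Z _ => p q; exact: (@P_cst R).
rewrite /tau mulf_neq0 ?tau_cst_neq0 //.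
(* The product Z f is N^(-1) e1, so the integrand is N^(-1) N^(-2), at level 3. *)
rewrite (_ : (fun u => _) = (fun u => NV u ^ (- 3))); first exact: int_Gamma_N.
apply/funext => u; have N0 := Nneq0 u.
have -> : NV u ^ (- 3) = (NV u * NV u * NV u)^-1 by rewrite -expr2 -exprSr.
rewrite /F /Zmx symmx_sand symmxZ !mulmx2E !mxE /= /f0 /f1 NexpN2 /z12.
by move: N0; rewrite NZE => N0; field: ii; exact: N0.
Qed.

End Vanishing.

Theorem proposition114 (R : realType) :
  (* tau_+ (e = 0) and tau_- (e = 1) are invariant trilinear forms *)
  (forall e : nat, (e < 2)%N ->
     trilinear_on (@Vrow R e) (@W R) (@Vcol R e) (@tau R e)
     /\ tau_sp4_invariant R e) /\
  (* E_+ and E_- are invariant subspaces, annihilated by tau_+ and tau_- *)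
  [/\ lsubspace (@W R) (@Eplus R), sp4_stable (@Eplus R)
    & tau_vanishes 0 (@Eplus R)] /\
  [/\ lsubspace (@W R) (@Eminus R), sp4_stable (@Eminus R)
    & tau_vanishes 1 (@Eminus R)] /\
  (* the induced forms exist and are not identically zero *)
  (exists beta, induced_form 0 (@Eplus R) beta
     /\ nontrivial_form 0 (@Eplus R) beta) /\
  (exists beta, induced_form 1 (@Eminus R) beta
     /\ nontrivial_form 1 (@Eminus R) beta).
Proof.
split=> [e _|]; first by split; [exact: tau_trilinear|exact: tau_invariant].
split; first by split; [exact: Eplus_subspace|exact: Eplus_stable|exact: tau_Eplus].
split; first by split; [exact: Eminus_subspace|exact: Eminus_stable|exact: tau_Eminus].
split.
  have [g [F [f [hg hF hf ht]]]] := nontrivial_plus R.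
  exact: exists_induced_form (@Eplus_subspace R) (@tau_Eplus R) hg hF hf ht.
have [g [F [f [hg hF hf ht]]]] := nontrivial_minus R.
exact: exists_induced_form (@Eminus_subspace R) (@tau_Eminus R) hg hF hf ht.
Qed.
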